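(* Let $p\in(0,1]$ and $k\in\mathbb{N}$ be constants and let $P>(1-p)^{2^{k-1}}\varphi$, where $\varphi=\frac{1}{2}(\sqrt{5}+1)$ is the golden ratio. Suppose that for any model in $\mathcal{D}_{\ge p}(Q_k)$, the probability that the random spanning subgraph of $Q_k$ is connected is at least $P$. Then there exists $C>0$ such that for $n\in\mathbb{N}$, and any model in $\mathcal{D}_{\ge p}(Q_n)$, there is a component of the random subgraph containing at least $C\cdot 2^n$ vertices with probability at least $1-e^{-\Omega(n^2)}$.
   Context: $Q_n$ is the $n$-dimensional hypercube graph with vertex set $\{0,1\}^n$, two vertices being adjacent iff they differ in exactly one coordinate. A bond percolation model on a graph $G$ is a probability distribution on the spanning subgraphs of $G$; an edge is open if it is present in the random subgraph and closed otherwise. The model is 1-independent if, for any two disjoint sets of edges $S_1$, $S_2$ of $G$ such that no edge in $S_1$ shares a vertex with an edge in $S_2$, the states (open or closed) of the edges in $S_1$ are independent of the states of the edges in $S_2$. $\mathcal{D}_{\ge p}(G)$ is the class of 1-independent bond percolation models on $G$ in which each edge is open with probability at least $p$. The notation $1-e^{-\Omega(n^2)}$ is the usual asymptotic one as $n\to\infty$: there are a constant $c>0$ and an $n_0$, depending only on the fixed constants ($p,k,P$) and not on $n$ or on the model, such that the probability is at least $1-e^{-cn^2}$ for all $n\ge n_0$. *)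

(* Defs.v *)
From HB Require Import structures.
From mathcomp Require Import all_boot all_order all_algebra.
From mathcomp Require Import reals sequences exp.

Set Implicit Arguments.
Unset Strict Implicit.
Unset Printing Implicit Defensive.

Import Order.TTheory GRing.Theory Num.Theory.

Local Open Scope ring_scope.

Record sgraph := SGraph {
  vertex : finType;
  adj : rel vertex;
  adj_sym : symmetric adj;
  adj_irrefl : irreflexive adj }.

Arguments adj : clear implicits.

Definition edges (G : sgraph) : {set {set vertex G}} :=
  [set [set x; y] | x in [set: vertex G], y in [set: vertex G] & adj G x y].

Definition cube_adj (n : nat) : rel {ffun 'I_n -> bool} :=
  fun x y => #|[set i | x i != y i]| == 1%N.

Lemma cube_adj_sym (n : nat) : symmetric (@cube_adj n).
Proof.
move=> x y; rewrite /cube_adj; congr (_ == _); apply: eq_card => i.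
by rewrite !inE eq_sym.
Qed.

Lemma cube_adj_irrefl (n : nat) : irreflexive (@cube_adj n).
Proof.
move=> x; rewrite /cube_adj (_ : [set i | _] = set0) ?cards0 //.
by apply/setP => i; rewrite !inE eqxx.
Qed.

Definition hypercube (n : nat) : sgraph :=
  SGraph (@cube_adj_sym n) (@cube_adj_irrefl n).

(* A spanning subgraph is identified with its set of edges. *)
Definition subgraph (G : sgraph) := {set {set vertex G}}.

Definition sub_adj (G : sgraph) (H : subgraph G) : rel (vertex G) :=
  fun x y => (x != y) && ([set x; y] \in H).

Definition components (G : sgraph) (H : subgraph G) : {set {set vertex G}} :=
  equivalence_partition (connect (sub_adj H)) [set: vertex G].

Definition connected_subgraph (G : sgraph) (H : subgraph G) : bool :=
  [forall x, forall y, connect (sub_adj H) x y].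

(* Since the graph is finite, a probability distribution on its spanning
   subgraphs is given by its mass function. *)
Record bond_model (R : realType) (G : sgraph) := BondModel {
  mass :> {ffun subgraph G -> R};
  mass_ge0 : forall H, 0 <= mass H;
  mass_sum1 : \sum_H mass H = 1;
  mass_supp : forall H, mass H != 0 -> H \subset edges G }.

Definition Pr (R : realType) (G : sgraph) (M : bond_model R G)
    (A : pred (subgraph G)) : R :=
  \sum_(H | A H) M H.

(* The states of the edges in S are recorded by H :&: S. *)
Definition one_independent (R : realType) (G : sgraph)
    (M : bond_model R G) : Prop :=
  forall S1 S2 : {set {set vertex G}},
    S1 \subset edges G -> S2 \subset edges G -> [disjoint S1 & S2] ->
    (forall e f, e \in S1 -> f \in S2 -> [disjoint e & f]) ->
  forall A1 A2 : {set {set vertex G}},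
    Pr M (fun H => (H :&: S1 == A1) && (H :&: S2 == A2)) =
    Pr M (fun H => H :&: S1 == A1) * Pr M (fun H => H :&: S2 == A2).

Definition one_independent_ge (R : realType) (G : sgraph) (p : R)
    (M : bond_model R G) : Prop :=
  one_independent M /\
  forall e, e \in edges G -> p <= Pr M (fun H => e \in H).

Definition golden (R : realType) : R := (Num.sqrt 5 + 1) / 2.

(* Main.v *)
Require Import Defs.
From mathcomp Require Import all_boot all_order all_algebra.
From mathcomp Require Import reals sequences exp.
From mathcomp Require Import ring lra zify.

(** Split the coordinates of Q_n into N + k and call a copy of Q_k active when
    it is connected (probability at least P) and two neighbouring copies joined
    when one of the 2^k edges between them is open (probability at least 1 - q,
    q = (1-p)^(2^k)).  The golden-ratio hypothesis says exactly that
    (P - q/P)^2 > q.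

    Take r disjoint blocks of M ~ N/r coordinates of Q_N.  Around a base z there
    are M^r leaves, obtained by flipping one coordinate in each block, and
    r M^(r-1) hubs, obtained by omitting one block; a leaf is adjacent to r hubs.
    After revealing, for each hub, its activity and the attachment of boundedly
    many pinned leaves, the remaining attachments of a typical hub are nearly
    uncorrelated (otherwise pinning another leaf would raise a bounded energy),
    so the number of attached leaves concentrates.  Designate for each leaf one
    hub whose label predicts attachment with probability at least
    s = P(leaf active) - q/P - eps.  At z and at a neighbouring base z + g, any
    2-colouring of the components of the designated hubs that separates
    eps M^r pairs fails to be linked only with probability exp(-c M^r), because
    s^2 > q, and there are only 2^(O(M^(r-1))) colourings.  So the designated
    hubs of a leaf at z and at z + g are nearly always connected.  Choosing g
    inside a block and using the symmetry of the two bases, the designated hubs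
    of a leaf and of its modification in one block are mostly connected, whence
    one component contains most designated hubs, and then more than half of
    the active leaves.  A component with such a majority at z also has it at
    z + g, so it is the same for all bases and has linear size.  All failure
    probabilities are exp(-c M^(r-1)) with r >= 4, which survives the union bound
    over the 2^N N pairs (z, g) and leaves room for exp(-c n^2). *)

Set Implicit Arguments.
Unset Strict Implicit.
Unset Printing Implicit Defensive.
Import Order.TTheory GRing.Theory Num.Theory.
Local Open Scope ring_scope.

(** * Finite probability spaces *)

(** The value of s: the copies at a hub and at a neighbouring leaf are disjoint, so an active hub
    does not bias the leaf's activity, and all edges between them are closed with conditional
    probability at most q/P. Averaged over the labels of an active hub, the predicted attachment is
    thus at least P(leaf active) - q/P; giving up eps makes a single label reach it with probability
    bounded below. The obstacle is that the attachments of a leaf to its r hubs, and its edges to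
    the leaf at z + g, all use the copy at that leaf and may be correlated in any way. Designating
    one hub per leaf makes the stars vertex-disjoint, hence independent given the labels. The edges
    between the two leaves are combined with the attachments by counting only: a proportion s^2 of
    pairs attached on both sides does not fit into a proportion q of pairs with all edges closed. A
    majority of the active leaves needs 2 (P - q/P) > P. This too follows from the golden ratio:
    with b^2 = q, P^2 > b P + b^2 > 2 b^2. The number r must be large because each of the r
    coordinate changes loses the leaves without a designated hub, a proportion that decays
    exponentially in r. *)

Section Expectation.
Variables (R : realType) (O : finType) (mu : O -> R).
Hypothesis mu_ge0 : forall w, 0 <= mu w.
Hypothesis mu_sum1 : \sum_w mu w = 1.

Definition Ex (f : O -> R) : R := \sum_w mu w * f w.
Definition Prb (A : pred O) : R := Ex (fun w => (A w)%:R).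

Lemma eq_Ex f g : f =1 g -> Ex f = Ex g.
Proof. by move=> fg; apply: eq_bigr => w _; rewrite fg. Qed.

Lemma ExD f g : Ex (fun w => f w + g w) = Ex f + Ex g.
Proof. by rewrite /Ex -big_split; apply: eq_bigr => w _; rewrite mulrDr. Qed.

Lemma ExZ c f : Ex (fun w => c * f w) = c * Ex f.
Proof. by rewrite /Ex big_distrr; apply: eq_bigr => w _; rewrite mulrCA. Qed.

Lemma ExZr c f : Ex (fun w => f w * c) = Ex f * c.
Proof. by rewrite mulrC -ExZ; apply: eq_Ex => w; rewrite mulrC. Qed.

Lemma ExN f : Ex (fun w => - f w) = - Ex f.
Proof. by rewrite /Ex -sumrN; apply: eq_bigr => w _; rewrite mulrN. Qed.

Lemma ExB f g : Ex (fun w => f w - g w) = Ex f - Ex g.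
Proof. by rewrite ExD ExN. Qed.

Lemma Ex_cst c : Ex (fun=> c) = c.
Proof. by rewrite /Ex -big_distrl /= mu_sum1 mul1r. Qed.

Lemma Ex_sum (I : finType) (Q : pred I) (f : I -> O -> R) :
  Ex (fun w => \sum_(i | Q i) f i w) = \sum_(i | Q i) Ex (f i).
Proof.
rewrite /Ex exchange_big; apply: eq_bigr => w _ /=.
by rewrite big_distrr.
Qed.

Lemma ler_Ex f g : (forall w, f w <= g w) -> Ex f <= Ex g.
Proof. by move=> fg; apply: ler_sum => w _; apply: ler_wpM2l. Qed.

Lemma Ex_ge0 f : (forall w, 0 <= f w) -> 0 <= Ex f.
Proof. by move=> f0; apply: sumr_ge0 => w _; apply: mulr_ge0. Qed.

Lemma Prb_ge0 A : 0 <= Prb A.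
Proof. by apply: Ex_ge0 => w; rewrite ler0n. Qed.

Lemma Prb_le1 A : Prb A <= 1.
Proof. by rewrite -[leRHS](Ex_cst 1); apply: ler_Ex => w; case: (A w). Qed.

Lemma sub_Prb A B : subpred A B -> Prb A <= Prb B.
Proof.
move=> AB; apply: ler_Ex => w; rewrite ler_nat.
by case: (boolP (A w)) => // /AB ->.
Qed.

Lemma PrbC A : Prb (fun w => ~~ A w) = 1 - Prb A.
Proof.
rewrite -[1](Ex_cst 1) -ExB; apply: eq_Ex => w.
by case: (A w); rewrite ?subrr ?subr0.
Qed.

Lemma Prb_has (I : finType) (Q : pred I) (A : I -> pred O) :
  Prb (fun w => [exists i, Q i && A i w]) <= \sum_(i | Q i) Prb (A i).
Proof.
rewrite -Ex_sum; apply: ler_Ex => w.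
case: existsP => [[i /andP[Qi Ai]]|_]; last first.
  by apply: sumr_ge0 => i _; rewrite ler0n.
by rewrite (bigD1 i) //= Ai lerDl sumr_ge0 // => j _; rewrite ler0n.
Qed.

Lemma Prb_or A B : Prb (fun w => A w || B w) <= Prb A + Prb B.
Proof.
rewrite -ExD; apply: ler_Ex => w; rewrite -natrD ler_nat.
by case: (A w); case: (B w).
Qed.

Section Conditional.
Variable (L : finType).
Implicit Types (lam : O -> L).

Definition label_prb lam l : R := Ex (fun w => (lam w == l)%:R).
(** On a label of probability 0 the division returns 0; after multiplication by the probability,
    [ce_pl] needs no case distinction. *)
Definition cexp lam (f : O -> R) l : R := Ex (fun w => (lam w == l)%:R * f w) / label_prb lam l.

Lemma pl_ge0 lam l : 0 <= label_prb lam l. Proof. exact: Prb_ge0. Qed.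

Lemma pl_sum lam : \sum_l label_prb lam l = 1.
Proof.
rewrite -Ex_sum -[RHS](Ex_cst 1); apply: eq_Ex => w.
rewrite (bigD1 (lam w)) //= eqxx big1 ?addr0 // => l.
by rewrite eq_sym => /negbTE ->.
Qed.

Lemma pl_eq0 lam l f : label_prb lam l = 0 -> Ex (fun w => (lam w == l)%:R * f w) = 0.
Proof.
move=> /eqP; rewrite psumr_eq0; last by move=> w _; rewrite mulr_ge0.
move=> /allP p0; rewrite /Ex big1 // => w _.
have /= /eqP := p0 w (mem_index_enum w).
by rewrite mulrA => ->; rewrite mul0r.
Qed.

Lemma ce_pl lam f l : cexp lam f l * label_prb lam l = Ex (fun w => (lam w == l)%:R * f w).
Proof.
have [p0|p0] := eqVneq (label_prb lam l) 0; last by rewrite /cexp divfK.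
by rewrite p0 mulr0 pl_eq0.
Qed.

Lemma Ex_split lam f : Ex f = \sum_l Ex (fun w => (lam w == l)%:R * f w).
Proof.
rewrite -Ex_sum; apply: eq_Ex => w.
rewrite (bigD1 (lam w)) //= eqxx mul1r big1 ?addr0 // => l.
by rewrite eq_sym => /negbTE ->; rewrite mul0r.
Qed.

Lemma Ex_ce lam f (g : L -> R) :
  Ex (fun w => cexp lam f (lam w) * g (lam w)) = Ex (fun w => f w * g (lam w)).
Proof.
rewrite (Ex_split lam) [RHS](Ex_split lam); apply: eq_bigr => l _.
transitivity (Ex (fun w => (lam w == l)%:R * (cexp lam f l * g l))).
  by apply: eq_Ex => w; case: eqP => [->|]; rewrite ?mul0r.
rewrite ExZr mulrA [_ * cexp _ _ _]mulrC ce_pl -ExZr.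
by apply: eq_Ex => w; case: eqP => [->|]; rewrite ?mul0r ?mul1r.
Qed.

Lemma ceB lam f g l : cexp lam (fun w => f w - g w) l = cexp lam f l - cexp lam g l.
Proof.
rewrite /cexp -mulrBl -ExB; congr (_ / _); apply: eq_Ex => w; exact: mulrBr.
Qed.

Lemma ce_Ml lam (g : L -> R) f l : cexp lam (fun w => g (lam w) * f w) l = g l * cexp lam f l.
Proof.
rewrite /cexp mulrA -ExZ; congr (_ / _); apply: eq_Ex => w.
by case: eqP => [->|]; rewrite ?mul0r ?mulr0 // !mul1r.
Qed.

Lemma ce_ge0 lam f l : (forall w, 0 <= f w) -> 0 <= cexp lam f l.
Proof.
move=> f0; rewrite divr_ge0 ?pl_ge0 // Ex_ge0 // => w.
by rewrite mulr_ge0.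
Qed.

Lemma ce_le1 lam f l : (forall w, f w <= 1) -> cexp lam f l <= 1.
Proof.
move=> f1; rewrite /cexp.
have := pl_ge0 lam l; rewrite le_eqVlt => /orP[/eqP <-|p0].
  by rewrite invr0 mulr0.
rewrite ler_pdivrMr // mul1r; apply: ler_Ex => w.
by rewrite -[leRHS]mulr1 ler_wpM2l.
Qed.

Lemma Ex_ce_sq lam f :
  Ex (fun w => cexp lam f (lam w) ^+ 2) <= Ex (fun w => f w ^+ 2).
Proof.
have h : 0 <= Ex (fun w => (f w - cexp lam f (lam w)) ^+ 2).
  by apply: Ex_ge0 => w; exact: sqr_ge0.
have e1 := Ex_ce lam f (cexp lam f).
have e2 : Ex (fun w => (f w - cexp lam f (lam w)) ^+ 2) =
   Ex (fun w => f w ^+ 2) - 2 * Ex (fun w => f w * cexp lam f (lam w))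
   + Ex (fun w => cexp lam f (lam w) ^+ 2).
  rewrite -ExZ -ExB -ExD; apply: eq_Ex => w; ring.
have e3 : Ex (fun w => cexp lam f (lam w) ^+ 2) =
  Ex (fun w => cexp lam f (lam w) * cexp lam f (lam w)).
  by apply: eq_Ex => w; rewrite expr2.
lra.
Qed.

Definition ccov lam f g l : R :=
  cexp lam (fun w => f w * g w) l - cexp lam f l * cexp lam g l.

End Conditional.

Section Refinement.
Variables (L L' : finType) (lam : O -> L) (lam' : O -> L') (phi : L' -> L).
Hypothesis lamE : forall w, lam w = phi (lam' w).

(** Pythagoras: the increment of the conditional expectation along a refinement is orthogonal to the
    coarser conditional expectation, which is what [e2] expresses. *)
Lemma ce_gain f :
  Ex (fun w => cexp lam' f (lam' w) ^+ 2) =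
  Ex (fun w => cexp lam f (lam w) ^+ 2) +
  Ex (fun w => (cexp lam' f (lam' w) - cexp lam f (lam w)) ^+ 2).
Proof.
have e1 := Ex_ce lam f (cexp lam f).
have e2 : Ex (fun w => cexp lam' f (lam' w) * cexp lam f (lam w)) =
          Ex (fun w => f w * cexp lam f (lam w)).
  have := Ex_ce lam' f (fun l => cexp lam f (phi l)).
  by under eq_Ex do rewrite -lamE; under [RHS]eq_Ex do rewrite -lamE.
have e3 : Ex (fun w => (cexp lam' f (lam' w) - cexp lam f (lam w)) ^+ 2) =
   Ex (fun w => cexp lam' f (lam' w) ^+ 2)
   - 2 * Ex (fun w => cexp lam' f (lam' w) * cexp lam f (lam w))
   + Ex (fun w => cexp lam f (lam w) * cexp lam f (lam w)).
  rewrite -ExZ -ExB -ExD; apply: eq_Ex => w; ring.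
have e4 : Ex (fun w => cexp lam f (lam w) ^+ 2) =
  Ex (fun w => cexp lam f (lam w) * cexp lam f (lam w)).
  by apply: eq_Ex => w; rewrite expr2.
lra.
Qed.

(** As [g] is read off the finer label, [f] may be replaced by [cexp lam' f] in the covariance,
    which becomes the coarse conditional expectation of the increment times [g]. Jensen and the
    bound on [g] conclude. *)
Lemma cov_gain f (g : L' -> R) : (forall l, `|g l| <= 1) ->
  Ex (fun w => ccov lam f (fun w => g (lam' w)) (lam w) ^+ 2) <=
  Ex (fun w => (cexp lam' f (lam' w) - cexp lam f (lam w)) ^+ 2).
Proof.
move=> g1.
pose D w := (cexp lam' f (lam' w) - cexp lam f (lam w)) * g (lam' w).
have covE w : ccov lam f (fun w => g (lam' w)) (lam w) = cexp lam D (lam w).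
  rewrite /ccov -(ce_Ml lam (cexp lam f)).
  have -> : cexp lam (fun w => f w * g (lam' w)) (lam w) =
            cexp lam (fun w => cexp lam' f (lam' w) * g (lam' w)) (lam w).
    rewrite /cexp; congr (_ / _).
    have e := Ex_ce lam' f (fun l => (phi l == lam w)%:R * g l).
    transitivity (Ex (fun w0 => f w0 * ((phi (lam' w0) == lam w)%:R * g (lam' w0)))).
      by apply: eq_Ex => w0; rewrite -lamE mulrCA.
    by rewrite -e; apply: eq_Ex => w0; rewrite -lamE mulrCA.
  rewrite -ceB /D; congr (cexp lam _ _).
  by apply: boolp.funext => w0; rewrite mulrBl.
under eq_Ex do rewrite covE.
apply: le_trans (Ex_ce_sq _ _) _; apply: ler_Ex => w.
rewrite /D exprMn -[leRHS]mulr1 ler_wpM2l ?sqr_ge0 //.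
by rewrite -real_normK ?num_real // expr_le1.
Qed.

End Refinement.
End Expectation.

(** * Pinning and the decay of conditional covariances *)

Section Pinning.
Variables (R : realType) (O : finType) (mu : O -> R).
Hypothesis mu_ge0 : forall w, 0 <= mu w.
Hypothesis mu_sum1 : \sum_w mu w = 1.
Local Notation Ex := (Ex mu).
Local Notation cexp := (cexp mu).
Variable M : nat.
Implicit Types (b : O -> bool) (x : 'I_M -> O -> bool) (A P : {set 'I_M}).

(** Slots outside [P] are masked by false, so that all pin sets share one label type and enlarging
    [P] refines the label. *)
Definition pin_label b x P (w : O) : bool * {ffun 'I_M -> bool} :=
  (b w, [ffun a => (a \in P) && x a w]).

Definition pin_cov b x A P (l : bool * {ffun 'I_M -> bool}) : R :=
  \sum_(a in A) \sum_(c in A)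
    ccov mu (pin_label b x P) (fun w => (x a w)%:R) (fun w => (x c w)%:R) l ^+ 2.

Definition pin_energy b x P : R :=
  \sum_a Ex (fun w => cexp (pin_label b x P) (fun w => (x a w)%:R) (pin_label b x P w) ^+ 2).

Lemma pin_energy_le b x P : pin_energy b x P <= M%:R.
Proof.
have -> : M%:R = \sum_(a < M) (1 : R) by rewrite sumr_const card_ord.
apply: ler_sum => a _.
apply: le_trans (Ex_ce_sq mu_ge0 _ _) _.
rewrite -[leRHS](Ex_cst mu_sum1 1); apply: ler_Ex => // w.
by case: (x a w) => /=; rewrite -natrX (ler_nat _ _ 1).
Qed.

Lemma pin_energy_ge0 b x P : 0 <= pin_energy b x P.
Proof. by apply: sumr_ge0 => a _; apply: Ex_ge0 => // w; exact: sqr_ge0. Qed.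

Lemma pin_label_refine b x P c w :
  pin_label b x P w =
  (fun l : bool * {ffun 'I_M -> bool} => (l.1, [ffun a => (a \in P) && l.2 a]))
    (pin_label b x (c |: P) w).
Proof.
congr pair; apply/ffunP => a; rewrite !ffunE !inE.
by case: (a \in P); rewrite ?orbT ?andbF.
Qed.

(** [ce_gain] splits the increase over the slots; [cov_gain] bounds each part below by the
    covariance with slot [c], whose value is part of the finer label. *)
Lemma pin_energy_gain b x A P c :
  pin_energy b x P +
  \sum_(a in A) Ex (fun w => ccov mu (pin_label b x P) (fun w => (x a w)%:R)
     (fun w => (x c w)%:R) (pin_label b x P w) ^+ 2)
  <= pin_energy b x (c |: P).
Proof.
rewrite /pin_energy [leRHS](eq_bigr _ (fun a _ =>
  ce_gain mu_ge0 (@pin_label_refine b x P c) (fun w => (x a w)%:R))).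
rewrite big_split lerD2l /=.
apply: (@le_trans _ _ (\sum_(a in A) Ex (fun w =>
  (cexp (pin_label b x (c |: P)) (fun w0 => (x a w0)%:R) (pin_label b x (c |: P) w) -
   cexp (pin_label b x P) (fun w0 => (x a w0)%:R) (pin_label b x P w)) ^+ 2))).
  apply: ler_sum => a aA.
  have := cov_gain mu_ge0 (@pin_label_refine b x P c) (fun w => (x a w)%:R)
    (g := fun l : bool * {ffun 'I_M -> bool} => (l.2 c)%:R).
  have -> : (fun w => ((pin_label b x (c |: P) w).2 c)%:R) = (fun w => (x c w)%:R) :> (O -> R).
    by apply: boolp.funext => w; rewrite ffunE !inE eqxx.
  by apply=> l; case: (l.2 c); rewrite ?normr1 ?normr0.
rewrite [leRHS](bigID (mem A)) /= lerDl sumr_ge0 // => a _.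
by apply: Ex_ge0 => // w; exact: sqr_ge0.
Qed.

(* Pinning a slot whose conditional covariances with the others are large on
   average raises the energy; as the energy is bounded, boundedly many pins
   suffice. *)
Lemma pinning (I : finType) (wt : I -> R) (b : I -> O -> bool)
    (x : I -> 'I_M -> O -> bool) A (v : R) (T : nat) :
  (forall i, 0 <= wt i) -> 0 < v -> 1 < T.+1%:R * v ->
  exists P, [/\ P \subset A, (#|P| <= T)%N &
    \sum_i wt i * Ex (fun w => pin_cov (b i) (x i) A P (pin_label (b i) (x i) P w))
    <= v * M%:R ^+ 2 * \sum_i wt i].
Proof.
move=> wt0 v0 Tv.
pose bad P := \sum_i wt i * Ex (fun w => pin_cov (b i) (x i) A P (pin_label (b i) (x i) P w)).
pose W := \sum_i wt i.
pose En P := \sum_i wt i * pin_energy (b i) (x i) P.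
have W0 : 0 <= W by apply: sumr_ge0.
case: (boolP [exists P : {set 'I_M}, [&& P \subset A, (#|P| <= T)%N & bad P <= v * M%:R ^+ 2 * W]]).
  by case/existsP => P /and3P[? ? ?]; exists P.
rewrite negb_exists => /forallP nex.
(* If no set of at most [T] pins works, each of [T.+1] successive pins raises the energy by
   [v * M%:R * W], which takes it past its bound [M%:R * W]. *)
have step k : (k <= T.+1)%N ->
  exists P : {set 'I_M}, [/\ P \subset A, (#|P| <= k)%N & k%:R * v * M%:R * W <= En P].
  elim: k => [_|k IH kT].
    exists set0; split; rewrite ?sub0set ?cards0 // !mul0r.
    by apply: sumr_ge0 => i _; rewrite mulr_ge0 ?pin_energy_ge0.
  have [P [PA Pk EP]] := IH (ltnW kT).
  have := nex P; rewrite PA (leq_trans Pk) //= -ltNge => Pbad.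
  pose gain c := \sum_i wt i * \sum_(a in A)
    Ex (fun w => ccov mu (pin_label (b i) (x i) P) (fun w => (x i a w)%:R)
     (fun w => (x i c w)%:R) (pin_label (b i) (x i) P w) ^+ 2).
  have badE : bad P = \sum_(c in A) gain c.
    rewrite /gain exchange_big; apply: eq_bigr => i _ /=.
    rewrite -big_distrr /=; congr (_ * _); rewrite exchange_big /= /pin_cov Ex_sum.
    by apply: eq_bigr => a _; rewrite Ex_sum.
  (* Averaging: the total exceeds v M^2 W and there are at most M candidates. *)
  have [c cA gc] : exists2 c, c \in A & v * M%:R * W <= gain c.
    apply/exists_inP; apply: contraLR Pbad; rewrite negb_exists_in => /forall_inP h.
    rewrite -leNgt badE.
    apply: (@le_trans _ _ (\sum_(c in A) v * M%:R * W)).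
      by apply: ler_sum => c cA; rewrite ltW // ltNge h.
    rewrite sumr_const -[_ *+ #|A|]mulr_natl.
    apply: (@le_trans _ _ (M%:R * (v * M%:R * W))).
      apply: ler_wpM2r; first by rewrite !mulr_ge0 // ltW.
      by rewrite ler_nat -[leqRHS]card_ord max_card.
    by rewrite le_eqVlt; apply/orP; left; apply/eqP; ring.
  exists (c |: P); split.
  - by rewrite subUset sub1set cA.
  - by rewrite cardsU1; case: (c \in P) => /=; rewrite ?add0n ?add1n // ltnW.
  have : En P + gain c <= En (c |: P).
    rewrite -big_split; apply: ler_sum => i _ /=; rewrite -mulrDr.
    by rewrite ler_wpM2l // pin_energy_gain.
  rewrite -natr1; lra.
have [P [_ _ EP]] := step T.+1 (leqnn _).
have EnM : En P <= M%:R * W.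
  rewrite mulrC /W big_distrl /=; apply: ler_sum => i _.
  by rewrite ler_wpM2l // pin_energy_le.
have Mgt : ~~ (0 < M%:R * W :> R).
  apply/negP => MW; have : T.+1%:R * v * (M%:R * W) <= 1 * (M%:R * W).
    by rewrite mul1r; apply: le_trans EnM; rewrite mulrA.
  by rewrite ler_pM2r // leNgt Tv.
(* Only this degenerate case survives; then both sides vanish for the empty pin set. *)
have MW0 : M%:R * W = 0 by apply/eqP; rewrite eq_le mulr_ge0 // leNgt Mgt.
exists set0; split; rewrite ?sub0set ?cards0 //.
rewrite -/W.
have [M0|M0] := eqVneq M 0%N.
  rewrite [X in _ <= X](_ : _ = 0); last by rewrite M0 expr0n mulr0 mul0r.
  rewrite big1 // => i _; rewrite (_ : Ex _ = 0) ?mulr0 //.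
  rewrite -(Ex_cst mu_sum1 0); apply: eq_Ex => w; rewrite /pin_cov big1 // => a.
  by move: (ltn_ord a); rewrite {2}M0.
have W00 : W = 0.
  by move/eqP: MW0; rewrite mulf_eq0 pnatr_eq0 (negbTE M0) => /eqP.
rewrite W00 mulr0 big1 // => i _.
have /eqP := W00; rewrite psumr_eq0 // => /allP/(_ i (mem_index_enum i)) /eqP ->.
by rewrite mul0r.
Qed.

End Pinning.

(** * Independence and exponential moments *)

Lemma expR_ge1_nneg (R : realType) (y : R) : 0 <= y -> 1 <= expR y.
Proof. by move=> y0; rewrite -expR0 ler_expR. Qed.

(** Everything comes from (1 - y) e^y <= 1. For y >= 0 it reads e^y - 1 <= y e^y, to be used twice;
    for y < 0 compare with (1 - y)(1 + y + y^2) = 1 - y^3 >= 1. *)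
Lemma expR_le_quad (R : realType) (y t : R) :
  `|y| <= t -> expR y <= 1 + y + y ^+ 2 * expR t.
Proof.
move=> yt.
have h1 : (1 - y) * expR y <= 1.
  have := expR_ge1Dx (- y); rewrite expRN => h.
  have e0 := expR_gt0 y.
  by rewrite -(ler_pM2r e0) mulVf ?gt_eqF // in h.
have et : 1 <= expR t by rewrite expR_ge1_nneg // (le_trans _ yt).
have [y0|y0] := lerP 0 y.
  have eyt : expR y <= expR t by rewrite ler_expR (le_trans _ yt) // ler_norm.
  have h2 : expR y - 1 <= y * expR y by lra.
  have h3 : y * (expR y - 1) <= y * (y * expR y) by rewrite ler_wpM2l.
  have h4 : y ^+ 2 * expR y <= y ^+ 2 * expR t by rewrite ler_wpM2l ?sqr_ge0.
  rewrite expr2 in h4 *; lra.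
have h2 : 1 <= (1 - y) * (1 + y + y ^+ 2).
  have -> : (1 - y) * (1 + y + y ^+ 2) = 1 - y * y ^+ 2 by ring.
  by rewrite lerBrDl gerDr mulr_le0_ge0 ?sqr_ge0 // ltW.
have h3 : expR y <= 1 + y + y ^+ 2.
  by rewrite -(@ler_pM2l _ (1 - y)) ?subr_gt0 ?(lt_trans y0) // (le_trans h1).
have h4 : y ^+ 2 * 1 <= y ^+ 2 * expR t by rewrite ler_wpM2l ?sqr_ge0.
lra.
Qed.

Section Independence.
Variables (R : realType) (O : finType) (mu : O -> R).
Hypothesis mu_ge0 : forall w, 0 <= mu w.
Hypothesis mu_sum1 : \sum_w mu w = 1.
Local Notation Ex := (Ex mu).
Local Notation Prb := (Prb mu).
Local Notation cexp := (cexp mu).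
Local Notation label_prb := (label_prb mu).
Variables (V : finType) (res : {set V} -> O -> O).
Hypothesis res_sub : forall (U U' : {set V}) w, U \subset U' -> res U (res U' w) = res U w.
Hypothesis res_indep : forall U1 U2 : {set V}, [disjoint U1 & U2] -> forall A1 A2,
  Prb (fun w => (res U1 w == A1) && (res U2 w == A2)) =
  Prb (fun w => res U1 w == A1) * Prb (fun w => res U2 w == A2).

(** Measurability with respect to what happens inside [U], asked of every configuration and not only
    of those with positive mass. *)
Definition dep (U : {set V}) (T : Type) (f : O -> T) := forall w, f (res U w) = f w.

Lemma dep_sub (U U' : {set V}) T (f : O -> T) : U \subset U' -> dep U f -> dep U' f.
Proof. by move=> UU' df w; rewrite -df res_sub. Qed.

Lemma dep_app2 U T1 T2 T' (g : T1 -> T2 -> T') f1 f2 :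
  dep U f1 -> dep U f2 -> dep U (fun w => g (f1 w) (f2 w)).
Proof. by move=> d1 d2 w; rewrite d1 d2. Qed.

Lemma Ex_res U f : dep U f -> Ex f = \sum_a f a * Prb (fun w => res U w == a).
Proof.
move=> df; under [RHS]eq_bigr do rewrite -ExZ.
rewrite -Ex_sum; apply: eq_Ex => w.
rewrite (bigD1 (res U w)) //= eqxx mulr1 df big1 ?addr0 // => a.
by rewrite eq_sym => /negbTE ->; rewrite mulr0.
Qed.

Lemma Ex_indep (U1 U2 : {set V}) f g : [disjoint U1 & U2] -> dep U1 f -> dep U2 g ->
  Ex (fun w => f w * g w) = Ex f * Ex g.
Proof.
move=> dis df dg; rewrite (Ex_res df) (Ex_res dg) big_distrl /=.
transitivity (\sum_a \sum_c f a * g c * Prb (fun w => (res U1 w == a) && (res U2 w == c))).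
  under eq_bigr => a _ do under eq_bigr => c _ do rewrite -ExZ.
  under eq_bigr => a _ do rewrite -Ex_sum.
  rewrite -Ex_sum; apply: eq_Ex => w.
  rewrite (bigD1 (res U1 w)) //= [X in _ + X]big1 ?addr0; last first.
    move=> a; rewrite eq_sym => /negbTE n; rewrite big1 // => c _.
    by rewrite n /= mulr0.
  rewrite (bigD1 (res U2 w)) //= !eqxx mulr1 df dg big1 ?addr0 // => c.
  by rewrite eq_sym => /negbTE n; rewrite n /= mulr0.
apply: eq_bigr => a _; rewrite big_distrr /=; apply: eq_bigr => c _.
by rewrite res_indep // mulrACA.
Qed.

(** Conditioning on the value of [f] freezes the parameter of [F], and then the two factors live on
    disjoint sets. This serves for weights that are random on the opposite side. *)
Lemma Ex_freeze (U1 U2 : {set V}) (T : finType) (f : O -> T) (g : T -> R) (F : T -> O -> R) B :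
  [disjoint U1 & U2] -> dep U1 f -> (forall a, dep U2 (F a)) ->
  (forall a, 0 <= g a) -> (forall a, Ex (F a) <= B) ->
  Ex (fun w => g (f w) * F (f w) w) <= Ex (fun w => g (f w)) * B.
Proof.
move=> dis df dF g0 FB; rewrite (Ex_split mu f) [X in _ <= X * _](Ex_split mu f).
rewrite big_distrl /=; apply: ler_sum => a _.
have -> : Ex (fun w => (f w == a)%:R * (g (f w) * F (f w) w)) =
          Ex (fun w => ((f w == a)%:R * g a) * F a w).
  by apply: eq_Ex => w; rewrite mulrA; case: eqP => [->|]; rewrite ?mul0r.
rewrite (Ex_indep dis _ (dF a)); last by move=> w; rewrite df.
have -> : Ex (fun w => (f w == a)%:R * g (f w)) = Ex (fun w => (f w == a)%:R * g a).
  by apply: eq_Ex => w; case: eqP => [->|]; rewrite ?mul0r.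
by apply: ler_wpM2l => //; apply: Ex_ge0 => // w; rewrite mulr_ge0.
Qed.

Lemma Ex_prod (I : finType) (Q : pred I) (U : I -> {set V}) (f : I -> O -> R) :
  (forall i j, Q i -> Q j -> i != j -> [disjoint U i & U j]) ->
  (forall i, Q i -> dep (U i) (f i)) ->
  Ex (fun w => \prod_(i | Q i) f i w) = \prod_(i | Q i) Ex (f i).
Proof.
move=> dis df; rewrite -[RHS]big_filter.
transitivity (Ex (fun w => \prod_(i <- [seq i <- index_enum I | Q i]) f i w)).
  by apply: eq_Ex => w; rewrite big_filter.
have : all Q [seq i <- index_enum I | Q i] by exact: filter_all.
have : uniq [seq i <- index_enum I | Q i] by rewrite filter_uniq // index_enum_uniq.
elim: [seq i <- index_enum I | Q i] => [_ _|i s IH /= /andP[iNs us] /andP[Qi Qs]].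
  by rewrite big_nil -[RHS](Ex_cst mu_sum1); apply: eq_Ex => w; rewrite big_nil.
rewrite big_cons -IH // -(@Ex_indep (U i) (\bigcup_(j in s) U j)).
- by apply: eq_Ex => w; rewrite big_cons.
- apply: bigcup_disjoint => j js; rewrite dis //.
    by rewrite (allP Qs).
  by apply: contraNneq iNs => ->.
- exact: df.
- move=> w; apply: eq_big_seq => j js; apply: (dep_sub (U := U j)).
    exact: bigcup_sup.
  by apply: df; rewrite (allP Qs).
Qed.

Lemma Ex_exp_markov (g D : O -> R) (a : R) : (forall w, 0 <= g w) ->
  Ex (fun w => g w * (a <= D w)%R%:R) <= expR (- a) * Ex (fun w => g w * expR (D w)).
Proof.
move=> g0; rewrite -ExZ; apply: ler_Ex => // w.
rewrite mulrCA; apply: ler_wpM2l => //; rewrite -expRD.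
case: (lerP a (D w)) => [aD|_] /=; last by rewrite expR_ge0.
by rewrite addrC expR_ge1_nneg // subr_ge0.
Qed.

(** * Concentration of the attachment counts given the labels *)

Section Stars.
Variables (Hb Pt L : finType) (lam : Hb -> O -> L) (x : Hb -> Pt -> O -> bool).
Variables (sl : Hb -> {set V}) (lv : Pt -> V) (inc : Hb -> Pt -> bool) (B v : R).
Hypothesis lam_dep : forall h, dep (sl h) (lam h).
Hypothesis x_dep : forall h S, inc h S -> dep (lv S |: sl h) (x h S).
Hypothesis sl_disj : forall h h', h != h' -> [disjoint sl h & sl h'].
Hypothesis lv_sl : forall h S, lv S \notin sl h.
Hypothesis lv_inj : injective lv.
Hypothesis B_gt0 : 0 < B.
Hypothesis v_ge0 : 0 <= v.
Hypothesis inc_card : forall h, #|[set S | inc h S]|%:R <= B.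

Definition attach h S l : R := cexp (lam h) (fun w => (x h S w)%:R) l.

(* The covariance bound: the conditional variance of
   every weighted count of the attachments to [h] is at most [v B^2]. *)
Definition regular h l := forall wt : Pt -> R, (forall S, 0 <= wt S <= 1) ->
  (forall S, wt S != 0 -> inc h S) ->
  Ex (fun w => (lam h w == l)%:R * (\sum_S wt S * (attach h S l - (x h S w)%:R)) ^+ 2)
    <= v * B ^+ 2 * label_prb (lam h) l.

Section FixedLabels.
Variables (l : {ffun Hb -> L}) (d : Pt -> option Hb).
Hypothesis d_inc : forall S h, d S = Some h -> inc h S.
Hypothesis d_reg : forall S h, d S = Some h -> regular h (l h).

Definition star_dev (wt : Pt -> R) h w : R :=
  \sum_(S | d S == Some h) wt S * (attach h S (l h) - (x h S w)%:R).

(** The star of [h]: the support of its label together with the leaves designated to it. A leaf has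
    only one designated hub, so stars are disjoint although each leaf neighbours several hubs. *)
Let blk h := sl h :|: [set lv S | S in [set S | d S == Some h]].

Lemma blk_disj h h' : h != h' -> [disjoint blk h & blk h'].
Proof.
move=> hh'; rewrite -setI_eq0; apply/eqP/setP => u; rewrite !inE.
apply/negP => /andP[/orP[uh|/imsetP[S dS eu]] /orP[uh'|/imsetP[S' dS' eu']]].
- by have := sl_disj hh'; rewrite disjoint_subset => /subsetP/(_ u uh); rewrite inE uh'.
- by move: (lv_sl h S'); rewrite -eu' uh.
- by move: (lv_sl h' S); rewrite -eu uh'.
- have SS' : S = S' by apply: lv_inj; rewrite -eu -eu'.
  move: dS dS' hh'; rewrite !inE SS' => /eqP -> /eqP[->].
  by rewrite eqxx.
Qed.

Lemma blk_dep_lam h : dep (blk h) (lam h).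
Proof. by apply: dep_sub (lam_dep h); exact: subsetUl. Qed.

Lemma blk_dep_x h S : d S = Some h -> dep (blk h) (x h S).
Proof.
move=> dS; apply: dep_sub (x_dep (d_inc dS)).
rewrite subUset subsetUl andbT sub1set inE; apply/orP; right.
by apply/imsetP; exists S; rewrite ?inE ?dS.
Qed.

Lemma star_dev_le (wt : Pt -> R) h w : (forall S, 0 <= wt S <= 1) -> `|star_dev wt h w| <= B.
Proof.
move=> wt01; apply: le_trans (ler_norm_sum _ _ _) _; apply: le_trans (inc_card h).
apply: (@le_trans _ _ (\sum_(S | d S == Some h) 1)).
  apply: ler_sum => S _; rewrite normrM mulr_ile1 //.
    by rewrite ger0_norm; case/andP: (wt01 S).
  have a0 : 0 <= attach h S (l h) by apply: ce_ge0 => // w'; rewrite ler0n.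
  have a1 : attach h S (l h) <= 1 by apply: ce_le1 => // w'; case: (x h S w').
  by rewrite ler_norml; case: (x h S w) => /=; lra.
rewrite sumr_const ler_nat subset_leq_card //; apply/subsetP => S.
by move=> dS; rewrite inE; apply: d_inc; apply/eqP; exact: dS.
Qed.

(** In the quadratic bound for the exponential, the linear term vanishes because [attach] is the
    conditional mean, and the quadratic one is controlled by [regular]; [star_dev_le] keeps the
    exponent within [t]. *)
Lemma star_mgf1 (wt : Pt -> R) t h : (forall S, 0 <= wt S <= 1) -> 0 <= t ->
  Ex (fun w => (lam h w == l h)%:R * expR (t * (star_dev wt h w / B))) <=
  label_prb (lam h) (l h) * expR (t ^+ 2 * expR t * v).
Proof.
move=> wt01 t0; set p := label_prb _ _; have p0 : 0 <= p by exact: pl_ge0.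
pose D w := star_dev wt h w.
have B0 : B != 0 by rewrite gt_eqF.
have D0 : Ex (fun w => (lam h w == l h)%:R * D w) = 0.
  transitivity (\sum_(S | d S == Some h) wt S *
     (Ex (fun w => (lam h w == l h)%:R * attach h S (l h)) -
      Ex (fun w => (lam h w == l h)%:R * (x h S w)%:R))).
    under [RHS]eq_bigr do rewrite -ExB -ExZ.
    rewrite -Ex_sum; apply: eq_Ex => w; rewrite /D /star_dev big_distrr /=.
    by apply: eq_bigr => S _; ring.
  by rewrite big1 // => S _; rewrite ExZr mulrC -(ce_pl mu_ge0) [X in X - _]mulrC subrr mul0r.
have D2 : Ex (fun w => (lam h w == l h)%:R * D w ^+ 2) <= v * B ^+ 2 * p.
  case: (pickP (fun S => d S == Some h)) => [S0 /eqP dS0|none]; last first.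
    rewrite (_ : Ex _ = 0).
      by rewrite mulr_ge0 // mulr_ge0 // exprn_ge0 // ltW.
    rewrite -[RHS](Ex_cst mu_sum1); apply: eq_Ex => w.
    by rewrite /D /star_dev big_pred0 // expr0n mulr0.
  (* The weights are extended by 0 to the leaves not designated to [h], since [regular] sums over
     all leaves. *)
  have := d_reg dS0 (wt := fun S => if d S == Some h then wt S else 0).
  move=> H; apply: le_trans (H _ _).
  - rewrite le_eqVlt; apply/orP; left; apply/eqP; apply: eq_Ex => w.
    congr (_ * _ ^+ 2); rewrite /D /star_dev [LHS]big_mkcond; apply: eq_bigr => S _.
    by case: eqP => //; rewrite mul0r.
  - by move=> S; case: eqP => // _; rewrite lexx ler01.
  - by move=> S; case: (d S =P Some h) => [dS _|_]; [exact: d_inc dS | rewrite eqxx].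
apply: (@le_trans _ _ (Ex (fun w => (lam h w == l h)%:R + t / B * ((lam h w == l h)%:R * D w)
   + t ^+ 2 * expR t / B ^+ 2 * ((lam h w == l h)%:R * D w ^+ 2)))).
  apply: ler_Ex => // w.
  have h1 : `|t * (D w / B)| <= t.
    rewrite normrM ger0_norm // ler_piMr // normrM normfV (gtr0_norm B_gt0).
    by rewrite ler_pdivrMr // mul1r star_dev_le.
  have := expR_le_quad h1; rewrite -/(D w) => h2.
  case: eqP => _ /=; last by rewrite !mul0r !mulr0 !addr0.
  rewrite !mul1r; apply: le_trans h2 _; rewrite le_eqVlt; apply/orP; left; apply/eqP.
  by field.
rewrite !ExD !ExZ D0 mulr0 addr0 -/(label_prb _ _) -/p.
apply: (@le_trans _ _ (p + t ^+ 2 * expR t / B ^+ 2 * (v * B ^+ 2 * p))).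
  rewrite lerD2l; apply: ler_wpM2l => //; apply: divr_ge0; last exact: sqr_ge0.
  by apply: mulr_ge0; [exact: sqr_ge0 | exact: expR_ge0].
have -> : p + t ^+ 2 * expR t / B ^+ 2 * (v * B ^+ 2 * p) = p * (1 + t ^+ 2 * expR t * v).
  by field.
by rewrite ler_wpM2l // expR_ge1Dx.
Qed.

Lemma star_mgf (wt : Pt -> R) t : (forall S, 0 <= wt S <= 1) -> 0 <= t ->
  Ex (fun w => ([forall h, lam h w == l h])%:R * expR (t / B * \sum_h star_dev wt h w)) <=
  (\prod_h label_prb (lam h) (l h)) * expR (#|Hb|%:R * (t ^+ 2 * expR t * v)).
Proof.
move=> wt01 t0.
have -> : Ex (fun w => ([forall h, lam h w == l h])%:R * expR (t / B * \sum_h star_dev wt h w))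
  = Ex (fun w => \prod_h ((lam h w == l h)%:R * expR (t * (star_dev wt h w / B)))).
  apply: eq_Ex => w; rewrite big_split /=; congr (_ * _).
    case: forallP => [al|]; first by rewrite big1 // => h _; rewrite al.
    move=> /forallP; rewrite negb_forall => /existsP[h nh].
    by rewrite (bigD1 h) //= (negbTE nh) mul0r.
  rewrite -expR_sum big_distrr /=; congr expR; apply: eq_bigr => h _; ring.
rewrite (Ex_prod (U := blk)); first last.
- move=> h _ w.
  have ds : star_dev wt h (res (blk h) w) = star_dev wt h w.
    by apply: eq_bigr => S /eqP dS; rewrite (blk_dep_x dS).
  by rewrite ds (blk_dep_lam h w).
- by move=> h h' _ _; exact: blk_disj.
have -> : #|Hb|%:R * (t ^+ 2 * expR t * v) = \sum_(h : Hb) (t ^+ 2 * expR t * v).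
  by rewrite sumr_const mulr_natl.
rewrite expR_sum -big_split /=; apply: ler_prod => h _.
rewrite star_mgf1 // andbT; apply: Ex_ge0 => // w.
by rewrite mulr_ge0 ?expR_ge0.
Qed.

Lemma star_tail (wt : Pt -> R) t a : (forall S, 0 <= wt S <= 1) -> 0 <= t ->
  Ex (fun w => ([forall h, lam h w == l h])%:R * (a <= \sum_h star_dev wt h w)%R%:R) <=
  (\prod_h label_prb (lam h) (l h)) * expR (#|Hb|%:R * (t ^+ 2 * expR t * v) - t * a / B).
Proof.
move=> wt01; rewrite le_eqVlt => /orP[/eqP <-|t0].
  rewrite expr0n /= !mul0r mulr0 subrr expR0 mulr1.
  apply: (le_trans _ (le_trans (star_mgf wt01 (lexx 0)) _)).
    apply: ler_Ex => // w; rewrite ler_wpM2l // !mul0r expR0.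
    by case: (a <= \sum_h star_dev wt h w)%R.
  by rewrite expr0n /= !mul0r mulr0 expR0 mulr1.
apply: (@le_trans _ _ (Ex (fun w => ([forall h, lam h w == l h])%:R *
    (t * a / B <= t / B * \sum_h star_dev wt h w)%R%:R))).
  rewrite le_eqVlt; apply/orP; left; apply/eqP; apply: eq_Ex => w.
  have -> : t * a / B = t / B * a by rewrite mulrAC.
  by rewrite ler_pM2l ?divr_gt0.
apply: le_trans (Ex_exp_markov _ _ _) _ => //.
rewrite addrC expRD mulrCA.
by apply: ler_wpM2l; [exact: expR_ge0 | apply: star_mgf => //; exact: ltW].
Qed.

End FixedLabels.
End Stars.
End Independence.

(** * Linking the designated hubs at two neighbouring bases *)

Section Linking.
Variables (R : realType) (O : finType) (mu : O -> R).
Hypothesis mu_ge0 : forall w, 0 <= mu w.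
Hypothesis mu_sum1 : \sum_w mu w = 1.
Local Notation Ex := (Ex mu).
Local Notation Prb := (Prb mu).
Local Notation cexp := (cexp mu).
Local Notation label_prb := (label_prb mu).
Variables (V : finType) (res : {set V} -> O -> O).
Hypothesis res_sub : forall (U U' : {set V}) w, U \subset U' -> res U (res U' w) = res U w.
Hypothesis res_indep : forall U1 U2 : {set V}, [disjoint U1 & U2] -> forall A1 A2,
  Prb (fun w => (res U1 w == A1) && (res U2 w == A2)) =
  Prb (fun w => res U1 w == A1) * Prb (fun w => res U2 w == A2).
Local Notation dep := (dep res).

Lemma chernoff (I : finType) (Q : pred I) (U : I -> {set V}) (Z : I -> O -> bool)
    (m : I -> R) (t a : R) :
  (forall i j, Q i -> Q j -> i != j -> [disjoint U i & U j]) ->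
  (forall i, Q i -> dep (U i) (Z i)) ->
  (forall i, Q i -> Prb (Z i) <= m i) -> 0 <= t ->
  Prb (fun w => a + \sum_(i | Q i) m i <= \sum_(i | Q i) (Z i w)%:R) <=
  expR (#|Q|%:R * (t ^+ 2 * expR t) - t * a).
Proof.
move=> dis dZ Zm t0.
apply: (@le_trans _ _ (Ex (fun w => \prod_(i | Q i) expR (t * ((Z i w)%:R - m i)) * expR (- (t * a))))).
  apply: ler_Ex => // w; rewrite -expR_sum -expRD -big_distrr /= sumrB.
  case: (lerP (a + _) _) => [h|_] /=; last by rewrite expR_ge0.
  by rewrite expR_ge1_nneg // -mulrBr mulr_ge0 // subr_ge0 lerBrDr.
rewrite ExZr expRD ler_wpM2r ?expR_ge0 //.
rewrite (Ex_prod mu_sum1 res_sub res_indep (U := U)) //; last first.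
  by move=> i Qi w; rewrite dZ.
have -> : #|Q|%:R * (t ^+ 2 * expR t) = \sum_(i | Q i) (t ^+ 2 * expR t).
  by rewrite sumr_const mulr_natl.
rewrite expR_sum; apply: ler_prod => i Qi; apply/andP; split.
  by apply: Ex_ge0 => // w; rewrite expR_ge0.
apply: (@le_trans _ _ (Ex (fun w => expR (- (t * m i)) *
    (1 + (t + t ^+ 2 * expR t) * (Z i w)%:R)))).
  apply: ler_Ex => // w; rewrite mulrBr addrC expRD ler_wpM2l ?expR_ge0 //.
  have := @expR_le_quad R (t * (Z i w)%:R) t; rewrite exprMn => H.
  have e2 : (Z i w)%:R ^+ 2 = (Z i w)%:R :> R by rewrite -natrX; case: (Z i w).
  apply: le_trans (H _) _.
    by case: (Z i w); rewrite ?mulr1 ?mulr0 ?normr0 // ger0_norm.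
  by rewrite e2 le_eqVlt; apply/orP; left; apply/eqP; ring.
rewrite ExZ ExD Ex_cst // ExZ -/(Prb (Z i)).
have P1 : Prb (Z i) <= 1 by exact: Prb_le1.
have P0 : 0 <= Prb (Z i) by exact: Prb_ge0.
apply: (@le_trans _ _ (expR (- (t * m i)) * expR (t * m i + t ^+ 2 * expR t))); last first.
  by rewrite -expRD addKr.
rewrite ler_wpM2l ?expR_ge0 //; apply: le_trans (expR_ge1Dx _).
rewrite lerD2l mulrDl lerD //; first by rewrite ler_wpM2l ?Zm.
by rewrite ler_piMr // mulr_ge0 ?sqr_ge0 ?expR_ge0.
Qed.

Section TwoSides.
Variables (Hb Pt L : finType) (lam : bool -> Hb -> O -> L).
Variables (x : bool -> Hb -> Pt -> O -> bool) (sl : bool -> Hb -> {set V}).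
Variables (lv : bool -> Pt -> V) (inc : bool -> Hb -> Pt -> bool) (B v theta : R).
Variable des : bool -> {ffun Hb -> L} -> Pt -> option Hb.
Hypothesis lam_dep : forall b h, dep (sl b h) (lam b h).
Hypothesis x_dep : forall b h S, inc b h S -> dep (lv b S |: sl b h) (x b h S).
Hypothesis sl_disj : forall b h h', h != h' -> [disjoint sl b h & sl b h'].
Hypothesis lv_sl : forall b h S, lv b S \notin sl b h.
Hypothesis lv_inj : forall b, injective (lv b).
Hypothesis B_gt0 : 0 < B.
Hypothesis v_ge0 : 0 <= v.
Hypothesis inc_card : forall b h, #|[set S | inc b h S]|%:R <= B.
Hypothesis des_inc : forall b l S h, des b l S = Some h -> inc b h S.
Hypothesis des_reg : forall b l S h, des b l S = Some h ->
  regular mu (lam b) (x b) (inc b) B v h (l h).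

Definition labv b w : {ffun Hb -> L} := [ffun h => lam b h w].

Lemma labv_eq b w l : (labv b w == l) = [forall h, lam b h w == l h].
Proof.
apply/eqP/forallP => [<- h|H]; first by rewrite ffunE.
by apply/ffunP => h; rewrite ffunE; apply/eqP.
Qed.

Definition lprod b (l : {ffun Hb -> L}) : R := \prod_h label_prb (lam b h) (l h).

Lemma lprod_ge0 b l : 0 <= lprod b l.
Proof. by apply: prodr_ge0 => h _; exact: pl_ge0. Qed.

Lemma lprod_sum b : \sum_l lprod b l = 1.
Proof.
rewrite /lprod -(bigA_distr_bigA (fun h l => label_prb (lam b h) l)) big1 // => h _.
exact: pl_sum.
Qed.

Lemma Ex_label b l : Ex (fun w => (labv b w == l)%:R) = lprod b l.
Proof.
transitivity (Ex (fun w => \prod_h (lam b h w == l h)%:R)); last first.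
  rewrite (Ex_prod mu_sum1 res_sub res_indep (U := sl b)) //.
    by move=> h h' _ _; exact: sl_disj.
  by move=> h _ w; rewrite lam_dep.
apply: eq_Ex => w; rewrite labv_eq; case: forallP => [al|].
  by rewrite big1 // => h _; rewrite al.
move=> /forallP; rewrite negb_forall => /existsP[h nh].
by rewrite (bigD1 h) //= (negbTE nh) mul0r.
Qed.

Lemma Ex_by_label b (F : {ffun Hb -> L} -> O -> R) rho :
  (forall l, Ex (fun w => (labv b w == l)%:R * F l w) <= lprod b l * rho) ->
  Ex (fun w => F (labv b w) w) <= rho.
Proof.
move=> H; rewrite (Ex_split mu (labv b)).
apply: (@le_trans _ _ (\sum_l lprod b l * rho)); last first.
  by rewrite -big_distrl /= lprod_sum mul1r.
apply: ler_sum => l _; apply: le_trans (H l).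
rewrite le_eqVlt; apply/orP; left; apply/eqP; apply: eq_Ex => w.
by case: eqP => [->|]; rewrite ?mul0r.
Qed.

(** An undesignated leaf counts 0 here and in [attach_open], so it contributes nothing to a
    deviation. *)
Definition attach_prb b (l : {ffun Hb -> L}) S : R :=
  if des b l S is Some h then attach mu (lam b) (x b) h S (l h) else 0.
Definition attach_open b (l : {ffun Hb -> L}) S w : bool :=
  if des b l S is Some h then x b h S w else false.

Lemma att01 b l S : 0 <= attach_prb b l S <= 1.
Proof.
rewrite /attach_prb; case: des => [h|]; last by rewrite lexx ler01.
by rewrite ce_ge0 ?ce_le1 // => w; case: (x b h S w).
Qed.

Lemma tail_label b l (wt : Pt -> R) t a : (forall S, 0 <= wt S <= 1) -> 0 <= t ->
  Ex (fun w => (labv b w == l)%:R * (a <= \sum_S wt S * (attach_prb b l S - (attach_open b l S w)%:R))%R%:R)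
  <= lprod b l * expR (#|Hb|%:R * (t ^+ 2 * expR t * v) - t * a / B).
Proof.
move=> wt01 t0.
have := star_tail mu_ge0 mu_sum1 res_sub res_indep (@lam_dep b) (@x_dep b) (@sl_disj b)
  (@lv_sl b) (@lv_inj b) B_gt0 v_ge0 (@inc_card b) (@des_inc b l) (@des_reg b l) a wt01 t0.
apply: le_trans; rewrite le_eqVlt; apply/orP; left; apply/eqP; apply: eq_Ex => w.
rewrite labv_eq; congr (_ * _); congr ((_ <= _)%R%:R).
rewrite /star_dev (exchange_big_dep predT) //=; apply: eq_bigr => S _.
rewrite /attach_prb /attach_open; case: (des b l S) => [h|]; last first.
  by rewrite big_pred0 // subrr mulr0.
rewrite (big_pred1 h) //.
Qed.

Lemma attach_count b t a : 0 <= t ->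
  Prb (fun w => a <= \sum_S (attach_prb b (labv b w) S - (attach_open b (labv b w) S w)%:R)) <=
  expR (#|Hb|%:R * (t ^+ 2 * expR t * v) - t * a / B).
Proof.
move=> t0; apply: (Ex_by_label (b := b)
  (F := fun l w => (a <= \sum_S (attach_prb b l S - (attach_open b l S w)%:R))%R%:R)) => l.
have wt01 (S : Pt) : 0 <= (1 : R) <= 1 by rewrite ler01 lexx.
apply: le_trans (tail_label b l a wt01 t0).
rewrite le_eqVlt; apply/orP; left; apply/eqP; apply: eq_Ex => w.
by under [in RHS]eq_bigr do rewrite mul1r.
Qed.

Definition supp b : {set V} := (\bigcup_h sl b h) :|: [set lv b S | S : Pt].

Lemma supp_sl b h : sl b h \subset supp b.
Proof. by rewrite subsetU // (bigcup_sup h). Qed.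

Lemma supp_lv b S : lv b S \in supp b.
Proof. by rewrite inE; apply/orP; right; apply/imsetP; exists S. Qed.

Lemma labv_dep b : dep (supp b) (labv b).
Proof.
by move=> w; apply/ffunP => h; rewrite !ffunE (dep_sub res_sub (supp_sl b h) (@lam_dep b h)).
Qed.

Lemma xx_dep b l S : dep (supp b) (attach_open b l S).
Proof.
rewrite /attach_open; case e: (des b l S) => [h|] // w.
have sub : lv b S |: sl b h \subset supp b.
  by rewrite subUset sub1set supp_lv supp_sl.
by rewrite (dep_sub res_sub sub (x_dep (des_inc e))).
Qed.

Hypothesis sides_disj : [disjoint supp false & supp true].
Variables (Y : Pt -> O -> bool) (q G eps eta : R).
Hypothesis Y_dep : forall S, dep [set lv false S; lv true S] (Y S).
Hypothesis Y_prb : forall S, Prb (fun w => ~~ Y S w) <= q.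
Hypothesis Pt_card : #|Pt|%:R <= G.
Hypothesis theta_ge0 : 0 <= theta.
Hypothesis theta_att : forall b l S h, des b l S = Some h ->
  theta <= attach mu (lam b) (x b) h S (l h).
Hypothesis gap : 3 * eta <= (theta ^+ 2 - q) * eps.
Hypothesis gap_ge0 : 0 <= theta ^+ 2 - q.

Definition crossing (c : {ffun bool * Hb -> bool}) (l0 l1 : {ffun Hb -> L}) : {set Pt} :=
  [set S | match des false l0 S, des true l1 S with
           | Some h0, Some h1 => c (false, h0) != c (true, h1)
           | _, _ => false end].

Definition linked l0 l1 S w := [&& attach_open false l0 S w, attach_open true l1 S w & Y S w].

Definition separated c l0 l1 w :=
  (eps * G <= #|crossing c l0 l1|%:R) && [forall S in crossing c l0 l1, ~~ linked l0 l1 S w].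

Let ind (A : {set Pt}) S : R := (S \in A)%:R.

(** Let p0, p1 be the predicted and x0, x1 the actual attachments on the two sides. Since p0 p1 - x0
    x1 = p1 (p0 - x0) + x0 (p1 - x1), without the last two deviations more than theta^2 |X| - 2 eta
    G pairs are attached on both sides. None being linked, all of these have [Y] false, which
    without the first deviation happens fewer than q |X| + eta G times; [gap] makes this
    contradictory. *)
Lemma separated_cases c l0 l1 w (X := crossing c l0 l1) : separated c l0 l1 w ->
  [|| eta * G + \sum_(S in X) q <= \sum_(S in X) (~~ Y S w)%:R,
      eta * G <= \sum_S (ind X S * attach_prb true l1 S) * (attach_prb false l0 S - (attach_open false l0 S w)%:R)
    | eta * G <= \sum_S (ind X S * (attach_open false l0 S w)%:R) * (attach_prb true l1 S - (attach_open true l1 S w)%:R)].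
Proof.
case/andP => big /forall_inP nolink; rewrite -implyNb -ltNge; apply/implyP => hY.
rewrite -implyNb -ltNge; apply/implyP => h0; rewrite leNgt; apply/negP => h1.
have hE : \sum_(S in X) (attach_prb false l0 S * attach_prb true l1 S - (attach_open false l0 S w && attach_open true l1 S w)%:R) < 2 * eta * G.
  have -> : 2 * eta * G = eta * G + eta * G by ring.
  apply: le_lt_trans (ltrD h0 h1); rewrite -big_split /= [leLHS]big_mkcond /=.
  rewrite le_eqVlt; apply/orP; left; apply/eqP; apply: eq_bigr => S _.
  rewrite /ind; case: (S \in X); last by rewrite !mul0r addr0.
  by rewrite -mulnb natrM !mul1r; ring.
have hx : \sum_(S in X) (attach_open false l0 S w && attach_open true l1 S w)%:R <= \sum_(S in X) (~~ Y S w)%:R :> R.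
  apply: ler_sum => S SX; have := nolink S SX; rewrite /linked ler_nat.
  by case: (attach_open false l0 S w); case: (attach_open true l1 S w); case: (Y S w).
have ht : \sum_(S in X) theta ^+ 2 <= \sum_(S in X) (attach_prb false l0 S * attach_prb true l1 S).
  apply: ler_sum => S; rewrite inE /attach_prb.
  case e0: (des false l0 S) => [k0|] //; case e1: (des true l1 S) => [k1|] // _.
  by rewrite expr2 ler_pM // theta_att.
rewrite sumrB in hE.
move: ht hY; rewrite !sumr_const -[theta ^+ 2 *+ _]mulr_natr -[q *+ _]mulr_natr => ht hY.
have hg : 3 * eta * G <= (theta ^+ 2 - q) * #|X|%:R.
  apply: le_trans (_ : (theta ^+ 2 - q) * eps * G <= _).
    by rewrite ler_wpM2r // (le_trans _ Pt_card).
  by rewrite -mulrA ler_wpM2l.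
lra.
Qed.

Lemma separated_le c l0 l1 t t' : 0 <= t -> 0 <= t' ->
  Ex (fun w => (labv false w == l0)%:R * ((labv true w == l1)%:R * (separated c l0 l1 w)%:R))
  <= lprod false l0 * lprod true l1 *
    (expR (G * (t' ^+ 2 * expR t') - t' * (eta * G)) +
     2 * expR (#|Hb|%:R * (t ^+ 2 * expR t * v) - t * (eta * G) / B)).
Proof.
move=> t0 t'0; set X := crossing c l0 l1.
set rho := expR (#|Hb|%:R * _ - _).
pose a0 w := eta * G + \sum_(S in X) q <= \sum_(S in X) (~~ Y S w)%:R.
pose a1 w := eta * G <= \sum_S (ind X S * attach_prb true l1 S) * (attach_prb false l0 S - (attach_open false l0 S w)%:R).
pose a2 w := eta * G <= \sum_S (ind X S * (attach_open false l0 S w)%:R) * (attach_prb true l1 S - (attach_open true l1 S w)%:R).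
pose E0 w : R := (labv false w == l0)%:R.
pose E1 w : R := (labv true w == l1)%:R.
have split3 w : E0 w * (E1 w * (separated c l0 l1 w)%:R) <=
   E0 w * E1 w * (a0 w)%:R + E1 w * (E0 w * (a1 w)%:R) + E0 w * (E1 w * (a2 w)%:R).
  have : (separated c l0 l1 w)%:R <= (a0 w)%:R + (a1 w)%:R + (a2 w)%:R :> R.
    case: (boolP (separated c l0 l1 w)) => [/separated_cases|_]; last by rewrite -!natrD ler_nat.
    rewrite -/(a0 w) -/(a1 w) -/(a2 w) -!natrD ler_nat.
    by case: (a0 w); case: (a1 w); case: (a2 w).
  have E0p : 0 <= E0 w by rewrite ler0n.
  have E1p : 0 <= E1 w by rewrite ler0n.
  have E01 : 0 <= E0 w * E1 w by rewrite mulr_ge0.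
  move=> /(ler_wpM2l E01); rewrite mulrA; lra.
apply: le_trans (ler_Ex mu_ge0 split3) _; rewrite !ExD.
have dl0 : dep (supp false) E0 by move=> w; rewrite /E0 labv_dep.
have dl1 : dep (supp true) E1 by move=> w; rewrite /E1 labv_dep.
have ind01 S : 0 <= ind X S <= 1 by rewrite /ind; case: (S \in X); rewrite ?lexx ?ler01.
(* The weights depend on the fixed [l1] only, so this deviation lives on the false side and is
   independent of the label of the true side. *)
have h1 : Ex (fun w => E1 w * (E0 w * (a1 w)%:R)) <= lprod true l1 * (lprod false l0 * rho).
  rewrite (Ex_indep res_indep (U1 := supp true) (U2 := supp false)) //; last 2 first.
  - by rewrite disjoint_sym.
  - move=> w; rewrite dl0; congr (_ * (_ <= _)%R%:R); apply: eq_bigr => S _.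
    by rewrite xx_dep.
  rewrite Ex_label; apply: ler_wpM2l; first exact: lprod_ge0.
  apply: tail_label => // S; have /andP[? ?] := att01 true l1 S; have /andP[? ?] := ind01 S.
  by rewrite mulr_ge0 // mulr_ile1.
(* Here the weights involve the actual attachments of the false side; they are frozen, and the tail
   bound on the true side holds uniformly in them. *)
have h2 : Ex (fun w => E0 w * (E1 w * (a2 w)%:R)) <= lprod false l0 * (lprod true l1 * rho).
  pose f w := (labv false w == l0, [ffun S => attach_open false l0 S w]) : bool * {ffun Pt -> bool}.
  pose F (s : bool * {ffun Pt -> bool}) w := E1 w *
    (eta * G <= \sum_S (ind X S * (s.2 S)%:R) * (attach_prb true l1 S - (attach_open true l1 S w)%:R))%R%:R.
  have := @Ex_freeze _ _ _ mu_ge0 _ _ res_indep (supp false) (supp true) _ f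
    (fun s => s.1%:R) F (lprod true l1 * rho) sides_disj.
  rewrite Ex_label => H; apply: le_trans (H _ _ _ _).
  - rewrite le_eqVlt; apply/orP; left; apply/eqP; apply: eq_Ex => w.
    rewrite /F /f /a2 /=; congr (_ * (_ * (_ <= _)%R%:R)); apply: eq_bigr => S _.
    by rewrite ffunE.
  - move=> w; rewrite /f labv_dep; congr pair; apply/ffunP => S.
    by rewrite !ffunE xx_dep.
  - move=> s w; rewrite /F dl1; congr (_ * (_ <= _)%R%:R); apply: eq_bigr => S _.
    by rewrite xx_dep.
  - by move=> s; rewrite ler0n.
  - move=> s; apply: tail_label => // S; have /andP[? ?] := ind01 S.
    by case: (s.2 S); rewrite ?mulr1 ?mulr0 ?lexx ?ler01 // ind01.
(* The events [Y] live on the leaves [lv], the labels on hubs and pinned leaves. These vertex sets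
   are disjoint, so the count of failing [Y] is independent of both label vectors. *)
have h0 : Ex (fun w => E0 w * E1 w * (a0 w)%:R) <=
   lprod false l0 * lprod true l1 * expR (G * (t' ^+ 2 * expR t') - t' * (eta * G)).
  pose W := \bigcup_b \bigcup_h sl b h.
  pose W' := \bigcup_b [set lv b S | S : Pt].
  have WW' : [disjoint W & W'].
    rewrite -setI_eq0; apply/eqP/setP => u; rewrite !inE; apply/negP => /andP[].
    case/bigcupP => b _ /bigcupP[h _ ub] /bigcupP[b' _ /imsetP[S _ eu]].
    move: ub; case: (b =P b') => [->|bb'].
      by rewrite eu (negbTE (lv_sl _ _ _)).
    move=> ub; have us := subsetP (supp_sl b h) u ub.
    have us' := supp_lv b' S; rewrite -eu in us'.
    move: sides_disj; rewrite -setI_eq0 => /eqP/setP/(_ u); rewrite in_set0 in_setI.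
    by move: us us' bb'; case: b {ub}; case: b' {eu} => us us' bb'; rewrite ?us ?us' //; case: bb'.
  rewrite (Ex_indep res_indep (U1 := W) (U2 := W')) //; first last.
  - move=> w; congr ((_ <= _)%R%:R); apply: eq_bigr => S _.
    rewrite (dep_sub res_sub _ (@Y_dep S)) // subUset !sub1set.
    by apply/andP; split; apply/bigcupP; [exists false|exists true]; rewrite ?imset_f.
  - have dW b : dep W (labv b).
      move=> w; apply/ffunP => h; rewrite !ffunE (dep_sub res_sub _ (@lam_dep b h)) //.
      by apply: subset_trans (bigcup_sup b _) => //; exact: bigcup_sup.
    by move=> w; rewrite /E0 /E1 !dW.
  rewrite (Ex_indep res_indep sides_disj dl0 dl1) !Ex_label.
  apply: ler_wpM2l; first by rewrite mulr_ge0 ?lprod_ge0.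
  apply: le_trans (@chernoff _ (mem X) (fun S => [set lv false S; lv true S])
    (fun S w => ~~ Y S w) (fun=> q) t' (eta * G) _ _ _ t'0) _.
  - move=> S S' _ _ SS'; rewrite -setI_eq0; apply/eqP/setP => u; rewrite !inE.
    have dd T T' : lv false T != lv true T'.
      apply/eqP => e; move: sides_disj; rewrite -setI_eq0 => /eqP/setP/(_ (lv false T)).
      by rewrite in_set0 in_setI supp_lv e supp_lv.
    apply/negP => /andP[/orP[]/eqP -> /orP[]].
    + by rewrite (inj_eq (@lv_inj _)) (negbTE SS').
    + by rewrite (negbTE (dd _ _)).
    + by rewrite eq_sym (negbTE (dd _ _)).
    + by rewrite (inj_eq (@lv_inj _)) (negbTE SS').
  - by move=> S _ w; rewrite Y_dep.
  - by move=> S _; exact: Y_prb.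
  rewrite ler_expR lerD2r ler_wpM2r ?mulr_ge0 ?sqr_ge0 ?expR_ge0 //.
  by apply: le_trans Pt_card; rewrite ler_nat max_card.
apply: le_trans (lerD (lerD h0 h1) h2) _.
rewrite le_eqVlt; apply/orP; left; apply/eqP; ring.
Qed.

(** The cut given by the components is random, so the bound for a fixed colouring is summed over all
    2^(2 |Hb|) colourings of the hubs of both sides. In the application there are fewer hubs than
    leaves by a factor of order M, which pays for the sum. *)
Lemma linking t t' : 0 <= t -> 0 <= t' ->
  Prb (fun w => [exists c, separated c (labv false w) (labv true w) w]) <=
  2 ^+ (2 * #|Hb|) * (expR (G * (t' ^+ 2 * expR t') - t' * (eta * G)) +
     2 * expR (#|Hb|%:R * (t ^+ 2 * expR t * v) - t * (eta * G) / B)).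
Proof.
move=> t0 t'0; set rho := _ + _.
apply: (@le_trans _ _ (\sum_(c : {ffun bool * Hb -> bool}) rho)); last first.
  by rewrite sumr_const card_ffun card_bool card_prod card_bool -[leLHS]mulr_natl natrX.
have := Prb_has mu_ge0 predT (fun c w => separated c (labv false w) (labv true w) w).
move/le_trans; apply; apply: ler_sum => c _.
apply: (Ex_by_label (b := false) (F := fun l w => (separated c l (labv true w) w)%:R)) => l0.
have -> : lprod false l0 * rho = \sum_l1 lprod false l0 * lprod true l1 * rho.
  by rewrite -big_distrl -big_distrr /= lprod_sum mulr1.
rewrite (Ex_split mu (labv true)); apply: ler_sum => l1 _.
apply: le_trans (separated_le c l0 l1 t0 t'0).
rewrite le_eqVlt; apply/orP; left; apply/eqP; apply: eq_Ex => w.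
rewrite mulrCA; case: (labv true w =P l1) => [->|] //.
by rewrite !mul0r mulr0.
Qed.

End TwoSides.
End Linking.

(** * The coarse cube *)

Definition flip (N : nat) (v : {ffun 'I_N -> bool}) (c : 'I_N) : {ffun 'I_N -> bool} :=
  [ffun i => v i (+) (i == c)].

(* [cres U w] is the part of the configuration [w] inside the copies [v \in U];
   [cX v] says that copy [v] is connected, [cY u v] that some edge between the
   copies [u] and [v] is open, [cconn] that two copies lie in one component. *)
Record coarse_model (R : realType) (P q : R) (N : nat) := CoarseModel {
  cO : finType;
  cmu : cO -> R;
  cmu_ge0 : forall w, 0 <= cmu w;
  cmu_sum1 : \sum_w cmu w = 1;
  cres : {set {ffun 'I_N -> bool}} -> cO -> cO;
  cres_sub : forall (U U' : {set {ffun 'I_N -> bool}}) w,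
    U \subset U' -> cres U (cres U' w) = cres U w;
  cres_indep : forall U1 U2 : {set {ffun 'I_N -> bool}}, [disjoint U1 & U2] -> forall A1 A2,
    Prb cmu (fun w => (cres U1 w == A1) && (cres U2 w == A2)) =
    Prb cmu (fun w => cres U1 w == A1) * Prb cmu (fun w => cres U2 w == A2);
  cX : {ffun 'I_N -> bool} -> cO -> bool;
  cY : {ffun 'I_N -> bool} -> {ffun 'I_N -> bool} -> cO -> bool;
  cconn : cO -> rel {ffun 'I_N -> bool};
  cX_dep : forall v, dep cres [set v] (cX v);
  cY_dep : forall u v, dep cres [set u; v] (cY u v);
  cX_prb : forall v, P <= Prb cmu (cX v);
  cY_prb : forall v c, Prb cmu (fun w => ~~ cY v (flip v c) w) <= q;
  cconn_refl : forall w, reflexive (cconn w);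
  cconn_sym : forall w, symmetric (cconn w);
  cconn_trans : forall w, transitive (cconn w);
  cconn_edge : forall w v c, cX v w -> cX (flip v c) w -> cY v (flip v c) w ->
    cconn w v (flip v c) }.

Arguments cmu {R P q N} c _ : rename.
Arguments cres {R P q N} c _ _ : rename.
Arguments cX {R P q N} c _ _ : rename.
Arguments cY {R P q N} c _ _ _ : rename.
Arguments cconn {R P q N} c _ _ _ : rename.

Section Grid.
Variables (N M r' : nat).
Local Notation r := r'.+1.
Variable cd : 'I_r -> 'I_M -> 'I_N.
Hypothesis cd_inj : forall i a j b, cd i a = cd j b -> i = j /\ a = b.
Local Notation V := {ffun 'I_N -> bool}.
Local Notation grid := {ffun 'I_r -> 'I_M}.
Local Notation line := ('I_r * {ffun 'I_r' -> 'I_M})%type.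
Implicit Types (w : V) (S : grid) (h : line).

(* The leaf of [S] flips one coordinate in each block; the hub [(i, T)] flips none
   in block [i] and those given by [T] in the others. *)
Definition leaf w S : V := [ffun c => w c (+) [exists i, cd i (S i) == c]].
Definition hubv w h : V := [ffun c => w c (+) [exists l, cd (lift h.1 l) (h.2 l) == c]].
Definition drop_at (i : 'I_r) S : {ffun 'I_r' -> 'I_M} := [ffun l => S (lift i l)].
(** A hub amounts to an axis-parallel line of the grid, and its neighbouring leaves are the points
    of that line; [ext] lists the points and [line_of] gives the line through a point in direction
    [i]. *)
Definition ext h (a : 'I_M) : grid := [ffun k => if unlift h.1 k is Some l then h.2 l else a].
Definition line_of S (i : 'I_r) : line := (i, drop_at i S).

Lemma ext_line S i : ext (line_of S i) (S i) = S.
Proof.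
apply/ffunP => k; rewrite !ffunE /=.
by case: (unliftP i k) => [l ->|->] //; rewrite ffunE.
Qed.

Lemma ext_at h a : ext h a h.1 = a.
Proof. by rewrite ffunE unlift_none. Qed.

Lemma ext_lift h a l : ext h a (lift h.1 l) = h.2 l.
Proof. by rewrite ffunE liftK. Qed.

Lemma flip_hub w h a : flip (hubv w h) (cd h.1 a) = leaf w (ext h a).
Proof.
apply/ffunP => c; rewrite !ffunE -addbA; congr addb.
case: existsP => [[l /eqP <-]|no].
  have -> : (cd (lift h.1 l) (h.2 l) == cd h.1 a) = false.
    by apply/eqP => /cd_inj[e _]; move: (neq_lift h.1 l); rewrite e eqxx.
  by apply/esym/existsP; exists (lift h.1 l); rewrite ext_lift.
apply/eqP/existsP => [->|[k /eqP e]].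
  by exists h.1; rewrite ext_at.
case: (unliftP h.1 k) e => [l ->|->]; last by rewrite ext_at.
by rewrite ext_lift => e; case: no; exists l; rewrite e.
Qed.

Lemma flip_leaf_base w S c : flip (leaf w S) c = leaf (flip w c) S.
Proof. by apply/ffunP => k; rewrite !ffunE addbAC. Qed.

Lemma leaf_inj w : injective (leaf w).
Proof.
move=> S S' /ffunP e; apply/ffunP => i; have := e (cd i (S i)).
rewrite !ffunE; move/addbI.
have -> : [exists k, cd k (S k) == cd i (S i)] by apply/existsP; exists i.
by move/esym/existsP => [k /eqP/cd_inj[-> ->]].
Qed.

Lemma hubv_leaf w h S : hubv w h != leaf w S.
Proof.
apply/eqP => /ffunP/(_ (cd h.1 (S h.1))); rewrite !ffunE => /addbI.
have -> : [exists k, cd k (S k) == cd h.1 (S h.1)] by apply/existsP; exists h.1.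
case/existsP => l /eqP/cd_inj[e _].
by move: (neq_lift h.1 l); rewrite e eqxx.
Qed.

Lemma hubv_inj w : injective (hubv w).
Proof.
move=> [i R] [j R'] /ffunP e; have ij : i = j.
  apply/eqP; apply: contraT => ij; have [l jl] := unlift_some ij.
  have := e (cd (lift i l) (R l)); rewrite !ffunE => /addbI /=.
  have -> : [exists k, cd (lift i k) (R k) == cd (lift i l) (R l)] by apply/existsP; exists l.
  move/esym/existsP => [k /eqP/cd_inj[e2 _]].
  by move: (neq_lift j k); rewrite e2 -jl eqxx.
rewrite ij in e *; congr pair; apply/ffunP => l.
have := e (cd (lift j l) (R l)); rewrite !ffunE => /addbI /=.
have -> : [exists k, cd (lift j k) (R k) == cd (lift j l) (R l)] by apply/existsP; exists l.
by move/esym/existsP => [k /eqP/cd_inj[/lift_inj -> ->]].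
Qed.

Lemma ext_inj h h' a a' : h.1 = h'.1 -> ext h a = ext h' a' -> h = h' /\ a = a'.
Proof.
case: h h' => [i R] [j R'] /= <- e; split; last first.
  by rewrite -(ext_at (i, R) a) e (ext_at (i, R')).
congr pair; apply/ffunP => l.
by rewrite -(ext_lift (i, R) a l) e (ext_lift (i, R')).
Qed.

Lemma card_line : #|{: line}| = (r * M ^ r')%N.
Proof. by rewrite card_prod card_ord card_ffun !card_ord. Qed.

End Grid.

Section LineRegular.
Variables (R : realType) (O : finType) (mu : O -> R).
Hypothesis mu_ge0 : forall w, 0 <= mu w.
Hypothesis mu_sum1 : \sum_w mu w = 1.
Local Notation Ex := (Ex mu).
Local Notation cexp := (cexp mu).
Local Notation label_prb := (label_prb mu).

Lemma Ex_cov (L : finType) (lam : O -> L) (f g : O -> R) l :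
  Ex (fun w => (lam w == l)%:R * ((cexp lam f l - f w) * (cexp lam g l - g w))) =
  label_prb lam l * ccov mu lam f g l.
Proof.
have e1 := ce_pl mu_ge0 lam f l; have e2 := ce_pl mu_ge0 lam g l.
have e3 := ce_pl mu_ge0 lam (fun w => f w * g w) l.
transitivity (cexp lam f l * cexp lam g l * label_prb lam l
   - cexp lam g l * Ex (fun w => (lam w == l)%:R * f w)
   - cexp lam f l * Ex (fun w => (lam w == l)%:R * g w)
   + Ex (fun w => (lam w == l)%:R * (f w * g w))).
  rewrite /label_prb -!ExZ -!ExB -ExD; apply: eq_Ex => w; ring.
rewrite -e1 -e2 -e3 /ccov; ring.
Qed.

Lemma sum_injective_le (I J : finType) (T : {set I}) (A : {set J}) (s : I -> J) (f : J -> R) :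
  {in T &, injective s} -> (forall S, S \in T -> s S \in A) -> (forall a, 0 <= f a) ->
  \sum_(S in T) f (s S) <= \sum_(a in A) f a.
Proof.
move=> sI sA f0; rewrite -(big_imset f sI) /=.
rewrite [leRHS](bigID (mem (s @: T))) /=.
rewrite [X in _ <= X + _](eq_bigl (mem (s @: T))); last first.
  move=> a /=; case: (boolP (a \in s @: T)) => [/imsetP[S ST ->]|]; last by rewrite andbF.
  by rewrite sA.
by rewrite lerDl sumr_ge0.
Qed.

(** Expanding the square gives a sum of weighted covariances c. Each is at most v/2 + c^2/(2v), and
    by the hypothesis on the squares the total is at most M^2 v/2 + v^2 M^2/(2v) = v M^2. *)
Lemma line_regular (L Pt : finType) (lam : O -> L) (M : nat) (xs : 'I_M -> O -> bool)
    (A : {set 'I_M}) (T : {set Pt}) (s : Pt -> 'I_M) (v : R) l (wt : Pt -> R) :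
  {in T &, injective s} -> (forall S, S \in T -> s S \in A) -> 0 < v ->
  \sum_(a in A) \sum_(c in A)
    ccov mu lam (fun w => (xs a w)%:R) (fun w => (xs c w)%:R) l ^+ 2 <= v ^+ 2 * M%:R ^+ 2 ->
  (forall S, 0 <= wt S <= 1) ->
  Ex (fun w => (lam w == l)%:R * (\sum_(S in T) wt S *
      (cexp lam (fun w0 => (xs (s S) w0)%:R) l - (xs (s S) w)%:R)) ^+ 2)
  <= v * M%:R ^+ 2 * label_prb lam l.
Proof.
move=> sI sA v0 hcov wt01.
pose D S w := cexp lam (fun w0 => (xs (s S) w0)%:R) l - (xs (s S) w)%:R.
pose cv a c := ccov mu lam (fun w => (xs a w)%:R) (fun w => (xs c w)%:R) l.
have p0 := pl_ge0 mu_ge0 lam l.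
have -> : Ex (fun w => (lam w == l)%:R * (\sum_(S in T) wt S * D S w) ^+ 2) =
  \sum_(S in T) \sum_(S' in T) wt S * wt S' * (label_prb lam l * cv (s S) (s S')).
  under [RHS]eq_bigr => S _ do under eq_bigr => S' _ do rewrite /cv -Ex_cov -ExZ.
  under [RHS]eq_bigr => S _ do rewrite -Ex_sum.
  rewrite -Ex_sum; apply: eq_Ex => w.
  rewrite expr2 big_distrl big_distrr /=; apply: eq_bigr => S _.
  by rewrite !big_distrr /=; apply: eq_bigr => S' _; rewrite /D; ring.
apply: (@le_trans _ _ (\sum_(S in T) \sum_(S' in T)
    (v / 2 + cv (s S) (s S') ^+ 2 * (2 * v)^-1) * label_prb lam l)).
  apply: ler_sum => S _; apply: ler_sum => S' _.
  rewrite [label_prb lam l * _]mulrC mulrA ler_wpM2r //.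
  have /andP[w0 w1] := wt01 S; have /andP[w0' w1'] := wt01 S'.
  set u := wt S * wt S'; set c := cv _ _.
  have u0 : 0 <= u by rewrite mulr_ge0.
  have u1 : u <= 1 by rewrite mulr_ile1.
  have h : 2 * v * (u * c) <= v ^+ 2 + c ^+ 2.
    have := sqr_ge0 (v * u - c).
    have : (v * u) ^+ 2 <= v ^+ 2.
      by rewrite exprMn ler_piMr ?sqr_ge0 // exprn_ile1.
    rewrite !expr2 => a b; nra.
  have -> : v / 2 + c ^+ 2 * (2 * v)^-1 = (v ^+ 2 + c ^+ 2) / (2 * v).
    by field; rewrite gt_eqF.
  by rewrite ler_pdivlMr ?mulr_gt0 // mulrC.
have -> : v * M%:R ^+ 2 * label_prb lam l = (M%:R ^+ 2 * (v / 2) + v ^+ 2 * M%:R ^+ 2 * (2 * v)^-1) * label_prb lam l.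
  by field; rewrite gt_eqF.
under eq_bigr => S _ do rewrite -big_distrl.
rewrite -big_distrl /=; apply: ler_wpM2r => //.
under eq_bigr => S _ do rewrite big_split /= sumr_const -big_distrl /=.
rewrite big_split /= sumr_const -big_distrl /=; apply: lerD.
  rewrite -mulrnA -[leLHS]mulr_natl natrM expr2.
  apply: ler_wpM2r; first by apply: divr_ge0 => //; exact: ltW.
  have TM : #|T|%:R <= M%:R :> R.
    rewrite ler_nat -(card_in_imset sI) -[leqRHS]card_ord; exact: max_card.
  by rewrite ler_pM.
apply: ler_wpM2r; first by rewrite invr_ge0 mulr_ge0 ?ltW.
apply: le_trans hcov.
apply: (@le_trans _ _ (\sum_(S in T) \sum_(c in A) cv (s S) c ^+ 2)).
  apply: ler_sum => S _; apply: (sum_injective_le (f := fun c => cv (s S) c ^+ 2)) => // c.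
  exact: sqr_ge0.
apply: (sum_injective_le (f := fun a => \sum_(c in A) cv a c ^+ 2)) => // a.
by apply: sumr_ge0 => c _; exact: sqr_ge0.
Qed.

End LineRegular.

(** * Labels, thresholds and designated hubs *)

Section Local.
Variables (R : realType) (P0 q : R) (N M r' : nat) (cm : coarse_model P0 q N).
Local Notation r := r'.+1.
Variable cd : 'I_r -> 'I_M -> 'I_N.
Hypothesis cd_inj : forall i a j b, cd i a = cd j b -> i = j /\ a = b.
Local Notation V := {ffun 'I_N -> bool}.
Local Notation grid := {ffun 'I_r -> 'I_M}.
Local Notation line := ('I_r * {ffun 'I_r' -> 'I_M})%type.
Local Notation mu := (cmu cm).
Local Notation label := (bool * {ffun 'I_M -> bool})%type.
Variables (eps v : R) (A P : 'I_r -> {set 'I_M}).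

(** The activity of the hub is left out: it is the first component of the label, so it is known when
    the attachment is predicted. *)
Definition slot (h : V) i a w : bool :=
  cX cm (flip h (cd i a)) w && cY cm h (flip h (cd i a)) w.
Definition hub_label (h : V) i (w : cO cm) : label := pin_label (cX cm h) (slot h i) (P i) w.
(** Given that the hub is active, the leaf is active with its unconditional probability, and all
    edges between them are closed with probability at most [q / P0]; [eps] is the slack that makes
    this average be reached often enough. *)
Definition threshold (u : V) : R := Prb mu (cX cm u) - q / P0 - eps.
Definition viable (h : V) i a (l : label) : bool :=
  [&& l.1, threshold (flip h (cd i a)) <= cexp mu (hub_label h i) (fun w => (slot h i a w)%:R) l
    & pin_cov mu (cX cm h) (slot h i) (A i) (P i) l <= v ^+ 2 * M%:R ^+ 2].

(** The filter [I] serves the comparison of a leaf with its modification in block j: the hubs of the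
    other blocks are the ones that can be matched, so block j is then excluded. *)
Definition designated (z : V) (I : pred 'I_r) (S : grid) w : option 'I_r :=
  [pick i | I i && viable (hubv cd z (line_of S i)) i (S i) (hub_label (hubv cd z (line_of S i)) i w)].

Definition designated_hub z I S w : option V := omap (fun i => hubv cd z (line_of S i)) (designated z I S w).

Lemma slot_dep h i a : dep (cres cm) [set h; flip h (cd i a)] (slot h i a).
Proof.
apply: (dep_app2 andb); last exact: cY_dep.
by apply: (dep_sub (@cres_sub _ _ _ _ cm)) (cX_dep _); rewrite sub1set !inE eqxx orbT.
Qed.

End Local.

Arguments slot {R P0 q N M r'} cm cd h i a w.
Arguments hub_label {R P0 q N M r'} cm cd P h i w.
Arguments threshold {R P0 q N} cm eps u.
Arguments viable {R P0 q N M r'} cm cd eps v A P h i a l.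
Arguments designated {R P0 q N M r'} cm cd eps v A P z I S w.
Arguments designated_hub {R P0 q N M r'} cm cd eps v A P z I S w.

(* A uniformly random 2-colouring separates each pair with probability 1/2. *)
Lemma half_cut (U I : finType) (T : {set I}) (a b : I -> U) :
  (forall s, s \in T -> a s != b s) ->
  exists chi : {ffun U -> bool}, (#|T| <= 2 * #|[set s in T | chi (a s) != chi (b s)]|)%N.
Proof.
move=> ab.
have half u u' : u != u' -> (2 * #|[set chi : {ffun U -> bool} | chi u != chi u']| = #|{ffun U -> bool}|)%N.
  move=> uu'; pose f (chi : {ffun U -> bool}) : {ffun U -> bool} := [ffun x => chi x (+) (x == u)].
  have fK : involutive f by move=> chi; apply/ffunP => x; rewrite !ffunE -addbA addbb addbF.
  set X := [set chi | _]; have := cardsC X.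
  have <- : f @: X = ~: X.
    rewrite (can_imset_pre _ fK); apply/setP => chi; rewrite !inE !ffunE eqxx.
    rewrite [u' == u]eq_sym (negbTE uu') addbT addbF.
    by case: (chi u); case: (chi u').
  by rewrite (card_imset _ (inv_inj fK)) mul2n -addnn.
have [e0|T0] := posnP #|T|.
  by exists [ffun=> true]; rewrite e0.
apply/existsP; apply: contraT; rewrite negb_exists => /forallP small.
have : (\sum_(chi : {ffun U -> bool}) 2 * #|[set s in T | chi (a s) != chi (b s)]|
   < \sum_(chi : {ffun U -> bool}) #|T|)%N.
  rewrite [ltnRHS](bigD1 [ffun=> true]) // [ltnLHS](bigD1 [ffun=> true]) //=.
  rewrite -addSn leq_add //; first by rewrite ltnNge.
  by apply: leq_sum => chi _; rewrite ltnW // ltnNge.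
rewrite -big_distrr /=.
have -> : (\sum_(chi : {ffun U -> bool}) #|[set s in T | chi (a s) != chi (b s)]| =
  \sum_(s in T) #|[set chi : {ffun U -> bool} | chi (a s) != chi (b s)]|)%N.
  transitivity (\sum_(chi : {ffun U -> bool}) \sum_(s in T) (chi (a s) != chi (b s)))%N.
    apply: eq_bigr => chi _; rewrite -sum1dep_card big_mkcondr /=.
    by apply: eq_bigr => s _; case: (_ != _).
  rewrite exchange_big /=; apply: eq_bigr => s _.
  rewrite -sum1dep_card [RHS]big_mkcond /=.
  by apply: eq_bigr => chi _; case: (_ != _).
rewrite big_distrr /= (eq_bigr (fun=> #|{ffun U -> bool}|)); last first.
  by move=> s sT; rewrite half ?ab.
by rewrite !sum_nat_const mulnC ltnn.
Qed.

(** * Designation and linking in the coarse cube *)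

Section Claim.
Variables (R : realType) (P0 q : R) (N M r' : nat) (cm : coarse_model P0 q N).
Local Notation r := r'.+1.
Variable cd : 'I_r -> 'I_M -> 'I_N.
Hypothesis cd_inj : forall i a j b, cd i a = cd j b -> i = j /\ a = b.
Local Notation V := {ffun 'I_N -> bool}.
Local Notation grid := {ffun 'I_r -> 'I_M}.
Local Notation line := ('I_r * {ffun 'I_r' -> 'I_M})%type.
Local Notation mu := (cmu cm).
Local Notation label := (bool * {ffun 'I_M -> bool})%type.
Variables (eps v : R) (A P : 'I_r -> {set 'I_M}).
Hypothesis v_gt0 : 0 < v.
Hypothesis M_gt0 : (0 < M)%N.
Local Notation slot := (slot cm cd).
Local Notation hub_label := (hub_label cm cd P).
Local Notation threshold := (threshold cm eps).
Local Notation viable := (viable cm cd eps v A P).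
Local Notation des := (designated cm cd eps v A P).
Local Notation deshub := (designated_hub cm cd eps v A P).
Variables (z : V) (g : 'I_N) (I : bool -> pred 'I_r) (Q : 'I_r -> {set 'I_M}).
Hypothesis QA : forall i, Q i \subset A i.
Hypothesis QP : forall i, [disjoint Q i & P i].

Lemma pin_not_served i a : a \in Q i -> a \in P i -> False.
Proof. by move=> aQ aP; move: (QP i); rewrite -setI_eq0 => /eqP/setP/(_ a); rewrite !inE aQ aP. Qed.

Definition on_grid : {set grid} := [set S : grid | [forall i, S i \in Q i]].
Local Notation Pt := {S : grid | S \in on_grid}.
Let base (b : bool) : V := if b then flip z g else z.
Let served (h : line) := [forall l, h.2 l \in Q (lift h.1 l)].
(** Hubs with a coordinate outside [Q] get a constant label and an empty support. Otherwise pinned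
    leaves of hubs in different directions could coincide and the supports would overlap. *)
Let lam b (h : line) w : label :=
  if served h then hub_label (hubv cd (base b) h) h.1 w else (false, [ffun=> false]).
Let x b (h : line) (S : Pt) w := slot (hubv cd (base b) h) h.1 (val S h.1) w.
Let sl b (h : line) : {set V} :=
  if served h then hubv cd (base b) h |: [set leaf cd (base b) (ext h a) | a in P h.1] else set0.
Let lv b (S : Pt) := leaf cd (base b) (val S).
Let inc (b : bool) (h : line) (S : Pt) := line_of (val S) h.1 == h.
Let d b (l : {ffun line -> label}) (S : Pt) : option line :=
  omap (fun i => line_of (val S) i)
   [pick i | I b i && viable (hubv cd (base b) (line_of (val S) i)) i (val S i) (l (line_of (val S) i))].

Lemma on_gridP (S : Pt) i : val S i \in Q i.
Proof. by case: S => S /=; rewrite inE => /forallP. Qed.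

Lemma inc_served b h S : inc b h S -> served h.
Proof.
by move=> /eqP <-; apply/forallP => l /=; rewrite ffunE on_gridP.
Qed.

Lemma hub_flip b h S : inc b h S ->
  flip (hubv cd (base b) h) (cd h.1 (val S h.1)) = lv b S.
Proof. by move=> /eqP e; rewrite (flip_hub cd_inj) /lv -[in ext h _]e ext_line. Qed.

Let lam_dep b h : dep (cres cm) (sl b h) (lam b h).
Proof.
rewrite /lam /sl; case: (served h) => // w; congr pair.
  by rewrite (dep_sub (@cres_sub _ _ _ _ cm) _ (@cX_dep _ _ _ _ cm _)) // sub1set !inE eqxx.
apply/ffunP => a; rewrite !ffunE; case: (boolP (a \in P h.1)) => //= aP.
rewrite (dep_sub (@cres_sub _ _ _ _ cm) _ (slot_dep _ _ _ _)) //.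
rewrite subUset !sub1set (flip_hub cd_inj) !inE eqxx /=.
by apply/orP; right; apply/imsetP; exists a.
Qed.

Let x_dep b h S : inc b h S -> dep (cres cm) (lv b S |: sl b h) (x b h S).
Proof.
move=> i w; rewrite /x (dep_sub (@cres_sub _ _ _ _ cm) _ (slot_dep _ _ _ _)) //.
rewrite subUset !sub1set (hub_flip i) !inE eqxx /= andbT.
by rewrite /sl (inc_served i) !inE eqxx orbT.
Qed.

Let sl_disj b h h' : h != h' -> [disjoint sl b h & sl b h'].
Proof.
move=> hh'; rewrite /sl.
case sh: (served h); last by rewrite -setI_eq0 set0I.
case sh': (served h'); last by rewrite -setI_eq0 setI0.
rewrite -setI_eq0; apply/eqP/setP => u; rewrite !inE.
apply/negP => /andP[/orP[/eqP ->|/imsetP[a aP ->]] /orP[/eqP e|/imsetP[a' aP' e]]].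
- by move: hh'; rewrite (hubv_inj cd_inj e) eqxx.
- by move: (hubv_leaf cd_inj (base b) h (ext h' a')); rewrite e eqxx.
- by move: (hubv_leaf cd_inj (base b) h' (ext h a)); rewrite e eqxx.
(* A pinned leaf common to lines in different directions would have its coordinate in direction
   [h.1] both in [P], as a pin of [h], and in [Q], as [h'] is served. *)
- have {}e := leaf_inj cd_inj e.
  have [i|i] := eqVneq h.1 h'.1.
    by move: hh'; have [-> _] := ext_inj i e; rewrite eqxx.
  have : ext h a h.1 = a by rewrite ext_at.
  rewrite e; rewrite eq_sym in i; have [l jl _] := unlift_some i.
  rewrite {1}jl ext_lift => ea; apply: (pin_not_served _ aP); rewrite -ea {1}jl.
  by move/forallP: sh'; apply.
Qed.

Let lv_sl b h S : lv b S \notin sl b h.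
Proof.
rewrite /sl; case: (served h); rewrite ?inE //.
rewrite eq_sym (negbTE (hubv_leaf cd_inj _ _ _)) /=.
apply/imsetP => -[a aP /(leaf_inj cd_inj) e].
by apply: (pin_not_served _ aP); rewrite -(ext_at h a) -e on_gridP.
Qed.

Let lv_inj b : injective (lv b).
Proof. by move=> S S' /(leaf_inj cd_inj)/val_inj. Qed.

Let inc_inj b h : {in [set S | inc b h S] &, injective (fun S : Pt => val S h.1)}.
Proof.
move=> S S'; rewrite !inE => /eqP e /eqP e' eS; apply: val_inj.
by rewrite -(ext_line (val S) h.1) -(ext_line (val S') h.1) e e' eS.
Qed.

Let inc_card b h : #|[set S | inc b h S]|%:R <= M%:R :> R.
Proof.
by rewrite ler_nat -(card_in_imset (@inc_inj b h)) -[leqRHS]card_ord max_card.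
Qed.

Let d_exc b l S h : d b l S = Some h ->
  [/\ inc b h S, I b h.1 & viable (hubv cd (base b) h) h.1 (val S h.1) (l h)].
Proof.
rewrite /d; case: pickP => //= i /andP[Ii ei] [<-] /=; split=> //.
by rewrite /inc eqxx.
Qed.

Let d_inc b l S h : d b l S = Some h -> inc b h S.
Proof. by case/d_exc. Qed.

Let d_reg b l S h : d b l S = Some h -> regular mu (lam b) (x b) (inc b) M%:R v h (l h).
Proof.
case/d_exc => i _ /and3P[_ _ hcov] wt wt01 wt0.
have lamE : lam b h = hub_label (hubv cd (base b) h) h.1.
  by rewrite /lam (inc_served i).
have := line_regular (@cmu_ge0 _ _ _ _ cm) (@inc_inj b h)
  (A := A h.1) _ v_gt0 hcov wt01.
rewrite lamE => H; apply: le_trans (H _); last first.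
  by move=> S'; rewrite inE => /eqP <- /=; apply: (subsetP (QA _)); exact: on_gridP.
rewrite le_eqVlt; apply/orP; left; apply/eqP; apply: eq_Ex => w.
congr (_ * _ ^+ 2); rewrite [RHS]big_mkcond; apply: eq_bigr => S' _.
rewrite inE; case: (boolP (inc b h S')) => [_|ni]; first by rewrite /attach lamE.
by have [->|/wt0] := eqVneq (wt S') 0; rewrite ?mul0r // (negbTE ni).
Qed.

Let att_thr b l S h : d b l S = Some h -> threshold (lv b S) <= attach mu (lam b) (x b) h S (l h).
Proof.
case/d_exc => i _ /and3P[_ + _]; rewrite (hub_flip i).
by rewrite /attach /lam (inc_served i).
Qed.

Lemma lab_val b w (S : Pt) i :
  labv lam b w (line_of (val S) i) = hub_label (hubv cd (base b) (line_of (val S) i)) i w.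
Proof.
rewrite ffunE /lam /=; have -> // : served (line_of (val S) i).
by apply/forallP => l; rewrite ffunE on_gridP.
Qed.

Lemma d_labv b w S : d b (labv lam b w) S =
  omap (fun i => line_of (val S) i) (des (base b) (I b) (val S) w).
Proof.
by rewrite /d /designated; congr omap; apply: eq_pick => i /=; rewrite lab_val.
Qed.

Definition attached z0 I0 S w : bool :=
  if des z0 I0 S w is Some i then slot (hubv cd z0 (line_of S i)) i (S i) w else false.

Definition des_thr z0 I0 S w : R :=
  if des z0 I0 S w is Some i then threshold (leaf cd z0 S) else 0.

Lemma attached_count t a : 0 <= t ->
  Prb mu (fun w => \sum_(S in on_grid) (attached z (I false) S w)%:R + a <=
                   \sum_(S in on_grid) des_thr z (I false) S w) <=
  expR ((r * M ^ r')%:R * (t ^+ 2 * expR t * v) - t * a / M%:R).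
Proof.
move=> t0; rewrite -card_line.
have M0 : (0 : R) < M%:R by rewrite ltr0n.
have := attach_count (@cmu_ge0 _ _ _ _ cm) (cmu_sum1 cm) (@cres_sub _ _ _ _ cm)
  (@cres_indep _ _ _ _ cm) lam_dep x_dep sl_disj lv_sl lv_inj M0 (ltW v_gt0) inc_card
  d_inc d_reg false a t0.
apply: le_trans; apply: sub_Prb => [|w /=]; first exact: cmu_ge0.
rewrite addrC -lerBrDr -sumrB => h; apply: le_trans h _.
rewrite big_sub /=; apply: ler_sum => S _.
have dS := d_labv false w S; move: dS; rewrite /attach_prb /attach_open /des_thr /attached /=.
case e: (des z (I false) (sval S) w) => [i|] /= dS; last by rewrite dS.
by rewrite dS lerD2r; exact: att_thr dS.
Qed.

(** The labels of the hubs of one leaf have disjoint supports, as the hubs belong to different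
    blocks, so their viabilities are independent. *)
Lemma und_prb (S : Pt) dl : 0 <= dl <= 1 ->
  (forall i, I false i -> dl <= Prb mu (fun w =>
     viable (hubv cd z (line_of (val S) i)) i (val S i) (hub_label (hubv cd z (line_of (val S) i)) i w))) ->
  Prb mu (fun w => ~~ des z (I false) (val S) w) <= (1 - dl) ^+ #|I false|.
Proof.
move=> /andP[dl0 dl1] hdl.
pose e i w := viable (hubv cd z (line_of (val S) i)) i (val S i) (hub_label (hubv cd z (line_of (val S) i)) i w).
have -> : Prb mu (fun w => ~~ des z (I false) (val S) w) =
    Ex mu (fun w => \prod_(i | I false i) (~~ e i w)%:R).
  apply: eq_Ex => w; rewrite /designated; case: pickP => /= [i /andP[Ii ei]|no].
    by rewrite (bigD1 i) //= /e ei mul0r.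
  by rewrite big1 // => i Ii; have := no i; rewrite Ii /= /e => ->.
rewrite (Ex_prod (cmu_sum1 cm) (@cres_sub _ _ _ _ cm) (@cres_indep _ _ _ _ cm)
  (U := fun i => sl false (line_of (val S) i))); first last.
- move=> i _ w; congr (~~ _)%:R; rewrite /e.
  have lv0 w' := lab_val false w' S i; rewrite /= in lv0.
  by have := lam_dep false (line_of (val S) i) w; rewrite -!lv0 !ffunE => ->.
- by move=> i j _ _ ij; apply: sl_disj; apply: contra_neq ij => -[].
rewrite -prodr_const; apply: ler_prod => i Ii; apply/andP; split.
  by apply: Ex_ge0 => [|w]; [exact: cmu_ge0 | rewrite ler0n].
have := PrbC (cmu_sum1 cm) (e i); rewrite /Prb => ->.
by rewrite lerD2l lerN2; exact: hdl.
Qed.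

(* Leaves with the same coordinate sum share no hub, hence are undesignated
   independently of each other. *)
Let weight (S : grid) : nat := \sum_i S i.

Let weight_line S S' i j : weight S = weight S' -> line_of S i = line_of S' j -> S = S'.
Proof.
move=> eW e; have ij : i = j by case: e.
rewrite -{j}ij in e *; rewrite -(ext_line S i) -(ext_line S' i) e.
congr (ext _ _); move: eW; rewrite /weight (bigD1_ord i) // (bigD1_ord i (P := predT)) //=.
have -> : (\sum_(k < r') S (lift i k) = \sum_(k < r') S' (lift i k))%N.
  apply: eq_bigr => k _; case: e => /ffunP/(_ k); rewrite !ffunE => ->.
  by [].
by move/addIn/val_inj.
Qed.

(** The leaves are split by coordinate sum into at most r M + 1 classes. Within a class one
    coordinate is determined by the others, hence the size at most M^(r-1); Chernoff applies in each
    class with slack [a], and the slacks add up. *)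
Lemma undesignated_count (good : {set grid}) dl t a : 0 <= dl <= 1 -> 0 <= t ->
  (forall S i, S \in good -> I false i -> dl <= Prb mu (fun w =>
     viable (hubv cd z (line_of S i)) i (S i) (hub_label (hubv cd z (line_of S i)) i w))) ->
  Prb mu (fun w => (r * M).+1%:R * a + M%:R ^+ r * (1 - dl) ^+ #|I false| <=
    #|[set S in on_grid | (S \in good) && ~~ des z (I false) S w]|%:R) <=
  (r * M).+1%:R * expR ((M ^ r')%:R * (t ^+ 2 * expR t) - t * a).
Proof.
move=> dl01 t0 hdl; set pi := (1 - dl) ^+ _.
have /andP[dl0 dl1] := dl01.
have pi0 : 0 <= pi by rewrite exprn_ge0 // subr_ge0.
pose cls (k : 'I_(r * M).+1) : {set Pt} := [set S : Pt | (val S \in good) && (weight (val S) == k)].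
have wlt (S : grid) : (weight S < (r * M).+1)%N.
  rewrite ltnS /weight; have -> : (r * M = \sum_(i < r) M)%N by rewrite sum_nat_const card_ord.
  by apply: leq_sum => i _; exact: ltnW.
have cls_card k : (#|cls k| <= M ^ r')%N.
  have inj : {in cls k &, injective (fun S : Pt => drop_at ord0 (val S))}.
    move=> S S'; rewrite !inE => /andP[_ /eqP e] /andP[_ /eqP e'] ed.
    by apply: val_inj; apply: (@weight_line _ _ ord0 ord0); rewrite ?e ?e' // /line_of ed.
  by rewrite -(card_in_imset inj); apply: leq_trans (max_card _) _; rewrite card_ffun !card_ord.
have := @chernoff _ _ mu (@cmu_ge0 _ _ _ _ cm) (cmu_sum1 cm) _ (cres cm) (@cres_sub _ _ _ _ cm)
  (@cres_indep _ _ _ _ cm) Pt.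
move=> /(_ _ (fun S : Pt => \bigcup_i sl false (line_of (val S) i))
  (fun S w => ~~ des z (I false) (val S) w) (fun=> pi) t a) cher.
have {}cher k : Prb mu (fun w => a + \sum_(S in cls k) pi <=
    \sum_(S in cls k) (~~ des z (I false) (val S) w)%:R) <=
  expR ((M ^ r')%:R * (t ^+ 2 * expR t) - t * a).
  apply: le_trans (cher (mem (cls k)) _ _ _ t0) _.
  - move=> S S'; rewrite !inE => /andP[_ /eqP e] /andP[_ /eqP e'] SS'.
    apply: bigcup_disjoint => i _; rewrite disjoint_sym; apply: bigcup_disjoint => j _.
    apply: sl_disj; apply: contra_neq SS' => /weight_line eS; apply: val_inj.
    by apply/esym/eS; rewrite e e'.
  - move=> S _ w; congr (~~ _); congr isSome; apply: eq_pick => i /=.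
    have sub : sl false (line_of (val S) i) \subset \bigcup_i0 sl false (line_of (val S) i0).
      exact: (bigcup_sup i).
    have := dep_sub (@cres_sub _ _ _ _ cm) sub (lam_dep false (line_of (val S) i)) w.
    have lv0 w' := lab_val false w' S i; rewrite /= in lv0.
    by rewrite -!lv0 !ffunE => ->.
  - move=> S; rewrite !inE => /andP[gS _]; apply: und_prb => // i Ii; exact: hdl.
  rewrite ler_expR lerD2r; apply: ler_wpM2r; first by rewrite mulr_ge0 ?sqr_ge0 ?expR_ge0.
  by rewrite ler_nat; exact: cls_card.
apply: (@le_trans _ _ (\sum_(k < (r * M).+1) expR ((M ^ r')%:R * (t ^+ 2 * expR t) - t * a))); last first.
  by rewrite sumr_const card_ord -[leLHS]mulr_natl.
have := Prb_has (@cmu_ge0 _ _ _ _ cm) predT (fun k w => a + \sum_(S in cls k) pi <=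
    \sum_(S in cls k) (~~ des z (I false) (val S) w)%:R).
move=> /le_trans/(_ (ler_sum _ (fun k _ => cher k))); apply: le_trans.
apply: sub_Prb => [|w /= hw]; first exact: cmu_ge0.
rewrite -[X in is_true X]negbK negb_exists; apply/negP => /forallP nk.
move: hw; apply/negP; rewrite -ltNge.
have -> : #|[set S in on_grid | (S \in good) && ~~ des z (I false) S w]|%:R =
    \sum_(k < (r * M).+1) \sum_(S in cls k) (~~ des z (I false) (val S) w)%:R :> R.
  under eq_bigr => k _ do rewrite big_mkcond.
  rewrite exchange_big /= -sum1_card natr_sum big_mkcond [LHS](bigID (mem on_grid)) /=.
  rewrite [X in _ + X]big1 ?addr0; last by move=> S nS; rewrite inE (negbTE nS).
  rewrite (big_sub _ (fun S => if S \in [set S in on_grid | (S \in good) && ~~ des z (I false) S w] then 1%:R else 0)).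
  apply: eq_bigr => S _; rewrite (bigD1 (Ordinal (wlt (val S)))) //= big1; last first.
    move=> k; rewrite inE -val_eqE /= eq_sym => /negbTE ->; by rewrite andbF.
  rewrite addr0 !inE eqxx andbT; case: S => S /= Sg.
  move: Sg; rewrite inE => ->; case: (S \in good) => //=.
  by case: (des _ _ _ _).
apply: (@lt_le_trans _ _ (\sum_(k < (r * M).+1) (a + \sum_(S in cls k) pi))).
  apply: ltr_sum => [|k _]; last by have := nk k; rewrite -ltNge.
  by apply/hasP; exists ord0; rewrite ?mem_index_enum.
rewrite big_split /= sumr_const card_ord -[a *+ _]mulr_natl lerD2l.
under eq_bigr do rewrite sumr_const -[pi *+ _]mulr_natl.
rewrite -big_distrl /= ler_wpM2r // -natr_sum -natrX ler_nat.
have -> : (\sum_(k < (r * M).+1) #|cls k| = \sum_(S : Pt | val S \in good) 1)%N.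
  under eq_bigr => k _ do rewrite -sum1_card big_mkcond.
  rewrite exchange_big [RHS]big_mkcond /=; apply: eq_bigr => S _.
  rewrite (bigD1 (Ordinal (wlt (val S)))) //= big1; last first.
    move=> k; rewrite inE -val_eqE /= eq_sym => /negbTE ->; by rewrite andbF.
  by rewrite addn0 inE eqxx andbT.
rewrite sum1_card; apply: leq_trans (max_card _) _.
by rewrite card_sig; apply: leq_trans (max_card _) _; rewrite card_ffun !card_ord.
Qed.

Hypothesis g_unused : forall i a, a \in Q i :|: P i -> cd i a != g.

(** No served or pinned slot flips [g], so coordinate [g] of every vertex in use is that of the
    base; this tells the two sides apart. *)
Let supp_at_g b u : u \in supp sl lv b -> u g = base b g.
Proof.
have hl h : served h -> [exists l, cd (lift h.1 l) (h.2 l) == g] = false.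
  move=> /forallP sh; apply/existsP => -[l]; apply/negP.
  by apply: g_unused; rewrite inE sh.
rewrite inE => /orP[/bigcupP[h _]|/imsetP[S _ ->]]; last first.
  rewrite ffunE (_ : [exists _, _] = false) ?addbF //.
  apply/existsP => -[i]; apply/negP; apply: g_unused.
  by rewrite inE on_gridP.
rewrite /sl; case sh: (served h); rewrite ?inE //.
case/orP => [/eqP ->|/imsetP[a aP ->]]; first by rewrite ffunE hl ?addbF.
rewrite ffunE (_ : [exists _, _] = false) ?addbF //.
apply/existsP => -[i]; apply/negP; apply: g_unused; rewrite inE.
case: (unliftP h.1 i) => [l ->|->]; last by rewrite ext_at aP orbT.
by rewrite ext_lift; move/forallP: sh => ->.
Qed.

Let sides_disj : [disjoint supp sl lv false & supp sl lv true].
Proof.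
rewrite -setI_eq0; apply/eqP/setP => u; rewrite in_set0 in_setI; apply/negP => /andP[].
move=> /supp_at_g ue /supp_at_g; rewrite ue /= ffunE eqxx addbT.
by case: (z g).
Qed.

Definition crossed w : {set grid} := [set S in on_grid |
  match deshub z (I false) S w, deshub (flip z g) (I true) S w with
  | Some h0, Some h1 => ~~ cconn cm w h0 h1
  | _, _ => false end].

Variables (theta epsc eta : R).
Hypothesis theta_ge0 : 0 <= theta.
Hypothesis theta_thr : forall u, theta <= threshold u.
Hypothesis gap : 3 * eta <= (theta ^+ 2 - q) * epsc.
Hypothesis gap_ge0 : 0 <= theta ^+ 2 - q.

(** A canonical vertex of the component, so that a colouring of components becomes a colouring of
    vertices. *)
Let root w u : V := odflt u [pick u' | cconn cm w u u'].

Let root_conn w u : cconn cm w u (root w u).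
Proof. by rewrite /root; case: pickP => //= /(_ u); rewrite cconn_refl. Qed.

Let root_eq w u u' : cconn cm w u u' -> root w u = root w u'.
Proof.
move=> c; rewrite /root.
have -> : [pick u0 | cconn cm w u u0] = [pick u0 | cconn cm w u' u0].
  apply: eq_pick => k; apply/idP/idP => h.
    by apply: cconn_trans h; rewrite cconn_sym.
  exact: cconn_trans h.
by case: pickP => // /(_ u'); rewrite cconn_refl.
Qed.

Let Yr (S : Pt) := cY cm (lv false S) (lv true S).

Let lvE S : lv true S = flip (lv false S) g.
Proof. by rewrite /lv flip_leaf_base. Qed.

Let xx_conn b w S h : d b (labv lam b w) S = Some h -> attach_open x d b (labv lam b w) S w ->
  cX cm (lv b S) w /\ cconn cm w (hubv cd (base b) h) (lv b S).
Proof.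
move=> dS; rewrite /attach_open dS /x /slot; have [i _ /and3P[l1 _ _]] := d_exc dS.
rewrite (hub_flip i) => /andP[Xl Yl]; split=> //.
move: l1; rewrite ffunE /lam (inc_served i) /= => Xh.
have := @cconn_edge _ _ _ _ cm w (hubv cd (base b) h) (cd h.1 (val S h.1)).
by rewrite (hub_flip i); apply.
Qed.

(** By [half_cut] some 2-colouring of the components separates at least half of the crossed pairs,
    whence the factor 2 in the event. The induced colouring of hubs is then separated in the sense
    of [linking]. *)
Lemma crossed_prb t t' : 0 <= t -> 0 <= t' ->
  Prb mu (fun w => 2 * (epsc * M%:R ^+ r) <= #|crossed w|%:R) <=
  2 ^+ (2 * (r * M ^ r')) * (expR (M%:R ^+ r * (t' ^+ 2 * expR t') - t' * (eta * M%:R ^+ r)) +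
     2 * expR ((r * M ^ r')%:R * (t ^+ 2 * expR t * v) - t * (eta * M%:R ^+ r) / M%:R)).
Proof.
move=> t0 t'0; rewrite -card_line.
have M0 : (0 : R) < M%:R by rewrite ltr0n.
have Ydep S : dep (cres cm) [set lv false S; lv true S] (Yr S) by exact: cY_dep.
have Yp S : Prb mu (fun w => ~~ Yr S w) <= q by rewrite /Yr lvE; exact: cY_prb.
have card : #|{: Pt}|%:R <= M%:R ^+ r :> R.
  rewrite -natrX ler_nat card_sig; apply: leq_trans (max_card _) _.
  by rewrite card_ffun !card_ord.
have thr_att b l S h : d b l S = Some h -> theta <= attach mu (lam b) (x b) h S (l h).
  by move/att_thr; apply: le_trans.
have := linking (@cmu_ge0 _ _ _ _ cm) (cmu_sum1 cm) (@cres_sub _ _ _ _ cm)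
  (@cres_indep _ _ _ _ cm) lam_dep x_dep sl_disj lv_sl lv_inj M0 (ltW v_gt0) inc_card
  d_inc d_reg sides_disj Ydep Yp card theta_ge0 thr_att gap gap_ge0 t0 t'0.
apply: le_trans; apply: sub_Prb => [|w /= hw]; first exact: cmu_ge0.
pose hb b (S : Pt) : V :=
  if d b (labv lam b w) S is Some h then root w (hubv cd (base b) h) else z.
pose T : {set Pt} := [set S : Pt | val S \in crossed w].
have TE : #|T| = #|crossed w|.
  rewrite -(card_imset (mem T) val_inj); apply: eq_card => S.
  apply/imsetP/idP => [[S' + ->]|cS]; first by rewrite inE.
  have Sg : S \in on_grid by move: cS; rewrite inE => /andP[].
  by exists (exist _ S Sg) => //; rewrite in_set.
have Td S : S \in T -> exists h0 h1, [/\ d false (labv lam false w) S = Some h0,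
   d true (labv lam true w) S = Some h1 &
   ~~ cconn cm w (hubv cd (base false) h0) (hubv cd (base true) h1)].
  rewrite !inE => /andP[_]; rewrite /designated_hub.
  have := d_labv false w S; have := d_labv true w S => /=.
  case: (des z (I false) (sval S) w) => [i0|] //=.
  case: (des (flip z g) (I true) (sval S) w) => [i1|] //= -> -> nc.
  by exists (line_of (sval S) i0), (line_of (sval S) i1).
have hneq S : S \in T -> hb false S != hb true S.
  move=> /Td[h0 [h1 [e0 e1]]]; rewrite /hb e0 e1; apply: contraNneq => er.
  apply: cconn_trans (root_conn _ _) _; rewrite er cconn_sym; exact: root_conn.
have [chi hchi] := half_cut hneq.
(* Colouring a hub by its component makes linked hubs equal in colour, so no leaf with differently
   coloured hubs can be linked. *)
apply/existsP; exists [ffun bh => chi (root w (hubv cd (base bh.1) bh.2))].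
set c := [ffun bh => _]; apply/andP; split.
  apply: (@le_trans _ _ (#|[set S in T | chi (hb false S) != chi (hb true S)]|%:R)).
    rewrite -(@ler_pM2l _ 2) //; apply: le_trans hw _.
    by rewrite -natrM ler_nat -TE.
  rewrite ler_nat subset_leq_card //; apply/subsetP => S; rewrite in_set => /andP[].
  by case/Td => h0 [h1 [e0 e1 _]]; rewrite in_set /hb e0 e1 !ffunE.
apply/forall_inP => S; rewrite inE.
case e0: (d false (labv lam false w) S) => [h0|] //.
case e1: (d true (labv lam true w) S) => [h1|] //.
rewrite !ffunE /=; apply: contra => /and3P[x0 x1 Y01].
have [X0 c0] := xx_conn e0 x0; have [X1 c1] := xx_conn e1 x1.
rewrite (@root_eq w _ (hubv cd (base true) h1)) //.
apply: cconn_trans c0 _; rewrite cconn_sym; apply: cconn_trans c1 _.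
rewrite cconn_sym; move: X1 Y01; rewrite /Yr lvE; exact: cconn_edge.
Qed.

End Claim.

(** * Mixing *)

Section Mixing.
Variables (R : realType) (U : finType) (M r : nat).
Local Notation grid := {ffun 'I_r -> 'I_M}.
Implicit Types (S T : grid) (j : 'I_r).

Definition upd j S (e : 'I_M) : grid := [ffun i => if i == j then e else S i].

Definition swap j (p : grid * grid) : grid * grid := (upd j p.1 (p.2 j), upd j p.2 (p.1 j)).

Lemma swapK j : involutive (swap j).
Proof.
case=> S T; rewrite /swap /=; congr pair; apply/ffunP => i; rewrite !ffunE eqxx.
  by case: eqP => [->|].
by case: eqP => [->|].
Qed.

Variables (conn : rel U) (d0 : grid -> option U) (dj : 'I_r -> 'I_M -> grid -> option U).
Variables (ok : {set grid}) (C : 'I_r -> 'I_M -> {set grid}).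
Hypothesis conn_sym : symmetric conn.
Hypothesis conn_trans : transitive conn.
Hypothesis conn_refl : reflexive conn.
Hypothesis ok_upd : forall j S T, S \in ok -> T \in ok -> upd j S (T j) \in ok.
Hypothesis dj_sym : forall j e S, dj j e S = dj j (S j) (upd j S e).
Hypothesis dj_conn : forall j S T h0 h1, S \in ok -> T \in ok -> S j != T j ->
  S \notin C j (T j) -> d0 S = Some h0 -> dj j (T j) S = Some h1 -> conn h0 h1.
Variables (nu mu0 mu1 c : R).
Hypothesis c_ge0 : 0 <= c.
Let m : R := #|{: grid}|%:R.
Hypothesis nu_le : #|~: ok|%:R <= nu * m.
Hypothesis mu0_le : #|[set S | ~~ d0 S]|%:R <= mu0 * m.
Hypothesis mu1_le : forall j, \sum_(T : grid) #|[set S in ok | ~~ dj j (T j) S]|%:R <= mu1 * m ^+ 2.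
Hypothesis c_le : forall j T, T \in ok -> #|C j (T j)|%:R <= c * m.

Definition agree S T : bool :=
  match d0 S, d0 T with Some h, Some h' => conn h h' | _, _ => false end.

Lemma agree_trans : transitive agree.
Proof.
move=> S S' S''; rewrite /agree; case: (d0 S') (d0 S) (d0 S'') => [h'|] [h|] [h''|] //.
exact: conn_trans.
Qed.

(** Let S' be S with its j-th coordinate taken from T. By [dj_sym] the hub [dj] for S with the base
    moved by T j equals that for S' with the base moved by S j. Outside the listed exceptions the
    hubs [d0] of S and of S' are both connected to it, hence to each other. *)
Lemma disagree_step j (p : grid * grid) :
  (~~ agree p.1 (swap j p).1 : nat)%:R <=
   (p.1 \notin ok)%:R + (p.2 \notin ok)%:R + (~~ d0 p.1)%:R + (~~ d0 (swap j p).1)%:R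
   + ((p.1 \in ok) && ~~ dj j (p.2 j) p.1)%:R
   + ((p.2 \in ok) && (p.1 \in C j (p.2 j)))%:R
   + (((swap j p).2 \in ok) && ((swap j p).1 \in C j ((swap j p).2 j)))%:R :> R.
Proof.
rewrite -!natrD ler_nat.
case: (boolP (agree _ _)) => //= nag.
case: (boolP (p.1 \in ok)) => //= S_ok; case: (boolP (p.2 \in ok)) => //= T_ok.
case e0: (d0 p.1) => [h0|] //; case e0': (d0 (swap j p).1) => [h0'|] //=.
case e1: (dj j (p.2 j) p.1) => [h1|] //=.
case: (boolP (p.1 \in C _ _)) => //= nC.
have S'ok : (swap j p).1 \in ok by exact: ok_upd.
have T'ok : (swap j p).2 \in ok by exact: ok_upd.
case: (boolP ((swap j p).1 \in C _ _)) => /= nC'; first by rewrite T'ok.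
have [eST|nST] := eqVneq (p.1 j) (p.2 j).
  have pp : upd j p.1 (p.2 j) = p.1.
    by apply/ffunP => i; rewrite ffunE; case: eqP => // ->.
  by rewrite /= in nag; move: nag; rewrite /agree pp e0 conn_refl.
have c0 := dj_conn S_ok T_ok nST nC e0 e1.
have e1' : dj j ((swap j p).2 j) (swap j p).1 = Some h1.
  by rewrite -e1 [RHS]dj_sym /swap /= [upd j p.2 _ j]ffunE eqxx.
have nST' : (swap j p).1 j != (swap j p).2 j by rewrite !ffunE !eqxx eq_sym.
have c1 := dj_conn S'ok T'ok nST' nC' e0' e1'.
rewrite /= in e0' nag; move: nag; rewrite /agree e0 e0'; case/negP.
by apply: conn_trans c0 _; rewrite conn_sym.
Qed.

Let sum_fst (F : grid -> R) : \sum_(p : grid * grid) F p.1 = m * \sum_S F S.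
Proof.
rewrite -(pair_big predT predT (fun S T => F S)) /= big_distrr /=.
by apply: eq_bigr => S _; rewrite sumr_const mulr_natl.
Qed.

Let sum_swap j (F : grid * grid -> R) : \sum_p F (swap j p) = \sum_p F p.
Proof. by rewrite [RHS](reindex_inj (inv_inj (swapK j))). Qed.

Let sum_card (B : {set grid}) : \sum_S (S \in B)%:R = #|B|%:R :> R.
Proof.
rewrite -natr_sum -sum1_card; congr (_%:R); rewrite [RHS]big_mkcond.
by apply: eq_bigr => S _; case: (S \in B).
Qed.

Let m_ge0 : 0 <= m. Proof. exact: ler0n. Qed.

(** [swap j] permutes the pairs, so every term evaluated at the swapped pair has the same sum as the
    corresponding term at the pair itself. *)
Lemma disagree_sum j :
  \sum_p (~~ agree p.1 (swap j p).1)%:R <= (2 * nu + 2 * mu0 + mu1 + 2 * c) * m ^+ 2.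
Proof.
apply: le_trans (ler_sum _ (fun p _ => disagree_step j p)) _.
rewrite !big_split /= expr2.
have b1 : \sum_(p : grid * grid) (p.1 \notin ok)%:R <= nu * (m * m).
  rewrite (sum_fst (fun S => (S \notin ok)%:R)) mulrCA ler_wpM2l //.
  by have := nu_le; rewrite -sum_card; under eq_bigr do rewrite in_setC.
have b2 : \sum_(p : grid * grid) (p.2 \notin ok)%:R <= nu * (m * m).
  apply: le_trans b1; rewrite -(pair_big predT predT (fun S T => (T \notin ok)%:R)) /=.
  by rewrite exchange_big (pair_big predT predT (fun S T => (S \notin ok)%:R)).
have b3 : \sum_(p : grid * grid) (~~ d0 p.1)%:R <= mu0 * (m * m).
  rewrite (sum_fst (fun S => (~~ d0 S)%:R)) mulrCA ler_wpM2l //.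
  by have := mu0_le; rewrite -sum_card; under eq_bigr do rewrite inE.
have b4 : \sum_(p : grid * grid) (~~ d0 (upd j p.1 (p.2 j)))%:R <= mu0 * (m * m).
  by rewrite (sum_swap j (fun p : grid * grid => (~~ d0 p.1)%:R)).
have b5 : \sum_(p : grid * grid) ((p.1 \in ok) && ~~ dj j (p.2 j) p.1)%:R <= mu1 * (m * m).
  rewrite -(pair_big predT predT (fun S T => ((S \in ok) && ~~ dj j (T j) S)%:R)) /=.
  rewrite exchange_big -expr2; apply: le_trans (mu1_le j); apply: ler_sum => T _ /=.
  by rewrite -sum_card; under [leRHS]eq_bigr do rewrite inE.
have b6 : \sum_(p : grid * grid) ((p.2 \in ok) && (p.1 \in C j (p.2 j)))%:R <= c * (m * m).
  rewrite -(pair_big predT predT (fun S T => ((T \in ok) && (S \in C j (T j)))%:R)) /=.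
  rewrite exchange_big /=.
  apply: (@le_trans _ _ (\sum_(T : grid) c * m)).
    apply: ler_sum => T _; case: (boolP (T \in ok)) => [Tok|_] /=.
      by apply: le_trans (c_le j Tok); rewrite -sum_card.
    by rewrite big1 // mulr_ge0.
  by rewrite sumr_const -[_ *+ _]mulr_natr -/m -mulrA.
have b7 : \sum_(p : grid * grid) ((upd j p.2 (p.1 j) \in ok) &&
    (upd j p.1 (p.2 j) \in C j (upd j p.2 (p.1 j) j)))%:R <= c * (m * m).
  by rewrite (sum_swap j (fun p : grid * grid => ((p.2 \in ok) && (p.1 \in C j (p.2 j)))%:R)).
lra.
Qed.

Let hyb k (p : grid * grid) : grid := [ffun i : 'I_r => if (i < k)%N then p.2 i else p.1 i].
Let rot k (p : grid * grid) : grid * grid :=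
  (hyb k p, [ffun i : 'I_r => if (i < k)%N then p.1 i else p.2 i]).

Let rotK k : involutive (rot k).
Proof.
case=> S T; rewrite /rot /hyb /=; congr pair; apply/ffunP => i; rewrite !ffunE /=; by case: (i < k)%N.
Qed.

(** Hybrid argument: passing from S to T one coordinate at a time, a disagreement of the ends forces
    one at some step. *)
Lemma disagree_total : (0 < r)%N ->
  \sum_p (~~ agree p.1 p.2)%:R <= r%:R * (2 * nu + 2 * mu0 + mu1 + 2 * c) * m ^+ 2.
Proof.
move=> r0; have step (k : 'I_r) :
    \sum_p (~~ agree (hyb k p) (hyb k.+1 p))%:R <= (2 * nu + 2 * mu0 + mu1 + 2 * c) * m ^+ 2.
  (* The involution [rot k] turns a pair into its k-th hybrid and the complementary one, so the step
     between hybrids k and k + 1 becomes a swap of coordinate k in a uniform pair. *)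
  apply: le_trans (disagree_sum k); rewrite [leRHS](reindex_inj (inv_inj (rotK k))).
  rewrite le_eqVlt; apply/orP; left; apply/eqP; apply: eq_bigr => p _.
  congr (~~ agree _ _)%:R; apply/ffunP => i; rewrite !ffunE ltnn ltnS leq_eqVlt.
  by rewrite val_eqE; case: eqP => [->|].
rewrite -mulrA [leRHS](_ : _ = \sum_(k < r) (2 * nu + 2 * mu0 + mu1 + 2 * c) * m ^+ 2); last first.
  by rewrite sumr_const card_ord mulr_natl.
apply: le_trans (ler_sum _ (fun k _ => step k)).
rewrite exchange_big /=; apply: ler_sum => p _; rewrite -natr_sum ler_nat.
case: (boolP (agree _ _)) => //= nag; rewrite lt0n sum_nat_eq0 negb_forall.
apply: contraNT nag; rewrite negb_exists => /forallP ag.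
have {}ag (k : 'I_r) : agree (hyb k p) (hyb k.+1 p).
  by have := ag k; rewrite negbK; case: (agree _ _).
have h0 : hyb 0 p = p.1 by apply/ffunP => i; rewrite ffunE.
have hr : hyb r p = p.2 by apply/ffunP => i; rewrite ffunE ltn_ord.
rewrite -h0 -hr; suff all k : (k < r)%N -> agree (hyb 0 p) (hyb k.+1 p).
  by case: (r) r0 all => // r1 _; apply.
elim: k => [|k IH] kr; first exact: (ag (Ordinal kr)).
exact: agree_trans (IH (ltnW kr)) (ag (Ordinal kr)).
Qed.

(** Some S has at most the average number of disagreements. As this is a proportion below 1, S has a
    hub: without one it would disagree with every T. *)
Lemma mostly_agree : (0 < r)%N -> 0 < m -> r%:R * (2 * nu + 2 * mu0 + mu1 + 2 * c) < 1 ->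
  exists h, #|[set T | ~~ (if d0 T is Some h' then conn h h' else false)]|%:R <=
    r%:R * (2 * nu + 2 * mu0 + mu1 + 2 * c) * m.
Proof.
move=> r0 m0; set lam := _ * _ => lam1.
have [S hS] : exists S, #|[set T | ~~ agree S T]|%:R <= lam * m.
  apply/existsP; apply: contraT; rewrite negb_exists => /forallP big.
  have : \sum_p (~~ agree p.1 p.2)%:R <= lam * m ^+ 2 by exact: disagree_total.
  rewrite leNgt => /negP[]; rewrite -(pair_big predT predT (fun S T => (~~ agree S T)%:R)) /=.
  have -> : lam * m ^+ 2 = \sum_(S : grid) lam * m.
    by rewrite sumr_const -[_ *+ _]mulr_natr expr2 mulrA.
  apply: ltr_sum => [|S _].
    have /card_gt0P[S _] : (0 < #|{: grid}|)%N by rewrite -(ltr_nat R).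
    by apply/hasP; exists S; rewrite ?mem_index_enum.
  have := big S; rewrite -ltNge => /lt_le_trans; apply.
  by rewrite -sum_card; apply: ler_sum => T _; rewrite inE.
case e0: (d0 S) => [h|]; last first.
  move: hS; rewrite leNgt => /negP[].
  have -> : [set T | ~~ agree S T] = setT by apply/setP => T; rewrite !inE /agree e0.
  by rewrite cardsT gtr_pMl.
by exists h; move: hS; rewrite /agree e0.
Qed.

End Mixing.

(** * Choice of the pins *)

Section Pins.
Variables (R : realType) (P0 q : R) (N M r' : nat) (cm : coarse_model P0 q N).
Local Notation r := r'.+1.
Variable cd : 'I_r -> 'I_M -> 'I_N.
Hypothesis cd_inj : forall i a j b, cd i a = cd j b -> i = j /\ a = b.
Local Notation V := {ffun 'I_N -> bool}.
Local Notation grid := {ffun 'I_r -> 'I_M}.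
Local Notation mu := (cmu cm).
Variables (eps v : R).
Hypothesis v_gt0 : 0 < v.
Hypothesis M_gt0 : (0 < M)%N.
Hypothesis P0_gt0 : 0 < P0.
Hypothesis q_ge0 : 0 <= q.
Hypothesis eps_gt0 : 0 < eps.
Hypothesis theta_ge0 : 0 <= P0 - q / P0 - eps.
Implicit Types (A P : 'I_r -> {set 'I_M}).

Lemma thr_ge u : P0 - q / P0 - eps <= threshold cm eps u.
Proof. by rewrite /threshold !lerD2r; exact: cX_prb. Qed.

Lemma flip_neq (h : V) c : h != flip h c.
Proof.
by apply/eqP => /ffunP/(_ c); rewrite ffunE eqxx addbT; case: (h c).
Qed.

Definition mean_cov A P (h : V) i : R :=
  Ex mu (fun w => pin_cov mu (cX cm h) (slot cm cd h i) (A i) (P i) (hub_label cm cd P h i w)).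

Lemma mean_cov_ge0 A P h i : 0 <= mean_cov A P h i.
Proof.
apply: Ex_ge0 => [|w]; first exact: cmu_ge0.
by rewrite sumr_ge0 // => a _; rewrite sumr_ge0 // => c _; exact: sqr_ge0.
Qed.

(** Let X be the activity of the hub. The mean of X times prediction minus threshold is at least eps
    P(X), hence at least eps P0, by independence of hub and leaf; as predictions are at most 1, an
    active hub predicts above the threshold with probability at least eps P0. Markov applied to the
    covariances costs half of this. *)
Lemma viable_prb A P h i a :
  mean_cov A P h i <= eps * P0 / 2 * v ^+ 2 * M%:R ^+ 2 ->
  eps * P0 / 2 <= Prb mu (fun w => viable cm cd eps v A P h i a (hub_label cm cd P h i w)).
Proof.
move=> hcov; set u := flip h (cd i a); set th := threshold cm eps u.
have mu0 := @cmu_ge0 _ _ _ _ cm; have mu1 := cmu_sum1 cm.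
pose cx w := cexp mu (hub_label cm cd P h i) (fun w0 => (slot cm cd h i a w0)%:R) (hub_label cm cd P h i w).
pose K w := pin_cov mu (cX cm h) (slot cm cd h i) (A i) (P i) (hub_label cm cd P h i w).
pose E1 w := cX cm h w && (th <= cx w).
pose E2 w := v ^+ 2 * M%:R ^+ 2 < K w.
have M0 : (0 : R) < M%:R by rewrite ltr0n.
have vM : 0 < v ^+ 2 * M%:R ^+ 2 by rewrite mulr_gt0 ?exprn_gt0.
have h2 : Prb mu E2 <= eps * P0 / 2.
  rewrite -(ler_pM2r vM) [leRHS]mulrA; apply: le_trans hcov.
  rewrite -ExZr; apply: ler_Ex => // w; rewrite /E2 -/(K w).
  case: ltP => [/ltW|_] /=; first by rewrite mul1r.
  by rewrite mul0r sumr_ge0 // => x _; rewrite sumr_ge0 // => c _; exact: sqr_ge0.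
have h1 : eps * P0 <= Prb mu E1.
  have hX := cX_prb cm h.
  have e1 : Ex mu (fun w => (cX cm h w)%:R * (cx w - th)) =
      Ex mu (fun w => (slot cm cd h i a w)%:R * (cX cm h w)%:R) - th * Prb mu (cX cm h).
    have := Ex_ce mu0 (hub_label cm cd P h i) (fun w0 => (slot cm cd h i a w0)%:R)
      (fun l : bool * {ffun 'I_M -> bool} => l.1%:R).
    move=> /= <-; rewrite /Prb -ExZ -ExB; apply: eq_Ex => w; rewrite /cx; ring.
  have e2 : Prb mu (cX cm h) * Prb mu (cX cm u) - q <=
      Ex mu (fun w => (slot cm cd h i a w)%:R * (cX cm h w)%:R).
    have <- : Ex mu (fun w => (cX cm h w)%:R * (cX cm u w)%:R) =
        Prb mu (cX cm h) * Prb mu (cX cm u).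
      apply: (Ex_indep (@cres_indep _ _ _ _ cm) (U1 := [set h]) (U2 := [set u])).
      - by rewrite disjoints1 inE flip_neq.
      - by move=> w; rewrite cX_dep.
      - by move=> w; rewrite cX_dep.
    rewrite lerBlDr; apply: le_trans (lerD (lexx _) (cY_prb cm h (cd i a))).
    rewrite -ExD; apply: ler_Ex => // w; rewrite /slot -/u.
    by case: (cX cm h w); case: (cX cm u w); case: (cY cm h u w); rewrite /= ?mulr1 ?mulr0 ?addr0 ?add0r.
  have e3 : Ex mu (fun w => (cX cm h w)%:R * (cx w - th)) <= Prb mu E1.
    apply: ler_Ex => // w; rewrite /E1; case: (cX cm h w) => /=; last by rewrite mul0r.
    rewrite mul1r; have c1 : cx w <= 1 by apply: ce_le1 => // w'; case: (slot _ _ _ _ _ _).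
    have t0 : 0 <= th by apply: le_trans theta_ge0 (thr_ge _).
    by case: (lerP th (cx w)) => /= ht; lra.
  apply: le_trans e3; rewrite e1; apply: le_trans (_ : eps * Prb mu (cX cm h) <= _).
    by rewrite ler_pM2l.
  have : q <= q / P0 * Prb mu (cX cm h).
    by rewrite -mulrA ler_peMr // mulrC ler_pdivlMr ?mul1r.
  have -> : th = Prb mu (cX cm u) - q / P0 - eps by [].
  lra.
have : Prb mu E1 - Prb mu E2 <= Prb mu (fun w => viable cm cd eps v A P h i a (hub_label cm cd P h i w)).
  rewrite -ExB; apply: ler_Ex => // w.
  rewrite /viable /E1 /E2 -/u -/th -/(cx w) -/(K w) [K w <= _]leNgt.
  have -> : (hub_label cm cd P h i w).1 = cX cm h w by [].
  by case: (cX cm h w); case: (th <= cx w); case: (v ^+ 2 * M%:R ^+ 2 < K w); rewrite /= ?subrr ?subr0 ?sub0r ?oppr_le0.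
lra.
Qed.

Definition bad A P (x : V) i (S : grid) : bool :=
  eps * P0 / 2 * v ^+ 2 * M%:R ^+ 2 < mean_cov A P (hubv cd x (line_of S i)) i.

Let m : R := M%:R ^+ r.

Lemma card_grid : #|{: grid}|%:R = m.
Proof. by rewrite card_ffun !card_ord natrX. Qed.

(** Hubs at different bases are compared, so one choice of pins must serve [z], [flip z f] and the
    bases moved inside a block. [pinning] treats them all at once, with weight 1 for the first two
    and 1/(r m) for each moved base, of total weight 3 m over the leaves. Markov at half of eps P0
    v^2 M^2 turns this 3 into the 6 of [beta]. *)
Lemma good_pins (z : V) (f : 'I_N) A (T : nat) (vv : R) (beta := 6 * vv / (eps * P0 * v ^+ 2)) :
  0 < vv -> 1 < T.+1%:R * vv ->
  exists P, forall i, [/\ P i \subset A i, (#|P i| <= T)%N,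
    #|[set S | bad A P z i S]|%:R <= beta * m,
    #|[set S | bad A P (flip z f) i S]|%:R <= beta * m &
    \sum_(jT : 'I_r * grid) #|[set S | bad A P (flip z (cd jT.1 (jT.2 jT.1))) i S]|%:R
      <= r%:R * beta * m ^+ 2].
Proof.
move=> vv0 Tv.
have M0 : (0 : R) < M%:R by rewrite ltr0n.
have m0 : 0 < m by rewrite exprn_gt0.
have rm0 : 0 < r%:R * m by rewrite mulr_gt0 // ltr0n.
pose base (p : bool + 'I_r * grid) : V :=
  match p with inl b => if b then flip z f else z | inr jT => flip z (cd jT.1 (jT.2 jT.1)) end.
pose wt (p : bool + 'I_r * grid) : R := if p is inl _ then 1 else (r%:R * m)^-1.
have wt0 p : 0 <= wt p by case: p => //= _; rewrite invr_ge0 ltW.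
have wtS : \sum_(p : (bool + 'I_r * grid) * grid) wt p.1 = 3 * m.
  rewrite -(pair_big predT predT (fun p S => wt p)) /=.
  have -> : \sum_p \sum_(S : grid) wt p = m * \sum_p wt p.
    by rewrite big_distrr; apply: eq_bigr => p _; rewrite sumr_const -[LHS]mulr_natl card_grid.
  rewrite mulrC; congr (_ * _); rewrite big_sumType /= !sumr_const card_bool.
  rewrite card_prod card_ord -[(r%:R * m)^-1 *+ _]mulr_natl natrM card_grid divff ?gt_eqF //.
  by rewrite -[3%N]/(2 + 1)%N natrD.
pose hub (p : (bool + 'I_r * grid) * grid) i := hubv cd (base p.1) (line_of p.2 i).
have ch i : exists Pi : {set 'I_M}, [/\ Pi \subset A i, (#|Pi| <= T)%N &
    \sum_p wt p.1 * mean_cov A (fun=> Pi) (hub p i) i <= vv * M%:R ^+ 2 * (3 * m)].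
  have := pinning (@cmu_ge0 _ _ _ _ cm) (cmu_sum1 cm)
    (I := ((bool + 'I_r * grid) * grid)%type) (wt := fun p => wt p.1)
    (fun p => cX cm (hub p i)) (fun p => slot cm cd (hub p i) i) (A i) (fun p => wt0 p.1) vv0 Tv.
  by rewrite wtS.
have [P hP] := fin_all_exists ch; exists P => i; have [PA PT hsum] := hP i.
have covE h : mean_cov A (fun=> P i) h i = mean_cov A P h i by [].
pose D p S := mean_cov A P (hub (p, S) i) i.
have D0 p S : 0 <= D p S by exact: mean_cov_ge0.
pose kap := eps * P0 / 2 * v ^+ 2 * M%:R ^+ 2.
have kap0 : 0 < kap by rewrite /kap !mulr_gt0 ?exprn_gt0 ?invr_gt0.
have badle p : kap * #|[set S | bad A P (base p) i S]|%:R <= \sum_S D p S.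
  rewrite -sum1_card natr_sum big_distrr /= mulr1 big_mkcond /=.
  apply: ler_sum => S _; rewrite inE /bad -/kap; case: ifP => [/ltW //|_].
  exact: D0.
have {}hsum : \sum_p wt p * \sum_S D p S <= vv * M%:R ^+ 2 * (3 * m).
  apply: le_trans hsum; rewrite -(pair_big predT predT (fun p S => wt p * D p S)) /=.
  rewrite le_eqVlt; apply/orP; left; apply/eqP; apply: eq_bigr => p _.
  by rewrite big_distrr.
have hbad : \sum_p wt p * (kap * #|[set S | bad A P (base p) i S]|%:R) <= vv * M%:R ^+ 2 * (3 * m).
  by apply: le_trans hsum; apply: ler_sum => p _; rewrite ler_wpM2l.
have betaE : vv * M%:R ^+ 2 * (3 * m) = kap * (beta * m).
  rewrite /kap /beta; field.
  by rewrite !gt_eqF.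
rewrite betaE big_sumType /= in hbad.
have s0 : 0 <= \sum_(j : 'I_r * grid) (r%:R * m)^-1 * (kap * #|[set S | bad A P (base (inr j)) i S]|%:R).
  by apply: sumr_ge0 => j _; rewrite !mulr_ge0 ?invr_ge0 // ltW.
have b0 b : 0 <= kap * #|[set S | bad A P (base (inl b)) i S]|%:R.
  by rewrite mulr_ge0 // ltW.
rewrite (bigD1 true) //= (bigD1 false) //= big1 ?addr0 in hbad; last by case.
rewrite !mul1r in hbad.
have bt := b0 true; have bf := b0 false; rewrite /= in bt bf s0.
split=> //.
- rewrite -(ler_pM2l kap0); lra.
- rewrite -(ler_pM2l kap0); lra.
- rewrite -(ler_pM2l kap0) big_distrr /=.
  have : (r%:R * m)^-1 * \sum_(j : 'I_r * grid) (kap * #|[set S | bad A P (base (inr j)) i S]|%:R)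
     <= kap * (beta * m) by rewrite big_distrr /=; lra.
  rewrite mulrC ler_pdivrMr //= => /le_trans; apply.
  by rewrite le_eqVlt; apply/orP; left; apply/eqP; ring.
Qed.

End Pins.

(** * The local theorem *)

Lemma card_natr_sum (R : realType) (I : finType) (B : pred I) :
  #|[set S | B S]|%:R = \sum_S (B S)%:R :> R.
Proof.
rewrite -sum1dep_card natr_sum [LHS]big_mkcond /=.
by apply: eq_bigr => S _; case: (B S).
Qed.

Section Majority.
Variables (R : realType) (P0 q : R) (N M r' : nat) (cm : coarse_model P0 q N).
Local Notation r := r'.+1.
Variable cd : 'I_r -> 'I_M -> 'I_N.
Hypothesis cd_inj : forall i a j b, cd i a = cd j b -> i = j /\ a = b.
Local Notation V := {ffun 'I_N -> bool}.
Local Notation grid := {ffun 'I_r -> 'I_M}.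
Local Notation mu := (cmu cm).
Variables (eps v eta kap : R) (A P : 'I_r -> {set 'I_M}).
Hypothesis q_ge0 : 0 <= q.
Hypothesis P0_gt0 : 0 < P0.
Hypothesis eps_gt0 : 0 < eps.
Local Notation des := (designated cm cd eps v A P).
Local Notation deshub := (designated_hub cm cd eps v A P).
Let m : R := M%:R ^+ r.

(** More than half of the active leaves, with a margin proportional to the number of all leaves: the
    margin later yields a component of linear size. *)
Definition majority (x h : V) w : bool :=
  kap * m + #|[set S : grid | cX cm (leaf cd x S) w]|%:R <
  2 * #|[set S : grid | cX cm (leaf cd x S) w && cconn cm w h (leaf cd x S)]|%:R.

Definition near (x h : V) w (S : grid) : bool :=
  if deshub x predT S w is Some h' then cconn cm w h h' else false.

Variables (nu mu0 tau : R) (ok : {set grid}).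
Hypothesis nu_le : #|~: ok|%:R <= nu * m.
Hypothesis kap_le : kap <= P0 - 2 * (q / P0) - 2 * eps - 3 * eta - 2 * (nu + mu0 + tau).

(** Attached leaves whose designated hub is near [h] are active and connected to [h], and their
    number is at least the sum of the thresholds up to exceptions. Twice that sum minus the expected
    number of active leaves is at least (P0 - 2 q/P0 - 2 eps) m, since activities have probability
    at least P0. Of the 3 eta, two come from the attachments and one from the activities. *)
Lemma majority_at x h w :
  #|[set S | ~~ deshub x predT S w]|%:R <= mu0 * m ->
  #|[set S | ~~ near x h w S]|%:R <= tau * m ->
  \sum_(S in ok) des_thr cd eps v A P x predT S w <
    \sum_(S in ok) (attached cd eps v A P x predT S w)%:R + eta * m ->
  #|[set S : grid | cX cm (leaf cd x S) w]|%:R <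
    eta * m + \sum_(S : grid) Prb mu (cX cm (leaf cd x S)) ->
  majority x h w.
Proof.
move=> hdes hnear hatt hact.
have cmu0 := @cmu_ge0 _ _ _ _ cm; have cmu1 := cmu_sum1 cm.
have q0 : 0 <= q / P0 by rewrite divr_ge0 // ltW.
have s1 : \sum_(S in ok) (attached cd eps v A P x predT S w)%:R <=
    \sum_(S : grid) ((cX cm (leaf cd x S) w && cconn cm w h (leaf cd x S))%:R
     + (~~ near x h w S)%:R) :> R.
  rewrite big_mkcond; apply: ler_sum => S _; case: (S \in ok); last by rewrite addr_ge0.
  rewrite /attached /near /designated_hub; case e: (des x predT S w) => [i|] /=; last by rewrite addr_ge0.
  have hf : flip (hubv cd x (line_of S i)) (cd i (S i)) = leaf cd x S.
    by rewrite (flip_hub cd_inj x (line_of S i)) ext_line.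
  rewrite -natrD ler_nat; case: (boolP (cconn cm w h (hubv cd x (line_of S i)))) => c; last first.
    by rewrite addn1; case: (slot _ _ _ _ _ _).
  case: (boolP (slot _ _ _ _ _ _)) => //; rewrite /slot hf => /andP[Xl Yl].
  rewrite Xl /= addn0 lt0b; apply: cconn_trans c _.
  rewrite -hf; apply: cconn_edge; rewrite ?hf //.
  by move: e; rewrite /designated; case: pickP => // k /andP[_ /and3P[+ _ _]] [<-].
have s2 : \sum_(S : grid) (Prb mu (cX cm (leaf cd x S)) - q / P0 - eps) <=
    \sum_(S in ok) des_thr cd eps v A P x predT S w +
    \sum_(S : grid) ((S \in ~: ok)%:R + (~~ deshub x predT S w)%:R).
  rewrite [X in _ <= X + _]big_mkcond -big_split /=; apply: ler_sum => S _.
  have p1 := Prb_le1 cmu0 cmu1 (cX cm (leaf cd x S)).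
  rewrite /des_thr /threshold /designated_hub inE; set pr := Prb _ _ in p1 *; set a := q / P0 in q0 *.
  move: eps_gt0; case: (S \in ok); case: (des x predT S w) => [i|] /=; lra.
have c1 : \sum_(S : grid) (Prb mu (cX cm (leaf cd x S)) - q / P0 - eps) =
   \sum_(S : grid) Prb mu (cX cm (leaf cd x S)) - (q / P0 + eps) * m.
  rewrite /m -(card_grid R M r') mulr_natr -sumr_const -sumrB.
  by apply: eq_bigr => S _; rewrite opprD addrA.
have c2 : \sum_(S : grid) P0 <= \sum_(S : grid) Prb mu (cX cm (leaf cd x S)).
  by apply: ler_sum => S _; exact: cX_prb.
rewrite sumr_const -mulr_natr card_grid -/m in c2.
have hok : \sum_(S : grid) (S \in ~: ok)%:R <= nu * m.
  apply: le_trans nu_le; rewrite -(card_natr_sum R (fun S => S \in ~: ok)) ler_nat.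
  by apply: subset_leq_card; apply/subsetP => S; rewrite inE.
rewrite big_split /= in s1; rewrite c1 [X in _ <= _ + X]big_split /= in s2.
rewrite /majority !card_natr_sum; rewrite !card_natr_sum in hdes hnear hact.
have m0 : 0 <= m by rewrite exprn_ge0.
have kapm := ler_wpM2r m0 kap_le.
rewrite !mulrBl !mulrDl in kapm.
set SX := \sum_(S : grid) Prb _ _ in s2 c2 hact.
move: s1 s2 c2 hact hatt hdes hnear hok kapm.
set a := q / P0; lra.
Qed.

End Majority.

Lemma card_coord M r' (i : 'I_r'.+1) (B : {set 'I_M}) :
  (#|[set S : {ffun 'I_r'.+1 -> 'I_M} | S i \in B]| <= #|B| * M ^ r')%N.
Proof.
pose g (S : {ffun 'I_r'.+1 -> 'I_M}) := (S i, drop_at i S).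
have gI : injective g.
  move=> S S' [e1 e2]; rewrite -(ext_line S i) -(ext_line S' i) e1.
  by rewrite /line_of e2.
rewrite -(card_imset _ gI).
apply: leq_trans (_ : #|setX B [set: {ffun 'I_r' -> 'I_M}]| <= _)%N; last first.
  by rewrite cardsX cardsT card_ffun !card_ord.
apply: subset_leq_card; apply/subsetP => p /imsetP[S + ->].
by rewrite !inE andbT.
Qed.

(** * A common majority component at the two ends of an edge *)

Section Agreement.
Variables (R : realType) (P0 q : R) (N M r' : nat) (cm : coarse_model P0 q N).
Local Notation r := r'.+1.
Variable cd : 'I_r -> 'I_M -> 'I_N.
Hypothesis cd_inj : forall i a j b, cd i a = cd j b -> i = j /\ a = b.
Local Notation V := {ffun 'I_N -> bool}.
Local Notation grid := {ffun 'I_r -> 'I_M}.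
Local Notation mu := (cmu cm).
Variables (eps v eta kap epsc u0 beta : R) (P : 'I_r -> {set 'I_M}) (T : nat).
Hypothesis q_ge0 : 0 <= q.
Hypothesis P0_gt0 : 0 < P0.
Hypothesis eps_gt0 : 0 < eps.
Hypothesis M_gt0 : (0 < M)%N.
Variables (z : V) (f : 'I_N).
Local Notation A := (fun i => [set a | cd i a != f]).
Local Notation des := (designated cm cd eps v A P).
Local Notation deshub := (designated_hub cm cd eps v A P).
Local Notation bad := (bad cm cd eps v A P).
Let m : R := M%:R ^+ r.

(** Leaves served at a move along [g] avoid the pins, so that labels and attachments use different
    leaves, and avoid [g], so that the two bases stay apart. *)
Definition free (g : 'I_N) i : {set 'I_M} := [set a in A i | (a \notin P i) && (cd i a != g)].
Local Notation ok := (on_grid (free f)).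
Definition regular_at x (J : pred 'I_r) : {set grid} :=
  [set S | [forall i, J i ==> ~~ bad x i S]].

Definition ev_att x (w : cO cm) : bool :=
  \sum_(S in ok) (attached cd eps v A P x predT S w)%:R + eta * m
   <= \sum_(S in ok) des_thr cd eps v A P x predT S w.
Definition ev_act x (w : cO cm) : bool :=
  eta * m + \sum_(S : grid) Prb mu (cX cm (leaf cd x S)) <= \sum_(S : grid) (cX cm (leaf cd x S) w)%:R.
Definition ev_und x (J : pred 'I_r) (w : cO cm) : bool :=
  u0 * m <= #|[set S in ok | (S \in regular_at x J) && ~~ des x J S w]|%:R.
Definition ev_cr g (J : pred 'I_r) (w : cO cm) : bool :=
  2 * (epsc * m) <=
  #|crossed cd eps v A P z g (fun b : bool => if b then J else predT) (free g) w|%:R.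

Hypothesis PT : forall i, (#|P i| <= T)%N.
Hypothesis bad0 : forall i, #|[set S | bad z i S]|%:R <= beta * m.
Hypothesis bad1 : forall i, #|[set S | bad (flip z f) i S]|%:R <= beta * m.
Hypothesis bad2 : forall i, \sum_(jT : 'I_r * grid)
   #|[set S | bad (flip z (cd jT.1 (jT.2 jT.1))) i S]|%:R <= r%:R * beta * m ^+ 2.

(** Proportions of exceptional leaves: [nu] outside [ok], [mu0] undesignated at [z] or [flip z f],
    [mu1] undesignated at a moved base on average, [c] crossed, [tau] not near the common hub. *)
Let nu : R := r%:R * T.+1%:R / M%:R.
Let mu0 : R := nu + r%:R * beta + u0.
Let mu1 : R := u0 + r%:R * (r%:R * beta).
Let c : R := 2 * epsc.
Let tau : R := r%:R * (2 * nu + 2 * mu0 + mu1 + 2 * c).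

(** Each block loses at most T pinned slots and, by injectivity of [cd], at most one slot equal to
    [f]; hence [T.+1]. *)
Lemma not_ok_le : #|~: ok|%:R <= nu * m.
Proof.
have M0 : (0 : R) < M%:R by rewrite ltr0n.
have -> : nu * m = (r * (T.+1 * M ^ r'))%:R.
  by rewrite /nu /m !natrM natrX exprS; field; rewrite gt_eqF.
rewrite ler_nat.
apply: leq_trans (_ : #|\bigcup_i [set S : grid | S i \in ~: free f i]| <= _)%N.
  apply: subset_leq_card; apply/subsetP => S; rewrite !inE negb_forall => /existsP[i Si].
  by apply/bigcupP; exists i => //; rewrite inE in_setC.
apply: leq_trans (_ : \sum_(i < r) T.+1 * M ^ r' <= _)%N; last by rewrite sum_nat_const card_ord.
apply: leq_trans (_ : \sum_(i < r) #|[set S : grid | S i \in ~: free f i]| <= _)%N.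
  elim/big_rec2: _ => [|i n B _ h]; first by rewrite cards0.
  by apply: leq_trans (leq_card_setU _ _) _; rewrite leq_add2l.
apply: leq_sum => i _; apply: leq_trans (card_coord _ _) _; rewrite leq_mul2r; apply/orP; right.
have sub : ~: free f i \subset P i :|: [set a | cd i a == f].
  by apply/subsetP => a; rewrite !inE; case: (a \in P i); case: (cd i a == f).
apply: leq_trans (subset_leq_card sub) _; apply: leq_trans (leq_card_setU _ _) _.
rewrite -addn1 leq_add //.
apply/card_le1_eqP => a b; rewrite !inE => /eqP ea /eqP eb.
by have [] := cd_inj (etrans ea (esym eb)).
Qed.

Lemma und_le x J w : ~~ ev_und x J w ->
  #|[set S in ok | ~~ deshub x J S w]|%:R <=
    u0 * m + \sum_i #|[set S | bad x i S]|%:R.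
Proof.
rewrite -ltNge => /ltW h.
apply: (@le_trans _ _ (#|[set S in ok | (S \in regular_at x J) && ~~ des x J S w]|%:R +
   (\sum_i #|[set S | bad x i S]|)%:R)); last by rewrite natr_sum lerD2r.
rewrite -natrD ler_nat.
apply: leq_trans (_ : #|[set S in ok | (S \in regular_at x J) && ~~ des x J S w]
   :|: \bigcup_i [set S | bad x i S]| <= _)%N.
  apply: subset_leq_card; apply/subsetP => S; rewrite in_set => /andP[Sok nd].
  rewrite in_setU; case: (boolP (S \in regular_at x J)) => [Sr|].
    rewrite [S \in [set _ in _ | _]]inE Sok Sr /=; apply/orP; left.
    by move: nd; rewrite /designated_hub; case: (designated _ _ _ _ _ _ _ _ _ _).
  rewrite [_ \in regular_at _ _]inE negb_forall => /existsP[i]; rewrite negb_imply negbK => /andP[_ bi].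
  by apply/orP; right; apply/bigcupP; exists i; rewrite // inE.
apply: leq_trans (leq_card_setU _ _) _; rewrite leq_add2l.
elim/big_rec2: _ => [|i n B _ h']; first by rewrite cards0.
by apply: leq_trans (leq_card_setU _ _) _; rewrite leq_add2l.
Qed.

Lemma undes_le x w : (forall i, #|[set S | bad x i S]|%:R <= beta * m) ->
  ~~ ev_und x predT w -> #|[set S | ~~ deshub x predT S w]|%:R <= mu0 * m.
Proof.
move=> hb hu; have h1 := und_le hu; have h2 := not_ok_le.
have h3 : \sum_i #|[set S | bad x i S]|%:R <= r%:R * beta * m.
  apply: le_trans (ler_sum _ (fun i _ => hb i)) _.
  by rewrite sumr_const card_ord -mulrA mulr_natl.
have h4 : #|[set S | ~~ deshub x predT S w]|%:R <=
   #|~: ok|%:R + #|[set S in ok | ~~ deshub x predT S w]|%:R :> R.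
  rewrite -natrD ler_nat; apply: leq_trans (leq_card_setU _ _).
  apply: subset_leq_card; apply/subsetP => S; rewrite in_setU in_setC !in_set => ->.
  by rewrite andbT orNb.
by rewrite /mu0 !mulrDl; lra.
Qed.

(* Moving the base by [cd j e] and the leaf by [cd j (S j)], or the other way
   round, gives the same hubs in all blocks but [j]. *)
Lemma deshub_swap j e S w :
  deshub (flip z (cd j e)) (predC1 j) S w =
  deshub (flip z (cd j (S j))) (predC1 j) (upd j S e) w.
Proof.
have hub_eq i : i != j -> hubv cd (flip z (cd j e)) (line_of S i) =
    hubv cd (flip z (cd j (S j))) (line_of (upd j S e) i).
  move=> ij; have [l jl _] := unlift_some ij.
  apply/ffunP => k; rewrite !ffunE -!addbA; congr addb.
  (* The flip in block j is split off from the hub: it is the one exchanged with the flip of the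
     base. *)
  have spl (S' : grid) : [exists l0, cd (lift i l0) (drop_at i S' l0) == k] =
      (cd j (S' j) == k) (+) [exists l0, (l0 != l) && (cd (lift i l0) (S' (lift i l0)) == k)].
    case: eqP => [ek|nk] /=.
      have -> : [exists l0, (l0 != l) && (cd (lift i l0) (S' (lift i l0)) == k)] = false.
        apply/existsP => -[l0 /andP[nl /eqP]]; rewrite -ek => /cd_inj[e0 _].
        by move: nl; rewrite -(inj_eq (@lift_inj _ i)) e0 -jl eqxx.
      rewrite /=.
      by apply/existsP; exists l; rewrite ffunE -jl ek eqxx.
    apply/existsP/existsP => -[l0].
      rewrite ffunE => el; exists l0; rewrite el andbT; apply: contraPneq el => ->.
      by rewrite -jl; move/eqP.
    by case/andP => _ el; exists l0; rewrite ffunE.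
  rewrite /line_of /= !spl ffunE eqxx addbCA [k == _]eq_sym [k == cd j _]eq_sym.
  congr (_ (+) (_ (+) _)); apply: eq_existsb => l0.
  case: (l0 =P l) => //= nl; rewrite ffunE (negbTE (_ : lift i l0 != j)) //.
  by rewrite jl (inj_eq (@lift_inj _ i)); apply/eqP.
have ex_eq i : (predC1 j i && viable cm cd eps v A P (hubv cd (flip z (cd j e)) (line_of S i)) i (S i)
      (hub_label cm cd P (hubv cd (flip z (cd j e)) (line_of S i)) i w)) =
    (predC1 j i && viable cm cd eps v A P (hubv cd (flip z (cd j (S j))) (line_of (upd j S e) i)) i (upd j S e i)
      (hub_label cm cd P (hubv cd (flip z (cd j (S j))) (line_of (upd j S e) i)) i w)).
  apply: andb_id2l => ij; have {}ij : i != j by exact: ij.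
  by rewrite -(hub_eq i ij) ffunE (negbTE ij).
rewrite /designated_hub /designated (eq_pick ex_eq); case: pickP => [i /andP[ij _]|_]; last by [].
exact: (congr1 Some (hub_eq i ij)).
Qed.

Lemma ok_upd j S S' : S \in ok -> S' \in ok -> upd j S (S' j) \in ok.
Proof.
rewrite !in_set => /forallP hS /forallP hS'; apply/forallP => i.
by rewrite ffunE; case: eqP => [->|_].
Qed.

Lemma ok_free g S : S \in ok -> (forall i, cd i (S i) != g) -> S \in on_grid (free g).
Proof.
rewrite !in_set => /forallP hS hg; apply/forallP => i.
by move: (hS i); rewrite !inE hg andbT => /andP[-> /andP[-> _]].
Qed.

Lemma ok_unpinned S i : S \in ok -> S i \notin P i.
Proof. by rewrite inE => /forallP/(_ i); rewrite !inE => /and3P[]. Qed.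

Hypothesis epsc_ge0 : 0 <= epsc.
Hypothesis tau_lt1 : tau < 1.

Lemma crossed_le g J w : ~~ ev_cr g J w ->
  #|crossed cd eps v A P z g (fun b : bool => if b then J else predT) (free g) w|%:R <= c * m.
Proof. by rewrite -ltNge /c -mulrA => /ltW. Qed.

(** [mostly_agree] is applied with bases moved by [cd j e]. Linking is assumed for unpinned [e]
    only, since a pin along the moved coordinate would spoil the disjointness of the two sides;
    leaves in [ok] have unpinned coordinates. *)
Lemma mostly_near w :
  ~~ ev_und z predT w ->
  (forall j e, ~~ ev_und (flip z (cd j e)) (predC1 j) w) ->
  (forall j e, e \notin P j -> ~~ ev_cr (cd j e) (predC1 j) w) ->
  exists h, #|[set S | ~~ near cd eps v A P z h w S]|%:R <= tau * m.
Proof.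
move=> hu huj hc; have m0 : 0 < m by rewrite exprn_gt0 // ltr0n.
have := @mostly_agree R V M r (cconn cm w) (fun S => deshub z predT S w)
  (fun j e S => deshub (flip z (cd j e)) (predC1 j) S w) ok
  (fun j e => crossed cd eps v A P z (cd j e) (fun b : bool => if b then predC1 j else predT)
     (free (cd j e)) w)
  (@cconn_sym _ _ _ _ cm w) (@cconn_trans _ _ _ _ cm w) (@cconn_refl _ _ _ _ cm w) ok_upd
  (fun j e S => deshub_swap j e S w) _ nu mu0 mu1 c.
rewrite card_grid -/m; apply=> //.
(* [S] does not use the moved coordinate: outside block j by injectivity of [cd], inside it because
   its j-th coordinate differs from that of [S']. *)
- move=> j S S' h0 h1 Sok S'ok neq; rewrite inE negb_and => /orP[|nc d0 d1].
    case/negP; apply: ok_free => // i.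
    by apply/eqP => /cd_inj[ij e]; move: neq; rewrite -ij e -ij eqxx.
  by move: nc; rewrite d0 d1 negbK.
- by rewrite mulr_ge0.
- exact: not_ok_le.
- exact: undes_le.
- move=> j; apply: (@le_trans _ _ (\sum_(S' : grid) (u0 * m + \sum_i #|[set S | bad (flip z (cd j (S' j))) i S]|%:R))).
    by apply: ler_sum => S' _; apply: und_le.
  rewrite big_split /= exchange_big /= /mu1 mulrDl lerD //.
    rewrite sumr_const -[leLHS]mulr_natr card_grid -/m expr2 mulrA; exact: lexx.
  apply: (@le_trans _ _ (\sum_(i < r) r%:R * beta * m ^+ 2)); last first.
    by rewrite sumr_const card_ord -[leLHS]mulr_natl !mulrA.
  apply: ler_sum => i _; apply: le_trans (bad2 i).
  rewrite -(pair_big predT predT (fun (k : 'I_r) (S' : grid) => #|[set S | bad (flip z (cd k (S' k))) i S]|%:R)) /=.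
  by rewrite (bigD1 j) //= lerDl sumr_ge0 // => k _; apply: sumr_ge0.
- by move=> j S' S'ok; apply: crossed_le; apply: hc; exact: ok_unpinned.
Qed.

Hypothesis nu_le : kap <=
  P0 - 2 * (q / P0) - 2 * eps - 3 * eta - 2 * (nu + mu0 + (tau + c + nu + mu0)).
Hypothesis beta_ge0 : 0 <= beta.
Hypothesis u0_ge0 : 0 <= u0.

(** At [z] the hub comes from [mostly_near]. The same hub works at [flip z f]: a leaf is lost there
    only if it was lost at [z], is crossed, lies outside [ok] or is undesignated. *)
Lemma majority_pair w :
  ~~ ev_und z predT w -> ~~ ev_und (flip z f) predT w ->
  (forall j e, ~~ ev_und (flip z (cd j e)) (predC1 j) w) ->
  (forall j e, e \notin P j -> ~~ ev_cr (cd j e) (predC1 j) w) ->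
  ~~ ev_cr f predT w ->
  ~~ ev_att z w -> ~~ ev_att (flip z f) w -> ~~ ev_act z w -> ~~ ev_act (flip z f) w ->
  exists h, majority cd kap z h w && majority cd kap (flip z f) h w.
Proof.
move=> hu hu' huj hc hcf ha ha' hx hx'; have [h hh] := mostly_near hu huj hc.
have m0 : 0 < m by rewrite exprn_gt0 // ltr0n.
have nu0 : 0 <= nu by rewrite /nu divr_ge0 // mulr_ge0.
have mu00 : 0 <= mu0 by rewrite /mu0; apply: addr_ge0 => //; apply: addr_ge0 => //; exact: mulr_ge0.
have c0 : 0 <= c by rewrite /c mulr_ge0.
have act x : ~~ ev_act x w -> #|[set S : grid | cX cm (leaf cd x S) w]|%:R <
    eta * m + \sum_(S : grid) Prb mu (cX cm (leaf cd x S)).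
  by rewrite -ltNge card_natr_sum.
have hd := undes_le bad0 hu; have hd' := undes_le bad1 hu'.
have att x : ~~ ev_att x w -> \sum_(S in ok) des_thr cd eps v A P x predT S w <
    \sum_(S in ok) (attached cd eps v A P x predT S w)%:R + eta * m.
  by rewrite -ltNge.
exists h; apply/andP; split.
  apply: (majority_at cd_inj q_ge0 P0_gt0 eps_gt0 not_ok_le _ hd hh (att _ ha) (act _ hx)).
  by apply: le_trans nu_le _; lra.
have hh' : #|[set S | ~~ near cd eps v A P (flip z f) h w S]|%:R <= (tau + c + nu + mu0) * m.
  have hcr := crossed_le hcf.
  apply: (@le_trans _ _ (#|[set S | ~~ near cd eps v A P z h w S]|%:R +
    #|crossed cd eps v A P z f (fun b : bool => if b then predT else predT) (free f) w|%:R +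
    #|~: ok|%:R + #|[set S | ~~ deshub (flip z f) predT S w]|%:R)).
    rewrite -!natrD ler_nat.
    apply: leq_trans (leq_add (leq_add (leq_card_setU _ _) (leqnn _)) (leqnn _)).
    apply: leq_trans (leq_add (leq_card_setU _ _) (leqnn _)).
    apply: leq_trans (leq_card_setU _ _).
    apply: subset_leq_card; apply/subsetP => S; rewrite !in_setU in_setC [S \in crossed _ _ _ _ _ _ _ _ _ _]inE.
    rewrite [S \in [set S | ~~ near _ _ _ _ _ z _ _ _]]inE.
    rewrite [S \in [set S | ~~ near _ _ _ _ _ (flip _ _) _ _ _]]inE.
    rewrite [S \in [set S | ~~ designated_hub _ _ _ _ _ _ _ _ _ _]]inE.
    rewrite /near; case: (deshub z predT S w) => [h0|] //=.
    case: (deshub (flip z f) predT S w) => [h1|] //=; last by rewrite orbT.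
    case: (boolP (S \in ok)) => Sok; last by rewrite orbT.
    case: (boolP (cconn cm w h h0)) => //= c1; rewrite !orbF.
    by apply: contraNN => c2; apply: cconn_trans c1 c2.
  have hk := not_ok_le; rewrite 3!mulrDl; lra.
exact: (majority_at cd_inj q_ge0 P0_gt0 eps_gt0 not_ok_le _ hd' hh' (att _ ha') (act _ hx')).
Qed.

End Agreement.

Lemma exp2_le_expR (R : realType) n : 2 ^+ n <= expR n%:R :> R.
Proof.
rewrite -[n%:R]mulr1 expRM_natl; apply: lerXn2r; rewrite ?nnegrE ?expR_ge0 //.
by apply: le_trans (expR_ge1Dx 1); rewrite (_ : 2 = 1 + 1 :> R) //.
Qed.

(** * Failure probabilities at one edge of the coarse cube *)

Section LocalTheorem.
Variables (R : realType) (P0 q : R) (N M r' : nat) (cm : coarse_model P0 q N).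
Local Notation r := r'.+1.
Variable cd : 'I_r -> 'I_M -> 'I_N.
Hypothesis cd_inj : forall i a j b, cd i a = cd j b -> i = j /\ a = b.
Local Notation V := {ffun 'I_N -> bool}.
Local Notation grid := {ffun 'I_r -> 'I_M}.
Local Notation mu := (cmu cm).
Variables (eps v eta kap epsc vv t tp gam : R) (T : nat).
Hypothesis q_ge0 : 0 <= q.
Hypothesis P0_gt0 : 0 < P0.
Hypothesis eps_gt0 : 0 < eps.
Hypothesis v_gt0 : 0 < v.
Hypothesis M_gt0 : (0 < M)%N.
Let theta : R := P0 - q / P0 - eps.
Hypothesis theta_ge0 : 0 <= theta.
Hypothesis gap_ge0 : 0 <= theta ^+ 2 - q.
Hypothesis gap : 3 * eta <= (theta ^+ 2 - q) * epsc.
Hypothesis eta_ge0 : 0 <= eta.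
Hypothesis epsc_ge0 : 0 <= epsc.
Hypothesis vv_gt0 : 0 < vv.
Hypothesis T_large : 1 < T.+1%:R * vv.
Let dl : R := eps * P0 / 2.
Let beta : R := 6 * vv / (eps * P0 * v ^+ 2).
Let u0 : R := r.+1%:R * eta + (1 - dl) ^+ r'.
Let nu : R := r%:R * T.+1%:R / M%:R.
Let mu0 : R := nu + r%:R * beta + u0.
Let mu1 : R := u0 + r%:R * (r%:R * beta).
Let c : R := 2 * epsc.
Let tau : R := r%:R * (2 * nu + 2 * mu0 + mu1 + 2 * c).
Hypothesis tau_lt1 : tau < 1.
Hypothesis kap_le : kap <=
  P0 - 2 * (q / P0) - 2 * eps - 3 * eta - 2 * (nu + mu0 + (tau + c + nu + mu0)).
Hypothesis t_ge0 : 0 <= t.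
Hypothesis tp_ge0 : 0 <= tp.
Hypothesis t_v : t ^+ 2 * expR t * v <= 1.
Hypothesis tp_eta : tp * expR tp <= eta / 2.
Hypothesis t_eta : 3 * r%:R + 1 <= t * eta.
Hypothesis gam_le1 : gam <= 1.
Hypothesis gam_le : gam <= tp * eta / 2.
Hypothesis M_large : 2 * r%:R + 1 <= tp * eta / 2 * M%:R.
Let m : R := M%:R ^+ r.
Let W : R := M%:R ^+ r'.
Let E : R := expR (- (gam * W)).

Let W_ge0 : 0 <= W. Proof. exact: exprn_ge0. Qed.
Let mE : m = M%:R * W. Proof. by rewrite /m exprS. Qed.
Let W_le_m : W <= m.
Proof. by rewrite mE ler_peMl // ler1n. Qed.
Let M_gt0R : (0 : R) < M%:R. Proof. by rewrite ltr0n. Qed.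
Let cmu0 := @cmu_ge0 _ _ _ _ cm.
Let cmu1 := cmu_sum1 cm.

Let P0_le1 : P0 <= 1.
Proof. exact: le_trans (cX_prb cm [ffun=> false]) (Prb_le1 cmu0 cmu1 _). Qed.

Let dl01 : 0 <= dl <= 1.
Proof.
have q0 : 0 <= q / P0 by rewrite divr_ge0 // ltW.
have e1 : eps <= 1.
  by move: theta_ge0 P0_le1; rewrite /theta; set x := q / P0 in q0 *; lra.
have e0 : 0 <= eps * P0 by rewrite mulr_ge0 // ltW.
have : eps * P0 <= 1 by rewrite mulr_ile1 // ltW.
by rewrite /dl => h; apply/andP; split; lra.
Qed.

Lemma tp_rate a : 0 <= a -> a * (tp ^+ 2 * expR tp) - tp * (eta * a) <= - (tp * eta / 2 * a).
Proof.
move=> a0; have : tp * (tp * expR tp) <= tp * (eta / 2) by rewrite ler_wpM2l.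
move/(ler_wpM2l a0); rewrite expr2; lra.
Qed.

Lemma tp_rate_E a : W <= a -> expR (a * (tp ^+ 2 * expR tp) - tp * (eta * a)) <= E.
Proof.
move=> Wa; have a0 := le_trans W_ge0 Wa.
rewrite ler_expR; apply: le_trans (tp_rate a0) _; rewrite lerN2.
apply: le_trans (ler_wpM2r W_ge0 gam_le) _.
by apply: ler_wpM2l => //; rewrite divr_ge0 ?mulr_ge0.
Qed.

(** Of the 3 r + 1 provided by [t_eta], r is spent on the variance term of the r W hubs. The
    remaining 2 r + 1 will absorb the 2^(2 r W) colourings and still leave exp(-W). *)
Lemma t_rate : (r * M ^ r')%:R * (t ^+ 2 * expR t * v) - t * (eta * m) / M%:R
   <= - ((2 * r%:R + 1) * W).
Proof.
have -> : t * (eta * m) / M%:R = t * eta * W by rewrite mE; field; rewrite gt_eqF.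
have h1 : (r * M ^ r')%:R * (t ^+ 2 * expR t * v) <= r%:R * W.
  rewrite natrM natrX -[leRHS]mulr1; apply: ler_wpM2l => //.
  exact: mulr_ge0.
have h2 := ler_wpM2r W_ge0 t_eta; rewrite !mulrDl in h2; lra.
Qed.

Lemma expR_W_le a : W <= a -> expR (- a) <= E.
Proof.
move=> Wa; rewrite ler_expR lerN2; apply: le_trans Wa.
by rewrite -[leRHS]mul1r ler_wpM2r.
Qed.

Section AtEdge.
Variables (z : V) (f : 'I_N) (P : 'I_r -> {set 'I_M}).
Local Notation A := (fun i => [set a | cd i a != f]).
Local Notation free := (free cd P f).

Let freeA g i : free g i \subset A i.
Proof. by apply/subsetP => a; rewrite !inE => /andP[]. Qed.
Let freeP g i : [disjoint free g i & P i].
Proof.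
rewrite -setI_eq0; apply/eqP/setP => a; rewrite !inE.
by case: (a \in P i); rewrite ?andbF.
Qed.

Lemma ev_att_prb x : Prb mu (ev_att cd eps v eta P f x) <= E.
Proof.
have h := attached_count cm cd_inj eps (A := A) v_gt0 M_gt0 x f (fun=> predT) (freeA f) (freeP f)
  (eta * m) t_ge0.
apply: le_trans (le_trans h _); first by rewrite le_eqVlt eqxx.
apply: le_trans (_ : expR (- ((2 * r%:R + 1) * W)) <= _).
  by rewrite ler_expR; exact: t_rate.
apply: expR_W_le; rewrite -[leLHS]mul1r; apply: ler_wpM2r => //.
by rewrite lerDr mulr_ge0.
Qed.

Lemma ev_act_prb x : Prb mu (ev_act cd eta x) <= E.
Proof.
have := @chernoff _ _ mu cmu0 cmu1 _ (cres cm) (@cres_sub _ _ _ _ cm)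
  (@cres_indep _ _ _ _ cm) grid predT (fun S => [set leaf cd x S])
  (fun S => cX cm (leaf cd x S)) (fun S => Prb mu (cX cm (leaf cd x S))) tp (eta * m).
move=> h; apply: le_trans (h _ _ _ _) _ => //.
- move=> S S' _ _ SS'; rewrite disjoints1 inE.
  by apply: contra_neqN SS' => /eqP/(leaf_inj cd_inj).
- by move=> S _; exact: cX_dep.
by rewrite (card_grid R M r') tp_rate_E.
Qed.

(** The r M + 1 classes with slack eta W each cost at most (r + 1) eta m, the first term of [u0].
    The exponent r' of the second is the number of blocks left when one of them is excluded. *)
Lemma ev_und_prb x (J : pred 'I_r) : (r' <= #|J|)%N ->
  Prb mu (ev_und cd eps v u0 P f x J) <= (r * M).+1%:R * E.
Proof.
move=> J_ge; have /andP[d0 d1] := dl01.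
have h := undesignated_count (cm := cm) cd_inj (A := A) (eps := eps) (v := v) (z := x) f (I := fun=> J) (freeP f)
   (good := regular_at cm cd eps v P f x J) (eta * W) dl01 tp_ge0.
apply: le_trans (le_trans (h _) _).
- apply: sub_Prb => [|w /=]; first exact: cmu_ge0.
  apply: le_trans; rewrite /u0 mulrDl; apply: lerD.
    have -> : (r * M).+1%:R * (eta * W) = eta * ((r * M).+1%:R * W) by ring.
    have -> : r.+1%:R * eta * m = eta * (r.+1%:R * M%:R * W) by rewrite mE; ring.
    apply: ler_wpM2l => //; apply: ler_wpM2r => //; rewrite -natrM ler_nat.
    by rewrite mulSn -addn1 addnC leq_add.
  rewrite mulrC; apply: ler_wpM2r; first exact: exprn_ge0.
  by apply: ler_wiXn2l; rewrite ?subr_ge0 // gerBl.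
- move=> S i; rewrite inE => /forallP/(_ i)/implyP hb /hb; rewrite /bad -leNgt.
  exact: viable_prb.
apply: ler_wpM2l => //; rewrite natrX; exact: tp_rate_E.
Qed.

Lemma ev_cr_prb g (J : pred 'I_r) : (forall i a, a \in P i -> cd i a != g) ->
  Prb mu (ev_cr cd eps v epsc P z f g J) <= 3 * E.
Proof.
move=> Pg.
have gu i a : a \in free g i :|: P i -> cd i a != g.
  by rewrite !inE => /orP[/and3P[]|/Pg].
have h := crossed_prb (cm := cm) cd_inj (A := A) v_gt0 M_gt0 z (fun b : bool => if b then J else predT)
   (freeA g) (freeP g) gu theta_ge0 (thr_ge cm eps) gap gap_ge0 t_ge0 tp_ge0.
apply: le_trans (le_trans h _); first by rewrite le_eqVlt eqxx.
rewrite -/m; set y := expR (m * _ - _); set y' := expR (_ * (_ * v) - _).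
have -> : 3 * E = E + 2 * E by ring.
have p0 : 0 <= 2 ^+ (2 * (r * M ^ r')) :> R by rewrite exprn_ge0.
have pE : 2 ^+ (2 * (r * M ^ r')) <= expR (2 * r%:R * W) :> R.
  by apply: le_trans (exp2_le_expR _ _) _; rewrite !natrM natrX mulrA.
rewrite mulrDr mulrCA; apply: lerD; last (apply: ler_wpM2l => //).
  apply: le_trans (ler_wpM2r (expR_ge0 _) pE) _.
  rewrite -expRD; apply: (@le_trans _ _ (expR (- W))); last exact: expR_W_le.
  (* The Chernoff exponent is of order m = M W, so a large M alone lets it absorb the colourings. *)
  rewrite ler_expR; have := tp_rate (le_trans W_ge0 W_le_m).
  have := ler_wpM2r W_ge0 M_large; rewrite mE !mulrDl; lra.
apply: le_trans (ler_wpM2r (expR_ge0 _) pE) _.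
rewrite -expRD; apply: (@le_trans _ _ (expR (- W))); last exact: expR_W_le.
rewrite ler_expR; have := t_rate; rewrite !mulrDl; lra.
Qed.

End AtEdge.

Lemma Prb_or_le (F G : pred (cO cm)) x y :
  Prb mu F <= x -> Prb mu G <= y -> Prb mu (fun w => F w || G w) <= x + y.
Proof. by move=> hF hG; apply: le_trans (Prb_or cmu0 F G) _; exact: lerD. Qed.

Lemma Prb_has_le (I : finType) (Q : pred I) (F : I -> pred (cO cm)) x : 0 <= x ->
  (forall i, Q i -> Prb mu (F i) <= x) ->
  Prb mu (fun w => [exists i, Q i && F i w]) <= #|I|%:R * x.
Proof.
move=> x0 hF; apply: le_trans (Prb_has cmu0 Q F) _; apply: le_trans (ler_sum _ hF) _.
rewrite sumr_const -[leLHS]mulr_natl; apply: ler_wpM2r => //.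
by rewrite ler_nat max_card.
Qed.

Lemma local_majority (z : V) (f : 'I_N) :
  Prb mu (fun w => ~~ [exists h, majority cd kap z h w && majority cd kap (flip z f) h w]) <=
  ((r * M)%:R + 4) ^+ 2 * E.
Proof.
pose A i := [set a | cd i a != f].
have [P hP] := good_pins cm cd v_gt0 M_gt0 P0_gt0 eps_gt0 z f A vv_gt0 T_large.
have PA i : P i \subset A i by case: (hP i).
pose und x J : pred (cO cm) := ev_und cd eps v u0 P f x J.
pose crs g J : pred (cO cm) := ev_cr cd eps v epsc P z f g J.
have E0 : 0 <= E by exact: expR_ge0.
have r_le : (r' <= #|@predT 'I_r|)%N by rewrite card_ord.
have J_le j : (r' <= #|predC1 j : pred 'I_r|)%N by rewrite cardC1 card_ord.
have cardIM : #|{: 'I_r * 'I_M}|%:R = (r * M)%:R :> R by rewrite card_prod !card_ord.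
have h1 := Prb_or_le (ev_und_prb f P z r_le) (ev_und_prb f P (flip z f) r_le).
have h2 : Prb mu (fun w => [exists p : 'I_r * 'I_M, true && und (flip z (cd p.1 p.2)) (predC1 p.1) w])
    <= (r * M)%:R * ((r * M).+1%:R * E).
  rewrite -cardIM; apply: Prb_has_le => [|p _]; first by rewrite mulr_ge0.
  exact: ev_und_prb.
have h3 : Prb mu (fun w => [exists p : 'I_r * 'I_M, (p.2 \notin P p.1) && crs (cd p.1 p.2) (predC1 p.1) w])
    <= (r * M)%:R * (3 * E).
  rewrite -cardIM; apply: Prb_has_le => [|p pP]; first by rewrite mulr_ge0.
  apply: ev_cr_prb => // i a aP; apply/eqP => /cd_inj[ei ea].
  by move: pP; rewrite -ei -ea aP.
have h4 : Prb mu (crs f predT) <= 3 * E.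
  by apply: ev_cr_prb => // i a /(subsetP (PA i)); rewrite inE.
have h5 := Prb_or_le (ev_att_prb f P z) (ev_att_prb f P (flip z f)).
have h6 := Prb_or_le (ev_act_prb z) (ev_act_prb (flip z f)).
have := Prb_or_le (Prb_or_le (Prb_or_le h1 h2) (Prb_or_le h3 h4)) (Prb_or_le h5 h6).
move=> h; apply: le_trans (le_trans h _); last first.
  (* With x = r M, the failures total 2(x + 1) + x(x + 1) + 3x + 3 + 2 + 2 = x^2 + 6x + 9 times
     [E]. *)
  by rewrite -natr1; set x := (r * M)%:R; rewrite expr2; have : 0 <= x by []; nra.
apply: sub_Prb => [|w]; first exact: cmu_ge0.
apply: contraNT; rewrite !negb_or => /andP[/andP[/andP[/andP[n1 n2] n3] /andP[n4 n5]]].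
move=> /andP[/andP[n6 n7] /andP[n8 n9]].
have hT i : (#|P i| <= T)%N by case: (hP i).
have hb0 i : #|[set S | bad cm cd eps v A P z i S]|%:R <= beta * m by case: (hP i).
have hb1 i : #|[set S | bad cm cd eps v A P (flip z f) i S]|%:R <= beta * m by case: (hP i).
have hb2 i : \sum_(jT : 'I_r * grid)
    #|[set S | bad cm cd eps v A P (flip z (cd jT.1 (jT.2 jT.1))) i S]|%:R
    <= r%:R * beta * m ^+ 2 by case: (hP i).
have beta0 : 0 <= beta.
  by rewrite /beta !mulr_ge0 ?invr_ge0 ?mulr_ge0 ?exprn_ge0 // ltW.
have u00 : 0 <= u0.
  have /andP[_ d1] := dl01.
  by rewrite /u0 addr_ge0 ?mulr_ge0 ?exprn_ge0 ?subr_ge0.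
have nu3 j e : ~~ und (flip z (cd j e)) (predC1 j) w.
  by apply: contraNN n3 => h'; apply/existsP; exists (j, e).
have nc4 j e : e \notin P j -> ~~ crs (cd j e) (predC1 j) w.
  by move=> eP; apply: contraNN n4 => h'; apply/existsP; exists (j, e); rewrite eP.
apply/existsP; exact: (majority_pair cd_inj q_ge0 P0_gt0 eps_gt0 M_gt0 hT hb0 hb1 hb2
  epsc_ge0 tau_lt1 kap_le beta0 u00 n1 n2 nu3 nc4 n5 n6 n7 n8 n9).
Qed.

End LocalTheorem.

(** * From majorities to a giant component *)

Lemma flip_ind N (Q : {ffun 'I_N -> bool} -> Prop) x :
  Q x -> (forall y c, Q y -> Q (flip y c)) -> forall y, Q y.
Proof.
move=> Qx step y.
suff all (s : seq 'I_N) : uniq s -> Q [ffun c => if c \in s then y c else x c].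
  have := all (enum 'I_N) (enum_uniq _).
  rewrite (_ : finfun _ = y) //; apply/ffunP => c.
  by rewrite ffunE mem_enum.
elim: s => [_|c s IH /= /andP[cs us]].
  by rewrite (_ : finfun _ = x) //; apply/ffunP => c; rewrite ffunE.
have {}IH := IH us; set x1 := finfun _ in IH.
have [e|ne] := eqVneq (x c) (y c).
  rewrite (_ : finfun _ = x1) //; apply/ffunP => d; rewrite !ffunE inE.
  by case: eqP => //= ->; rewrite (negbTE cs).
rewrite (_ : finfun _ = flip x1 c); first exact: step.
apply/ffunP => d; rewrite !ffunE inE.
case: eqP => /= [->|_]; last by rewrite addbF.
by rewrite (negbTE cs) addbT; move: ne; case: (x c); case: (y c).
Qed.

Section Giant.
Variables (R : realType) (P0 q : R) (N M r' : nat) (cm : coarse_model P0 q N).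
Local Notation r := r'.+1.
Variable cd : 'I_r -> 'I_M -> 'I_N.
Local Notation V := {ffun 'I_N -> bool}.
Local Notation grid := {ffun 'I_r -> 'I_M}.
Variables (kap : R) (w : cO cm).
Hypothesis kap_ge0 : 0 <= kap.
Hypothesis M_gt0 : (0 < M)%N.

(** Two sets that each contain more than half of the active leaves have a leaf in common. *)
Lemma maj_unique z h h' : majority cd kap z h w -> majority cd kap z h' w -> cconn cm w h h'.
Proof.
rewrite /majority; set X := [set S | _]; set Y := [set S | _]; set Y' := [set S : grid | _ && cconn cm w h' _].
move=> h1 h2; have k0 : 0 <= kap * M%:R ^+ r by rewrite mulr_ge0 // exprn_ge0.
have : (#|Y :|: Y'| <= #|X|)%N.
  by apply: subset_leq_card; apply/subsetP => S; rewrite !inE => /orP[/andP[]|/andP[]].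
rewrite cardsU => hU; have hI : (#|Y :&: Y'| <= #|Y|)%N by exact/subset_leq_card/subsetIl.
have : (#|X| < #|Y| + #|Y'|)%N.
  rewrite -(ltr_nat R) natrD; lra.
move=> hX; have /card_gt0P[S] : (0 < #|Y :&: Y'|)%N by lia.
rewrite !inE => /andP[/andP[_ c1] /andP[_ c2]].
by apply: cconn_trans c1 _; rewrite cconn_sym.
Qed.

Lemma leaf_base_inj S : injective (fun x : V => leaf cd x S).
Proof.
move=> x y /ffunP e; apply/ffunP => c; have := e c.
by rewrite !ffunE => /addIb.
Qed.

(** By uniqueness the majority component is carried along every flip, so it is the same at all
    bases. Double counting pairs of base and leaf gives its size: for a fixed grid point, moving the
    base runs through every vertex once. *)
Lemma giant_of_majorities :
  (forall z f, exists h, majority cd kap z h w && majority cd kap (flip z f) h w) -> (0 < N)%N ->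
  exists h, kap / 2 * 2 ^+ N <= #|[set u | cconn cm w h u]|%:R.
Proof.
move=> hz N0; pose z0 : V := [ffun=> false].
have [h0 /andP[m0 _]] := hz z0 (Ordinal N0); exists h0.
have all z : exists h, majority cd kap z h w && cconn cm w h0 h.
  apply: (flip_ind (x := z0) (Q := fun z => exists h, majority cd kap z h w && cconn cm w h0 h)).
    by exists h0; rewrite m0 cconn_refl.
  move=> y f [h /andP[my ch]]; have [h1 /andP[my1 mf1]] := hz y f.
  by exists h1; rewrite mf1 (cconn_trans ch) // (maj_unique my).
have mp : (0 : R) < M%:R ^+ r by rewrite exprn_gt0 // ltr0n.
have lower z : kap / 2 * M%:R ^+ r <= \sum_(S : grid) (cconn cm w h0 (leaf cd z S))%:R.
  have [h /andP[+ ch]] := all z; rewrite /majority; set X := #|_|%:R; set Y := #|_|%:R => hm.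
  have X0 : 0 <= X by [].
  apply: (@le_trans _ _ Y); first lra.
  rewrite /Y card_natr_sum; apply: ler_sum => S _; rewrite ler_nat.
  by case: (cX _ _ _) => //=; case: (boolP (cconn _ _ h _)) => // c; rewrite (cconn_trans ch c).
rewrite -(ler_pM2r mp) card_natr_sum.
have -> : kap / 2 * 2 ^+ N * M%:R ^+ r = \sum_(z : V) (kap / 2 * M%:R ^+ r).
  by rewrite sumr_const card_ffun card_bool card_ord -[RHS]mulr_natl natrX; ring.
apply: le_trans (ler_sum _ (fun z _ => lower z)) _.
rewrite exchange_big /= (eq_bigr (fun=> \sum_(u : V) (cconn cm w h0 u)%:R)); last first.
  by move=> S _; rewrite [RHS](reindex_inj (@leaf_base_inj S)).
by rewrite sumr_const -[leLHS]mulr_natr card_grid.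
Qed.

End Giant.

(** (1 - dl)^n <= exp(-dl n) <= 2/(dl n)^2 and n + 1 <= 2 n, so the product is at most 4/(dl^2
    n). *)
Lemma linear_decay (R : realType) (dl delta : R) : 0 < dl <= 1 -> 0 < delta ->
  exists n, (3 <= n)%N /\ n.+1%:R * (1 - dl) ^+ n <= delta.
Proof.
move=> /andP[dl0 dl1] d0; have dd : 0 < dl ^+ 2 * delta by rewrite mulr_gt0 ?exprn_gt0.
pose n := (Num.bound (4 / (dl ^+ 2 * delta)) + 3)%N; exists n; split; first exact: leq_addl.
have hn : 4 / (dl ^+ 2 * delta) <= n%:R.
  have := archi_boundP (divr_ge0 (ler0n R 4) (ltW dd)) => /ltW/le_trans; apply.
  by rewrite ler_nat leq_addr.
rewrite ler_pdivrMr // in hn.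
have n0 : 1 <= n%:R :> R by rewrite ler1n /n addnC.
have h1 : (1 - dl) ^+ n <= expR (- (dl * n%:R)).
  rewrite -mulNr expRM_natr; apply: lerXn2r; rewrite ?nnegrE ?expR_ge0 ?subr_ge0 //.
  exact: expR_ge1Dx.
have h2 : (dl * n%:R) ^+ 2 / 2 <= expR (dl * n%:R).
  have dn : 0 <= dl * n%:R by rewrite mulr_ge0 // ltW.
  have := expR_ge1Dxn 1 dn; rewrite (_ : (2)`!%:R = 2 :> R) //.
  lra.
apply: le_trans (ler_wpM2l (ler0n _ _) h1) _.
rewrite expRN ler_pdivrMr ?expR_gt0 //.
apply: le_trans (ler_wpM2l (ltW d0) h2).
rewrite -natr1; move: hn n0; set x := n%:R => hn n0.
have : (x + 1) <= 2 * x by lra.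
have := ler_wpM2r (le_trans ler01 n0) hn.
rewrite exprMn !expr2; set d := dl; nra.
Qed.

(** The prefactors are at most exp(4 N + 8), and N <= 2 r M. As r' >= 3, the exponent is at least
    gam M times M^2, and the three terms of the bound on gam M pay for N^2, 4 N and 8 in turn. *)
Lemma union_bound (R : realType) (gam : R) (r M N r' : nat) : (3 <= r')%N ->
  (r * M <= N)%N -> (N <= 2 * r * M)%N -> (0 < M)%N ->
  4 * r%:R ^+ 2 + 8 * r%:R + 8 <= gam * M%:R ->
  (2 ^+ N * N%:R) * (((r * M)%:R + 4) ^+ 2 * expR (- (gam * M%:R ^+ r'))) <= expR (- N%:R ^+ 2) :> R.
Proof.
move=> r3 rMN N2 M0 hM.
have le_exp n : n%:R <= expR n%:R :> R.
  by apply: le_trans (expR_ge1Dx _); rewrite lerDr.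
have x1 : (1 : R) <= M%:R by rewrite ler1n.
have hW : M%:R ^+ 3 <= M%:R ^+ r' :> R by rewrite ler_weXn2l.
have e1 : ((r * M)%:R + 4) ^+ 2 <= expR (2 * (N%:R + 4)) :> R.
  rewrite -[2 * _]/(2%:R * _) expRM_natl; apply: lerXn2r; rewrite ?nnegrE ?expR_ge0 ?addr_ge0 //.
  rewrite -(natrD _ _ 4). by apply: le_trans (le_exp _) _; rewrite ler_expR -natrD ler_nat leq_add2r.
have e2 : 2 ^+ N * N%:R <= expR (N%:R + N%:R) :> R.
  by rewrite expRD ler_pM // ?exprn_ge0 // exp2_le_expR.
have g0 : 0 < gam * M%:R by apply: lt_le_trans hM; rewrite -!natrM -natrX -natrM -!natrD ltr0n addnS.
have e3 : expR (- (gam * M%:R ^+ r')) <= expR (- (gam * M%:R * M%:R ^+ 2)) :> R.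
  rewrite ler_expR lerN2 -mulrA -exprS; apply: ler_wpM2l => //.
  by have := g0; rewrite pmulr_lgt0 ?ltr0n // => /ltW.
apply: le_trans (ler_pM _ _ e2 (ler_pM _ _ e1 e3)) _;
  rewrite ?mulr_ge0 ?exprn_ge0 ?addr_ge0 ?expR_ge0 //.
rewrite -!expRD ler_expR.
have hN : N%:R <= 2 * r%:R * M%:R :> R by rewrite -[2 * _]natrM -natrM ler_nat.
have hMM := ler_wpM2r (sqr_ge0 (M%:R : R)) hM.
have N0 : 0 <= N%:R :> R by [].
have r0 : 0 <= r%:R :> R by [].
have hN2 : N%:R ^+ 2 <= (2 * r%:R * M%:R) ^+ 2 :> R by rewrite lerXn2r ?nnegrE ?mulr_ge0.
have h1 : r%:R * M%:R <= r%:R * M%:R ^+ 2 :> R by rewrite ler_wpM2l // ler_eXnr.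
have h2 : 1 <= M%:R ^+ 2 :> R by rewrite exprn_ege1.
move: hMM hN hN2 h1 h2; set g := gam * _; set b := M%:R; set d := r%:R; set n := N%:R.
lra.
Qed.

Lemma block_coords (N M r : nat) : (r * M <= N)%N ->
  exists cd : 'I_r -> 'I_M -> 'I_N, forall i a j b, cd i a = cd j b -> i = j /\ a = b.
Proof.
move=> rMN; have lt (i : 'I_r) (a : 'I_M) : (i * M + a < N)%N.
  have := ltn_ord i; have := ltn_ord a; nia.
exists (fun i a => Ordinal (lt i a)) => i a j b /(congr1 val) /= e.
have M0 : (0 < M)%N by exact: leq_ltn_trans (ltn_ord a).
have ij : i = j :> nat.
  by have := congr1 (divn^~ M) e; rewrite !divnMDl // !divn_small ?addn0.
split; first exact: val_inj.
by apply: val_inj; move/eqP: e; rewrite ij eqn_add2l => /eqP.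
Qed.

Lemma leq_summands (a b c n : nat) : (1 + a + b + c <= n)%N -> [/\ (a <= n)%N, (b <= n)%N & (c <= n)%N].
Proof. by move=> h; split; lia. Qed.

(** * Choice of the constants *)

Lemma coarse_giant (R : realType) (P0 q : R) :
  0 < P0 -> P0 <= 1 -> 0 <= q -> q < (P0 - q / P0) ^+ 2 -> 0 < P0 - 2 * (q / P0) ->
  exists kap : R, 0 < kap /\ exists N0, forall N, (N0 <= N)%N -> forall cm : coarse_model P0 q N,
    Prb (cmu cm) (fun w => ~~ [exists h, kap * 2 ^+ N <= #|[set u | cconn cm w h u]|%:R])
      <= expR (- N%:R ^+ 2).
Proof.
move=> P0_gt0 P0_le1 q_ge0; set s := P0 - q / P0; set d2 := P0 - _ => hs d2_gt0.
have qP : 0 <= q / P0 by rewrite divr_ge0 // ltW.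
have s_gt0 : 0 < s by move: d2_gt0; rewrite /d2 /s; set a := q / P0 in qP *; lra.
have s_le1 : s <= 1 by rewrite /s; set a := q / P0 in qP *; lra.
have d2_le1 : d2 <= 1 by rewrite /d2; set a := q / P0 in qP *; lra.
pose d1 := s ^+ 2 - q; have d1_gt0 : 0 < d1 by rewrite subr_gt0.
(* Replacing s <= 1 by s - eps costs at most 2 eps in the square, hence at most half of d1; the 2
   eps lost in the majority is at most half of d2. *)
have [eps [eps_gt0 eps_s eps_d1 eps_d2]] : exists eps, [/\ 0 < eps, eps <= s, eps <= d1 / 4 & eps <= d2 / 4].
  exists (Num.min s (Num.min (d1 / 4) (d2 / 4))); split; rewrite ?lt_min ?ge_min ?lexx ?orbT //.
  by rewrite s_gt0 !divr_gt0.
pose theta := s - eps.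
have theta_ge0 : 0 <= theta by rewrite subr_ge0.
have gap2 : d1 / 2 <= theta ^+ 2 - q.
  have aux (a b c : R) : a * b <= b -> b <= (a ^+ 2 - c) / 4 -> (a ^+ 2 - c) / 2 <= (a - b) ^+ 2 - c.
    by move=> h1 h2; have := sqr_ge0 b; rewrite !expr2 in h2 *; lra.
  by apply: aux => //; rewrite ler_piMl // ltW.
have gap_ge0 : 0 <= theta ^+ 2 - q by apply: le_trans gap2; rewrite divr_ge0 // ltW.
pose dl := eps * P0 / 2.
have dl01 : 0 < dl <= 1.
  have : eps * P0 <= 1 by apply: mulr_ile1 => //; [exact: ltW|exact: ltW|exact: le_trans eps_s s_le1].
  have : 0 < eps * P0 by rewrite mulr_gt0.
  by rewrite /dl => h1 h2; apply/andP; split; lra.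
(* Each elementary error will be at most delta. They add up to 17 delta in [tau] and to 61 delta in
   [kap_le], which after 2 eps <= d2/2 leaves more than d2/8. *)
pose delta := d2 / 200; have delta_gt0 : 0 < delta by rewrite divr_gt0.
have [r' [r'3 hr']] := linear_decay dl01 delta_gt0.
pose r := r'.+1; have r_gt0 : (0 : R) < r%:R by rewrite ltr0n.
have r1_gt0 : (0 : R) < r.+1%:R by rewrite ltr0n.
have r_ge1 : (1 : R) <= r%:R by rewrite ler1n.
pose epsc := delta / r%:R; have epsc_gt0 : 0 < epsc by rewrite divr_gt0.
have [eta [eta_gt0 eta_d eta_g]] : exists eta, [/\ 0 < eta, eta <= delta / (r%:R * r.+1%:R) &
    eta <= d1 / 2 * epsc / 3].
  exists (Num.min (delta / (r%:R * r.+1%:R)) (d1 / 2 * epsc / 3)); split; rewrite ?lt_min ?ge_min ?lexx ?orbT //.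
  by apply/andP; split; apply: divr_gt0 => //; apply: mulr_gt0 => //; exact: divr_gt0.
have gap : 3 * eta <= (theta ^+ 2 - q) * epsc.
  apply: le_trans (ler_wpM2r (ltW epsc_gt0) gap2); lra.
pose t := (3 * r%:R + 1) / eta.
have t_gt0 : 0 < t by rewrite divr_gt0 // addr_gt0 ?mulr_gt0.
have te_gt0 : 0 < t ^+ 2 * expR t by rewrite mulr_gt0 ?exprn_gt0 ?expR_gt0.
(* The variance must be small relative to the tilt [t], which [eta] dictates; the number of pins
   follows from [v] and is thus independent of N. *)
pose v := (t ^+ 2 * expR t)^-1; have v_gt0 : 0 < v by rewrite invr_gt0.
(* Chosen so that [beta] is delta/r^3: in [tau] it is multiplied by r three times, for the blocks,
   the moved bases and the coordinate changes. *)
pose vv := delta * (eps * P0 * v ^+ 2) / (6 * r%:R ^+ 3).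
have epv : 0 < eps * P0 * v ^+ 2 by rewrite !mulr_gt0 ?exprn_gt0.
have vv_gt0 : 0 < vv.
  by apply: divr_gt0; apply: mulr_gt0 => //; exact: exprn_gt0.
pose T := Num.bound vv^-1.
have T_large : 1 < T.+1%:R * vv.
  rewrite -ltr_pdivrMr // div1r; apply: lt_le_trans (archi_boundP _) _.
    by rewrite invr_ge0 ltW.
  by rewrite ler_nat leqnSn.
pose beta := 6 * vv / (eps * P0 * v ^+ 2).
have betaE : r%:R ^+ 3 * beta = delta.
  by rewrite /beta /vv; field; rewrite !gt_eqF.
have beta_ge0 : 0 <= beta.
  by apply: divr_ge0; [apply: mulr_ge0 => //; exact: ltW | exact: ltW].
have e1_gt0 : (0 : R) < expR 1 by exact: expR_gt0.
have [tp [tp_gt0 tp_1 tp_e]] : exists tp : R, [/\ 0 < tp, tp <= 1 & tp <= eta / (2 * expR 1)].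
  exists (Num.min 1 (eta / (2 * expR 1))); split; rewrite ?lt_min ?ge_min ?lexx ?orbT //.
  by rewrite ltr01; apply: divr_gt0 => //; exact: mulr_gt0.
have tp_eta : tp * expR tp <= eta / 2.
  apply: (@le_trans _ _ (tp * expR 1)); first by rewrite ler_pM2l // ler_expR.
  have := ler_wpM2r (ltW e1_gt0) tp_e.
  by rewrite (_ : eta / (2 * expR 1) * expR 1 = eta / 2) //; field; rewrite gt_eqF.
pose lam := tp * eta / 2; have lam_gt0 : 0 < lam.
  by apply: divr_gt0 => //; exact: mulr_gt0.
have [gam [gam_gt0 gam_le1 gam_le]] : exists gam : R, [/\ 0 < gam, gam <= 1 & gam <= lam].
  exists (Num.min 1 lam); split; rewrite ?lt_min ?ge_min ?lexx ?orbT //.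
  by rewrite ltr01.
(* The three bounds on M are for [M_large], for r [nu] <= delta and for [union_bound]. *)
pose M0 := (1 + Num.bound ((2 * r%:R + 1) / lam) + Num.bound (r%:R ^+ 2 * T.+1%:R / delta)
   + Num.bound ((4 * r%:R ^+ 2 + 8 * r%:R + 8) / gam))%N.
have bnd (x y : R) (M : nat) : 0 <= x -> 0 < y -> (Num.bound (x / y) <= M)%N -> x <= y * M%:R.
  move=> x0 y0 hb; rewrite mulrC -ler_pdivrMr //.
  have := archi_boundP (divr_ge0 x0 (ltW y0)) => /ltW/le_trans; apply.
  by rewrite ler_nat.
pose kap := d2 / 8; exists (kap / 2); split.
  by apply: divr_gt0 => //; exact: divr_gt0.
exists (r * M0)%N => N hN cm.
pose M := (N %/ r)%N.
have M_ge : (M0 <= M)%N by rewrite leq_divRL // mulnC.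
have M_gt0 : (0 < M)%N by apply: leq_trans M_ge; rewrite /M0 -!addnA.
have rMN : (r * M <= N)%N by rewrite mulnC leq_divM.
have N2 : (N <= 2 * r * M)%N.
  apply: leq_trans (ltnW (ltn_ceil N (isT : (0 < r)%N))) _.
  by rewrite -/M [leqRHS]mulnAC leq_mul2r mul2n -addnn -addn1 leq_add2l M_gt0 orbT.
have := M_ge; rewrite /M0 => /leq_summands[Ma Mb Mc].
have N_gt0 : (0 < N)%N by apply: leq_trans rMN; rewrite muln_gt0.
have [cd cd_inj] := block_coords rMN.
have hM1 : 2 * r%:R + 1 <= lam * M%:R.
  by apply: bnd => //; rewrite addr_ge0 ?mulr_ge0 // ltW.
have hM2 : r%:R ^+ 2 * T.+1%:R <= delta * M%:R.
  by apply: bnd => //; rewrite mulr_ge0 ?exprn_ge0 // ltW.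
have hM3 : 4 * r%:R ^+ 2 + 8 * r%:R + 8 <= gam * M%:R.
  by apply: bnd => //; rewrite !addr_ge0 ?mulr_ge0 ?exprn_ge0 // ltW.
pose nu : R := r%:R * T.+1%:R / M%:R.
pose x := (1 - dl) ^+ r'.
pose u0 : R := r.+1%:R * eta + x.
pose mu0 : R := nu + r%:R * beta + u0.
pose mu1 : R := u0 + r%:R * (r%:R * beta).
pose c : R := 2 * epsc.
pose tau : R := r%:R * (2 * nu + 2 * mu0 + mu1 + 2 * c).
have x_ge0 : 0 <= x by rewrite exprn_ge0 // subr_ge0; case/andP: dl01.
have mulr_ge (a : R) : 0 <= a -> a <= r%:R * a by move=> a0; rewrite ler_peMl.
have Mpos : (0 : R) < M%:R by rewrite ltr0n.
have nu_ge0 : 0 <= nu by apply: divr_ge0 => //; exact: mulr_ge0.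
have b1 : r%:R * nu <= delta.
  by rewrite /nu !mulrA ler_pdivrMr // -expr2.
have b2 : r%:R * (r.+1%:R * eta) <= delta.
  by move: eta_d; rewrite ler_pdivlMr ?mulr_gt0 // mulrC -mulrA.
have b3 : r%:R * x <= delta by exact: hr'.
have b4 : r%:R * (r%:R * (r%:R * beta)) <= delta by rewrite -betaE !exprS expr0 mulr1 !mulrA.
have b5 : r%:R * epsc = delta by rewrite /epsc mulrC divfK // gt_eqF.
have g1 := mulr_ge _ nu_ge0.
have re_ge0 : 0 <= r.+1%:R * eta by rewrite mulr_ge0 // ltW.
have g2 := mulr_ge _ re_ge0.
have g3 := mulr_ge _ x_ge0.
have rb : 0 <= r%:R * beta by rewrite mulr_ge0.
have g4 := mulr_ge _ rb.
have rrb : 0 <= r%:R * (r%:R * beta) by rewrite mulr_ge0.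
have g5 := mulr_ge _ rrb.
have g6 := mulr_ge _ (ltW epsc_gt0).
have eta_le : eta <= r.+1%:R * eta by rewrite ler_peMl ?ler1n // ltW.
have tauE : tau = 4 * (r%:R * nu) + 2 * (r%:R * (r%:R * beta)) + 3 * (r%:R * (r.+1%:R * eta))
   + 3 * (r%:R * x) + r%:R * (r%:R * (r%:R * beta)) + 4 * (r%:R * epsc).
  by rewrite /tau /mu0 /mu1 /c /u0; ring.
have dE : delta * 200 = d2 by rewrite /delta; field.
have tau_le : tau <= 17 * delta by rewrite tauE; lra.
have tau_lt1 : tau < 1 by lra.
have kap_le : kap <= P0 - 2 * (q / P0) - 2 * eps - 3 * eta - 2 * (nu + mu0 + (tau + c + nu + mu0)).
  rewrite -/d2 /kap /mu0 /c /u0; lra.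
have t_v : t ^+ 2 * expR t * v <= 1 by rewrite mulfV // gt_eqF.
have t_eta : 3 * r%:R + 1 <= t * eta by rewrite /t divfK // gt_eqF.
have loc z f := @local_majority R P0 q N M r' cm cd cd_inj eps v eta kap epsc vv t tp gam T
  q_ge0 P0_gt0 eps_gt0 v_gt0 M_gt0 theta_ge0 gap_ge0 gap (ltW eta_gt0) (ltW epsc_gt0) vv_gt0 T_large
  tau_lt1 kap_le (ltW t_gt0) (ltW tp_gt0) t_v tp_eta t_eta gam_le1 gam_le hM1 z f.
have cm0 := @cmu_ge0 _ _ _ _ cm.
have := Prb_has cm0 predT (fun (p : {ffun 'I_N -> bool} * 'I_N) w =>
  ~~ [exists h, majority cd kap p.1 h w && majority cd kap (flip p.1 p.2) h w]).
move=> hh; apply: le_trans (le_trans hh _).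
  apply: sub_Prb => // w; apply: contraNT; rewrite negb_exists => /forallP good.
  have [||h hh'] := @giant_of_majorities R P0 q N M r' cm cd kap w _ M_gt0 _ N_gt0.
  - by rewrite divr_ge0 // ltW.
  - move=> z f; apply/existsP; have := good (z, f); by rewrite /= negbK.
  by apply/existsP; exists h.
apply: le_trans (union_bound r'3 rMN N2 M_gt0 hM3).
apply: le_trans (ler_sum _ (fun p _ => loc p.1 p.2)) _.
rewrite sumr_const card_prod card_ffun card_bool !card_ord -[leLHS]mulr_natl natrM natrX.
exact: lexx.
Qed.

(** * Reduction to the coarse cube *)

Lemma PrE (R : realType) (G : sgraph) (M : bond_model R G) A : Pr M A = Prb (mass M) A.
Proof.
rewrite /Pr /Prb /Ex big_mkcond; apply: eq_bigr => H _.
by case: (A H); rewrite ?mulr1 ?mulr0.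
Qed.

Lemma edge_nonempty (G : sgraph) e : e \in edges G -> exists x, x \in e.
Proof. by case/imset2P => x y _ _ ->; exists x; rewrite !inE eqxx. Qed.

Section Window.
Variables (R : realType) (G : sgraph) (M : bond_model R G).
Hypothesis M_indep : one_independent M.
Local Notation mu := (mass M).

Definition window (U : {set vertex G}) (H : subgraph G) : subgraph G :=
  H :&: [set e in edges G | e \subset U].

Lemma window_sub (U U' : {set vertex G}) (H : subgraph G) : U \subset U' -> window U (window U' H) = window U H.
Proof.
move=> UU'; rewrite /window -setIA; congr (_ :&: _); apply/setIidPr/subsetP => e.
by rewrite !inE => /andP[-> /subset_trans->].
Qed.

(** Edges inside disjoint vertex sets share no vertex, and the two edge sets are disjoint because
    edges are nonempty; this turns 1-independence into a statement about vertex sets. *)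
Lemma window_indep (U1 U2 : {set vertex G}) : [disjoint U1 & U2] -> forall A1 A2,
  Prb mu (fun H => (window U1 H == A1) && (window U2 H == A2)) =
  Prb mu (fun H => window U1 H == A1) * Prb mu (fun H => window U2 H == A2).
Proof.
move=> dU A1 A2; rewrite -!PrE; apply: M_indep.
- by apply/subsetP => e; rewrite inE => /andP[].
- by apply/subsetP => e; rewrite inE => /andP[].
- rewrite -setI_eq0; apply/eqP/setP => e; rewrite !inE; apply/negP.
  move=> /andP[/andP[/edge_nonempty[x xe] /subsetP e1] /andP[_ /subsetP e2]].
  by have := disjointFr dU (e1 _ xe); rewrite e2.
- move=> e f; rewrite !inE => /andP[_ eU] /andP[_ fU].
  exact: disjointWl eU (disjointWr fU dU).
Qed.

Lemma window_edge (U e : {set vertex G}) : e \in edges G -> e \subset U -> dep window U (fun H => e \in H).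
Proof. by move=> eG eU H; rewrite !inE eG eU !andbT. Qed.

End Window.

(** * Restriction of a model to an embedded graph *)

Section Pullback.
Variables (R : realType) (G' G : sgraph) (g : vertex G' -> vertex G).
Hypothesis g_inj : injective g.
Hypothesis g_adj : forall x y, adj G' x y -> adj G (g x) (g y).
Variables (M : bond_model R G) (p : R).
Hypothesis M_in : one_independent_ge p M.
Local Notation mu := (mass M).

Lemma image_edge e : e \in edges G' -> g @: e \in edges G.
Proof.
case/imset2P => x y _; rewrite inE => /andP[_ xy] ->.
rewrite imsetU !imset_set1; apply/imset2P; exists (g x) (g y) => //.
by rewrite !inE g_adj.
Qed.

Definition pull (H : subgraph G) : subgraph G' := [set e in edges G' | g @: e \in H].

Lemma pull_window (U : {set vertex G}) H : (forall x, g x \in U) -> pull (window U H) = pull H.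
Proof.
move=> gU; apply/setP => e; rewrite !inE; case: (boolP (e \in edges G')) => //= eG.
rewrite image_edge //= (_ : g @: e \subset U) ?andbT //.
by apply/subsetP => y /imsetP[x _ ->].
Qed.

Lemma pull_connect H x y :
  connect (sub_adj (pull H)) x y -> connect (sub_adj H) (g x) (g y).
Proof.
move/connectP => [s sp ->]; apply/connectP; exists (map g s); last by rewrite last_map.
elim: s x sp => //= z s IH x /andP[xz sp]; rewrite IH // andbT.
move: xz; rewrite /sub_adj inE imsetU !imset_set1 => /and3P[nxz _ ->].
by rewrite (inj_eq g_inj) nxz.
Qed.

Definition pull_mass : {ffun subgraph G' -> R} := [ffun H' => Prb mu (fun H => pull H == H')].

Lemma pull_massE A : \sum_(H' | A H') pull_mass H' = Prb mu (fun H => A (pull H)).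
Proof.
under eq_bigr do rewrite ffunE.
rewrite exchange_big; apply: eq_bigr => H _ /=; rewrite -big_distrr /=; congr (_ * _).
rewrite big_mkcond (bigD1 (pull H)) //= eqxx big1 ?addr0; first by case: (A _).
by move=> H' ne; rewrite eq_sym (negbTE ne); case: ifP.
Qed.

Lemma pull_mass_ge0 H : 0 <= pull_mass H.
Proof. by rewrite ffunE; apply: Prb_ge0; exact: mass_ge0. Qed.

Lemma pull_mass_sum1 : \sum_H' pull_mass H' = 1.
Proof.
rewrite pull_massE -(mass_sum1 M); apply: eq_bigr => H _; by rewrite mulr1.
Qed.

Lemma pull_mass_supp H' : pull_mass H' != 0 -> H' \subset edges G'.
Proof.
apply: contraNT => nsub; rewrite ffunE; apply/eqP.
rewrite /Prb /Ex big1 // => H _; case: eqP => [e|]; last by rewrite mulr0.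
by case/negP: nsub; rewrite -e; apply/subsetP => e'; rewrite inE => /andP[].
Qed.

Definition pull_model : bond_model R G' := BondModel pull_mass_ge0 pull_mass_sum1 pull_mass_supp.

Lemma Pr_pull A : Pr pull_model A = Prb mu (fun H => A (pull H)).
Proof. exact: pull_massE. Qed.

Lemma pull_model_in : one_independent_ge p pull_model.
Proof.
have [M_indep M_ge] := M_in; split; last first.
  move=> e eG; rewrite Pr_pull; apply: le_trans (M_ge _ (image_edge eG)) _.
  rewrite PrE; apply: sub_Prb => [|H]; first exact: mass_ge0.
  by rewrite inE eG.
move=> S1 S2 S1G S2G _ dS A1 A2; rewrite !Pr_pull.
pose U (S : {set {set vertex G'}}) := g @: cover S.
have depS (S A : {set {set vertex G'}}) : S \subset edges G' ->
    dep (@window G) (U S) (fun H => (pull H :&: S == A)%:R : R).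
  move=> SG H; congr (_ == A)%:R; apply/setP => e; rewrite !inE.
  case: (boolP (e \in S)) => eS; rewrite ?andbF // !andbT.
  have eG := subsetP SG _ eS; rewrite eG image_edge //= (_ : g @: e \subset _) ?andbT //.
  by apply: imsetS; exact: bigcup_sup.
have dU : [disjoint U S1 & U S2].
  rewrite -setI_eq0 /U -imsetI; last by move=> x y _ _; exact: g_inj.
  apply/eqP/setP => x; rewrite inE; apply/negP => /imsetP[y + _].
  rewrite inE => /andP[/bigcupP[e eS ye] /bigcupP[f fS yf]].
  by have := disjointFr (dS _ _ eS fS) ye; rewrite yf.
rewrite /Prb -(Ex_indep (window_indep M_indep) dU (depS _ A1 S1G) (depS _ A2 S2G)).
by apply: eq_Ex => H; rewrite -natrM mulnb.
Qed.

End Pullback.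

(** * Copies of the small cube as vertices of the coarse cube *)

Section Reduction.
Variables (R : realType) (p P : R) (k N : nat) (M : bond_model R (hypercube (N + k))).
Hypothesis hconn : forall M' : bond_model R (hypercube k), one_independent_ge p M' ->
  P <= Pr M' (fun H => connected_subgraph H).
Hypothesis M_in : one_independent_ge p M.
Local Notation V := {ffun 'I_N -> bool}.
Local Notation F := {ffun 'I_k -> bool}.
Local Notation vtx := {ffun 'I_(N + k) -> bool}.
Local Notation Q := (hypercube (N + k)).
Local Notation mu := (mass M).

Definition emb (u : V) (y : F) : vtx :=
  [ffun c => match split c with inl i => u i | inr j => y j end].

Lemma emb_l u y i : emb u y (lshift k i) = u i.
Proof. by rewrite ffunE; case: split_ordP => j; [move/lshift_inj-> | move/eqP; rewrite eq_lrshift]. Qed.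

Lemma emb_r u y j : emb u y (rshift N j) = y j.
Proof. by rewrite ffunE; case: split_ordP => i; [move/eqP; rewrite eq_rlshift | move/rshift_inj->]. Qed.

Lemma emb_inj u y u' y' : emb u y = emb u' y' -> u = u' /\ y = y'.
Proof.
move/ffunP => e; split; apply/ffunP => i.
  by have := e (lshift k i); rewrite !emb_l.
by have := e (rshift N i); rewrite !emb_r.
Qed.

Lemma cube_adj_flip n (v : {ffun 'I_n -> bool}) c : cube_adj v (flip v c).
Proof.
apply/cards1P; exists c; apply/setP => i; rewrite !inE ffunE.
by case: (v i); case: (i == c).
Qed.

Lemma emb_flip u c y : emb (flip u c) y = flip (emb u y) (lshift k c).
Proof.
apply/ffunP => d; rewrite !ffunE; case: split_ordP => i ->.
  by rewrite ffunE (inj_eq (@lshift_inj _ _)).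
by rewrite eq_rlshift addbF.
Qed.

Lemma emb_adj u (x y : vertex (hypercube k)) :
  adj (hypercube k) x y -> adj Q (emb u x) (emb u y).
Proof.
rewrite /= /cube_adj => /cards1P[c /setP hc]; apply/cards1P; exists (rshift N c).
apply/setP => d; rewrite !inE !ffunE; case: split_ordP => i ->.
  by rewrite eqxx eq_lrshift.
by have := hc i; rewrite !inE (inj_eq (@rshift_inj _ _)).
Qed.

Definition fibre (U : {set V}) : {set vertex Q} :=
  [set emb u y | u in U, y in [set: F]].

Lemma mem_fibre (U : {set V}) u y : (emb u y \in fibre U) = (u \in U).
Proof.
apply/imset2P/idP => [[u' y' u'U _ /emb_inj[-> _]] //|uU].
by exists u y.
Qed.

Definition cluster (v : V) (H : subgraph Q) : bool :=
  connected_subgraph (@pull (hypercube k) Q (emb v) H).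

(** Membership in [edges Q] is part of the event because [window] keeps genuine edges only and
    [bridge_dep] concerns every set [H]. *)
Definition bridge (u v : V) (H : subgraph Q) : bool :=
  [exists y : F, ([set emb u y; emb v y] \in edges Q) && ([set emb u y; emb v y] \in H)].

(** The all-false vertex represents its copy. In a connected copy any vertex would do, and on
    disconnected copies the relation is still an equivalence, as [coarse_model] requires. *)
Definition joined (H : subgraph Q) : rel V :=
  fun u v => connect (sub_adj H) (emb u [ffun=> false]) (emb v [ffun=> false]).

Lemma sub_adj_sym (G : sgraph) (H : subgraph G) : symmetric (sub_adj H).
Proof. by move=> x y; rewrite /sub_adj eq_sym setUC. Qed.

Lemma fibre_sub (U U' : {set V}) : U \subset U' -> fibre U \subset fibre U'.
Proof. by move=> UU'; apply: imset2S. Qed.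

Let inj_emb v : injective (emb v).
Proof. by move=> x y /emb_inj[]. Qed.

Let cres U H := window (fibre U) H.

Let cres_sub (U U' : {set V}) H : U \subset U' -> cres U (cres U' H) = cres U H.
Proof. by move=> UU'; apply: window_sub; exact: fibre_sub. Qed.

Let cres_indep (U1 U2 : {set V}) : [disjoint U1 & U2] -> forall A1 A2,
  Prb mu (fun H => (cres U1 H == A1) && (cres U2 H == A2)) =
  Prb mu (fun H => cres U1 H == A1) * Prb mu (fun H => cres U2 H == A2).
Proof.
move=> dU; apply: window_indep; first by case: M_in.
rewrite -setI_eq0; apply/eqP/setP => x; rewrite !inE; apply/negP => /andP[].
move=> /imset2P[u y uU _ ->]; rewrite mem_fibre => uU2.
by have := disjointFr dU uU; rewrite uU2.
Qed.

Let cluster_dep v : dep cres [set v] (cluster v).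
Proof.
move=> H; rewrite /cluster /cres (pull_window (@emb_adj v)) // => y.
by rewrite mem_fibre inE.
Qed.

Let bridge_dep u v : dep cres [set u; v] (bridge u v).
Proof.
move=> H; rewrite /bridge; apply: eq_existsb => y; rewrite !inE.
case: (boolP (_ \in edges Q)) => //= eQ; rewrite (_ : _ \subset _) ?andbT //.
by rewrite subUset !sub1set !mem_fibre !inE !eqxx orbT.
Qed.

Let cluster_prb v : P <= Prb mu (cluster v).
Proof.
have h := hconn (@pull_model_in R (hypercube k) Q (emb v) (inj_emb (v := v)) (@emb_adj v) M p M_in).
by apply: le_trans h _; rewrite Pr_pull.
Qed.

Let edge_flip (x : vertex Q) c : [set x; flip x c] \in edges Q.
Proof.
apply/imset2P; exists x (flip x c) => //.
by rewrite !inE; exact: cube_adj_flip.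
Qed.

(** The 2^k edges between two neighbouring copies form a matching, so 1-independence makes their
    states mutually independent. *)
Let bridge_prb v c : Prb mu (fun H => ~~ bridge v (flip v c) H) <= (1 - p) ^+ (2 ^ k).
Proof.
have [M_indep M_ge] := M_in.
pose e y : {set vertex Q} := [set emb v y; emb (flip v c) y].
have eQ y : e y \in edges Q by rewrite /e emb_flip; exact: edge_flip.
have -> : Prb mu (fun H => ~~ bridge v (flip v c) H) =
    Ex mu (fun H => \prod_(y : F) (e y \notin H)%:R).
  apply: eq_Ex => H; rewrite /bridge; case: existsP => [[y /andP[_ yH]]|no] /=.
    by rewrite (bigD1 y) //= yH mul0r.
  by rewrite big1 // => y _; case: (boolP (e y \in H)) => // yH; case: no; exists y; rewrite eQ.
rewrite (Ex_prod (mass_sum1 M) (@window_sub _) (window_indep M_indep) (U := e)); first last.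
- by move=> y _ H; rewrite (window_edge (eQ y) (subxx _)).
- move=> y y' _ _ yy'; rewrite -setI_eq0; apply/eqP/setP => x; rewrite !inE; apply/negP.
  by case/andP => /orP[]/eqP-> /orP[]/eqP/emb_inj[_ eyy]; move: yy'; rewrite eyy eqxx.
have -> : (2 ^ k)%N = #|{: F}| by rewrite card_ffun card_bool card_ord.
rewrite -prodr_const; apply: ler_prod => y _; apply/andP; split.
  by apply: Ex_ge0 => [|H]; [exact: mass_ge0 | rewrite ler0n].
have := PrbC (mass_sum1 M) (fun H => e y \in H); rewrite /Prb => ->.
by rewrite lerD2l lerN2; have := M_ge _ (eQ y); rewrite PrE.
Qed.

Let joined_sym H : symmetric (joined H).
Proof. by move=> u v; apply: sym_connect_sym; exact: sub_adj_sym. Qed.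

Let joined_trans H : transitive (joined H).
Proof. by move=> u v x; exact: connect_trans. Qed.

Let joined_edge H v c : cluster v H -> cluster (flip v c) H -> bridge v (flip v c) H ->
  joined H v (flip v c).
Proof.
move=> /forallP X1 /forallP X2 /existsP[y /andP[eQ yH]].
have c1 u : cluster u H -> forall x z, connect (sub_adj H) (emb u x) (emb u z).
  move=> /forallP X x z; apply: (@pull_connect (hypercube k) Q (emb u) (inj_emb (v := u))).
  by have /forallP := X x.
apply: connect_trans (c1 v _ _ y) _; first exact/forallP.
apply: connect_trans (c1 (flip v c) _ y _); last exact/forallP.
apply: connect1; rewrite /sub_adj yH andbT.
by apply/eqP => /emb_inj[/ffunP/(_ c)]; rewrite ffunE eqxx addbT; case: (v c).
Qed.

Definition cube_coarse : coarse_model P ((1 - p) ^+ (2 ^ k)) N :=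
  CoarseModel (@mass_ge0 _ _ M) (mass_sum1 M) cres_sub cres_indep cluster_dep bridge_dep
    cluster_prb bridge_prb (fun H u => connect0 _ _) joined_sym joined_trans joined_edge.

Lemma giant_component (C : R) (H : subgraph Q) :
  [exists u, C <= #|[set v | joined H u v]|%:R] -> [exists X in components H, C <= #|X|%:R].
Proof.
case/existsP => u hu; apply/exists_inP.
pose x : vertex Q := emb u [ffun=> false].
exists [set y in [set: vertex Q] | connect (sub_adj H) x y]; first by apply/imsetP; exists x.
apply: le_trans hu _; rewrite ler_nat.
have inj : injective (fun v => emb v [ffun=> false]) by move=> v v' /emb_inj[].
rewrite -(card_imset _ inj); apply: subset_leq_card; apply/subsetP => y /imsetP[v + ->].
by rewrite !inE.
Qed.

End Reduction.

(** With b = sqrt q, the roots of P^2 - b P - b^2 in P are b times the golden ratio and a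
    nonpositive number, so the form is positive. Dividing by P gives P - q/P > b; moreover P > b, so
    P^2 > b P + b^2 yields P^2 > 2 q. *)
Lemma golden_gap (R : realType) (P q : R) : 0 <= q -> Num.sqrt q * golden R < P ->
  [/\ 0 < P, q < (P - q / P) ^+ 2 & 0 < P - 2 * (q / P)].
Proof.
move=> q0; rewrite -{2 3 4}(sqr_sqrtr q0); set b := Num.sqrt q.
have b0 : 0 <= b by exact: sqrtr_ge0.
have s5 : Num.sqrt 5 ^+ 2 = 5 :> R by rewrite sqr_sqrtr.
have s2 : 2 <= Num.sqrt 5 :> R.
  by rewrite -(ler_pXn2r (n := 2)) ?nnegrE ?sqrtr_ge0 // s5; lra.
rewrite /golden; move: s5 s2; set s := Num.sqrt 5 => s5 s2 hP.
have P0 : 0 < P by apply: le_lt_trans hP; apply: mulr_ge0 => //; lra.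
have h1 : 0 < P ^+ 2 - b * P - b ^+ 2.
  have -> : P ^+ 2 - b * P - b ^+ 2 = (P - b * ((s + 1) / 2)) * (P + b * ((s - 1) / 2)).
    rewrite (_ : (P - _) * _ = P ^+ 2 - b * P - b ^+ 2 * ((s ^+ 2 - 1) / 4)); last by field.
    by rewrite s5; field.
  apply: mulr_gt0; first by rewrite subr_gt0.
  by apply: ltr_wpDr => //; apply: mulr_ge0 => //; lra.
have bP : b < P by nra.
split=> //.
  have hb : b < P - b ^+ 2 / P.
    rewrite -(ltr_pM2r P0) mulrBl divfK ?gt_eqF // -expr2; lra.
  by rewrite ltrXn2r ?nnegrE ?(ltW (le_lt_trans b0 hb)).
rewrite -(pmulr_lgt0 _ P0) mulrBl -mulrA divfK ?gt_eqF //; nra.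
Qed.

Theorem theorem1p9 (R : realType) (p : R) (k : nat) (P : R)
    (hp0 : 0 < p) (hp1 : p <= 1)
    (hP : (1 - p) `^ (2 `^ (k%:R - 1)) * golden R < P)
    (hconn : forall M : bond_model R (hypercube k), one_independent_ge p M ->
       P <= Pr M (fun H => connected_subgraph H)) :
  exists C : R, 0 < C /\
  exists c : R, 0 < c /\
  exists n0 : nat, forall n : nat, (n0 <= n)%N ->
  forall M : bond_model R (hypercube n), one_independent_ge p M ->
    1 - expR (- (c * n%:R ^+ 2)) <=
    Pr M (fun H => [exists X in components H, C * 2 ^+ n <= (#|X|)%:R]).
Proof.
set q := (1 - p) ^+ (2 ^ k).
have p1 : 0 <= 1 - p by rewrite subr_ge0.
have q0 : 0 <= q by exact: exprn_ge0.
(* The exponent is a real power, so the identity includes k = 0, where it is 1/2. *)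
have sq : Num.sqrt q = (1 - p) `^ (2 `^ (k%:R - 1)).
  have e : (1 - p) `^ (2 `^ (k%:R - 1)) ^+ 2 = q.
    rewrite -[X in X = _]powR_mulrn ?powR_ge0 // -powRrM.
    have -> : 2 `^ (k%:R - 1) * 2%:R = (2 ^ k)%N%:R :> R.
      rewrite -[X in _ * X](@powRr1 R 2) // -powRD; last by rewrite pnatr_eq0 implybT.
      by rewrite subrK powR_mulrn // natrX.
    by rewrite powR_mulrn.
  by rewrite -e sqrtr_sqr ger0_norm // powR_ge0.
rewrite -sq in hP; have [P0 gap1 gap2] := golden_gap q0 hP.
(* If P > 1 there is nothing to prove for n >= k: the restriction of a model to a copy of the small
   cube would be connected with probability above 1. *)
have [P1|P1] := lerP P 1; last first.
  exists 1; split=> //; exists 1; split=> //; exists k => n kn M; move: M; rewrite -(subnK kn) => M M_in.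
  pose cm := cube_coarse hconn M_in.
  have := le_trans (cX_prb cm [ffun=> false]) (Prb_le1 (@cmu_ge0 _ _ _ _ cm) (cmu_sum1 cm) _).
  by rewrite leNgt P1.
have [kap [kap0 [N0 hN]]] := coarse_giant P0 P1 q0 gap1 gap2.
(* Only one vertex of each copy is counted in the component, hence the loss of 2^k. *)
exists (kap / 2 ^+ k); split; first by rewrite divr_gt0 ?exprn_gt0.
(* For n >= 2 k, N = n - k is at least n/2, so N^2 >= n^2/4. *)
exists (1 / 4); split; first by rewrite divr_gt0.
exists (N0 + 2 * k)%N => n hn M M_in; have kn : (k <= n)%N by lia.
have [N nE] : exists N, n = (N + k)%N by exists (n - k)%N; rewrite subnK.
subst n; have hN0 : (N0 <= N)%N by lia.
have kN : (k <= N)%N by lia.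
pose big (H : subgraph (hypercube (N + k))) := [exists h, kap * 2 ^+ N <= #|[set u | joined H h u]|%:R].
have hbig : 1 - expR (- N%:R ^+ 2) <= Prb (mass M) big.
  have := hN N hN0 (cube_coarse hconn M_in).
  by have := PrbC (mass_sum1 M) big; rewrite /cube_coarse /= => ->; lra.
apply: (@le_trans _ _ (1 - expR (- N%:R ^+ 2))).
  rewrite lerD2l lerN2 ler_expR lerN2 natrD.
  have : k%:R <= N%:R :> R by rewrite ler_nat.
  have : 0 <= k%:R :> R by [].
  set x := k%:R; set y := N%:R => x0 xy.
  have : (y + x) ^+ 2 <= (2 * y) ^+ 2 by rewrite lerXn2r ?nnegrE; lra.
  by rewrite exprMn (_ : (2 : R) ^+ 2 = 4); [lra | ring].
apply: le_trans hbig _; rewrite PrE; apply: sub_Prb => [|H hH]; first exact: mass_ge0.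
apply: giant_component; rewrite (_ : _ * _ = kap * 2 ^+ N) //.
by rewrite exprD mulrA mulrAC divfK // expf_neq0 // pnatr_eq0.
Qed.
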